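(* Let $\Sigma_{3,0}$ be the three-holed sphere (pants) and $\Sigma_{1,1}$ the one-holed torus, each with a chosen orientation. Let $q:\Sigma_{3,0}\to\Sigma_{1,1}$ be the quotient map gluing the boundary components $b_1$ and $b_2$, and let $q^*:\mathbb{C}[\mathfrak{X}(\Sigma_{3,0})]\to\mathbb{C}[\mathfrak{X}(\Sigma_{1,1})]$ be the induced algebra homomorphism. Let $\{\,,\}_3$ and $\{\,,\}_1$ be the Poisson brackets on $\mathbb{C}[\mathfrak{X}(\Sigma_{3,0})]$ and $\mathbb{C}[\mathfrak{X}(\Sigma_{1,1})]$ determined by the chosen orientations. Then: (i) $q^*$ is a Poisson morphism or an anti-Poisson morphism, depending on the orientations: for all $f,g\in\mathbb{C}[\mathfrak{X}(\Sigma_{3,0})]$, $$\{q^*(f),q^*(g)\}_1=\varepsilon\, q^*\big(\{f,g\}_3\big),$$ where $\varepsilon=+1$ if $q$ is orientation preserving and $\varepsilon=-1$ if $q$ is orientation reversing (on the interior of $\Sigma_{3,0}$). (ii) $q^*$ is generically rank preserving: with $\mathcal{Q}=q^*(\mathbb{C}[\mathfrak{X}(\Sigma_{3,0})])$, at a generic point of $\mathfrak{X}$ (i.e. on a dense open subset) one has $$\mathrm{rank}\big(\mathfrak{a}(\Sigma_{1,1})|_{\mathcal{Q}}\big)=\mathrm{rank}\big(\mathfrak{a}(\Sigma_{3,0})\big).$$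
   Context: **Character variety.** Let $G=\mathrm{SL}(3,\mathbb{C})$ and let $F_2=\langle x_1,x_2\rangle$ be the free group of rank 2. The representation variety $\mathrm{Hom}(F_2,G)\cong G\times G$ carries the conjugation action of $G$, and $\mathfrak{X}=\mathrm{Hom}(F_2,G)/\!\!/G=\mathrm{Spec}\big(\mathbb{C}[\mathrm{Hom}(F_2,G)]^{G}\big)$ is the categorical quotient, an irreducible affine variety of dimension 8. Its coordinate ring $\mathbb{C}[\mathfrak{X}]$ is generated by trace functions $\mathrm{tr}(\rho(w))$, $w\in F_2$. Specifically, it is generated by the nine functions $t_{(1)}=\mathrm{tr}\,\rho(x_1)$, $t_{(-1)}=\mathrm{tr}\,\rho(x_1^{-1})$, $t_{(2)}=\mathrm{tr}\,\rho(x_2)$, $t_{(-2)}=\mathrm{tr}\,\rho(x_2^{-1})$, $t_{(3)}=\mathrm{tr}\,\rho(x_1x_2)$, $t_{(-3)}=\mathrm{tr}\,\rho(x_1^{-1}x_2^{-1})$, $t_{(4)}=\mathrm{tr}\,\rho(x_1x_2^{-1})$, $t_{(-4)}=\mathrm{tr}\,\rho(x_1^{-1}x_2)$, $t_{(5)}=\mathrm{tr}\,\rho(x_1x_2x_1^{-1}x_2^{-1})$. **Surfaces.** $\pi_1(\Sigma_{3,0})=\langle b_1,b_2,b_3\mid b_1b_2b_3=1\rangle$ is identified with $F_2$ by $x_1=b_1$, $x_2=b_2$, where the $b_i$ are the boundary curves. $\pi_1(\Sigma_{1,1})=\langle\alpha,\beta,\gamma\mid[\alpha,\beta]\gamma=1\rangle$,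 where $[\alpha,\beta]=\alpha\beta\alpha^{-1}\beta^{-1}$ and $\gamma$ is the boundary curve, is identified with $F_2$ by $x_1=\alpha$, $x_2=\beta$. Write $\mathfrak{X}(\Sigma)$ for $\mathfrak{X}$ viewed as $\mathrm{Hom}(\pi_1(\Sigma),G)/\!\!/G$ and equipped with the Poisson structure below. **Poisson bracket.** For an oriented compact surface $\Sigma$ with boundary, $\mathbb{C}[\mathfrak{X}(\Sigma)]$ has a Poisson bracket (a Lie bracket that is a derivation in each argument) given on trace functions by $$\{\mathrm{tr}(\rho(\alpha)),\mathrm{tr}(\rho(\beta))\}=\sum_{p\in\alpha\cap\beta}\epsilon(p,\alpha,\beta)\Big(\mathrm{tr}(\rho(\alpha_p\beta_p))-\tfrac13\mathrm{tr}(\rho(\alpha))\,\mathrm{tr}(\rho(\beta))\Big).$$ Here $\alpha,\beta\in\pi_1(\Sigma)$ are represented by loops meeting only in transverse double points, $\epsilon(p,\alpha,\beta)=\pm1$ is the oriented intersection number at $p$, and $\alpha_p,\beta_p\in\pi_1(\Sigma,p)$ are the loops based at $p$. Reversing the orientation of $\Sigma$ multiplies the bracket by $-1$. **The quotient map.** $q:\Sigma_{3,0}\to\Sigma_{1,1}$ identifies the boundary components $b_1$ and $b_2$ so that the result is the (orientable) one-holed torus. It is an embedding on the interior and induces the injection $q_\sharp:\pi_1(\Sigma_{3,0})\to\pi_1(\Sigma_{1,1})$, $b_1\mapsto\alpha$, $b_2\mapsto\beta\alpha^{-1}\beta^{-1}$, $b_3\mapsto[\alpha,\beta]^{-1}$.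 Hence it induces $q_*:\mathfrak{X}(\Sigma_{1,1})\to\mathfrak{X}(\Sigma_{3,0})$, $[(A,B)]\mapsto[(A,BA^{-1}B^{-1})]$, and $q^*(f)=f\circ q_*$. **Rank.** $\mathfrak{a}(\Sigma)$ denotes the Poisson bi-vector of $\mathfrak{X}(\Sigma)$. The rank of $\mathfrak{a}(\Sigma_{3,0})$ at a point is the rank of the $9\times 9$ antisymmetric matrix $\big(\{t_{(i)},t_{(j)}\}_3\big)_{i,j}$, $i,j\in\{\pm1,\pm2,\pm3,\pm4,5\}$, evaluated at that point. The rank of $\mathfrak{a}(\Sigma_{1,1})|_{\mathcal{Q}}$ at a point is the rank of the matrix $\big(\{q^*(t_{(i)}),q^*(t_{(j)})\}_1\big)_{i,j}$ evaluated at that point. *)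

(* Defs.v *)
From HB Require Import structures.
From mathcomp Require Import all_boot all_order all_algebra.
From mathcomp Require Import complex zify ring lra.
From mathcomp Require Import all_classical all_reals all_analysis.

Set Implicit Arguments.
Unset Strict Implicit.
Unset Printing Implicit Defensive.

Import Order.TTheory GRing.Theory Num.Theory.
Import numFieldNormedType.Exports.

Local Open Scope classical_set_scope.
Local Open Scope ring_scope.

(** * The group SL(3, C) *)

Record SL3 (R : realType) :=
  MkSL3 { SL3_mx :> 'M[R[i]]_3; SL3_det : \det SL3_mx == 1 }.

Section SpecialLinearGroup.
Variable R : realType.
Implicit Types A B : SL3 R.

HB.instance Definition _ := [isSub for @SL3_mx R].
HB.instance Definition _ := [Choice of SL3 R by <:].

Fact SL3_one_subproof : \det (1%:M : 'M[R[i]]_3) == 1.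
Proof. by rewrite det1. Qed.

Fact SL3_mul_subproof A B : \det (SL3_mx A *m SL3_mx B) == 1.
Proof. by rewrite det_mulmx (eqP (SL3_det A)) (eqP (SL3_det B)) mulr1. Qed.

Fact SL3_inv_subproof A : \det (\adj (SL3_mx A)) == 1.
Proof.
have := congr1 determinant (mul_mx_adj (SL3_mx A)).
by rewrite det_mulmx (eqP (SL3_det A)) mul1r det1 => ->.
Qed.

Definition SL3_one := MkSL3 SL3_one_subproof.
Definition SL3_mul A B := MkSL3 (SL3_mul_subproof A B).
(* The adjugate is the inverse because the determinant is 1. *)
Definition SL3_inv A := MkSL3 (SL3_inv_subproof A).

Fact SL3_mulA : associative SL3_mul.
Proof. by move=> A B D; apply: val_inj; rewrite /= mulmxA. Qed.
Fact SL3_mul1g : left_id SL3_one SL3_mul.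
Proof. by move=> A; apply: val_inj; rewrite /= mul1mx. Qed.
Fact SL3_mulg1 : right_id SL3_one SL3_mul.
Proof. by move=> A; apply: val_inj; rewrite /= mulmx1. Qed.
Fact SL3_mulVg : left_inverse SL3_one SL3_inv SL3_mul.
Proof.
by move=> A; apply: val_inj; rewrite /= mul_adj_mx (eqP (SL3_det A)).
Qed.
Fact SL3_mulgV : right_inverse SL3_one SL3_inv SL3_mul.
Proof.
by move=> A; apply: val_inj; rewrite /= mul_mx_adj (eqP (SL3_det A)).
Qed.

HB.instance Definition _ :=
  isGroup.Build (SL3 R) SL3_mulA SL3_mul1g SL3_mulg1 SL3_mulVg SL3_mulgV.
HB.instance Definition _ := isPointed.Build (SL3 R) (1%g : SL3 R).

Lemma SL3_1E : SL3_mx (1%g : SL3 R) = 1%:M. Proof. by []. Qed.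
Lemma SL3_mulE A B : SL3_mx (A * B)%g = SL3_mx A *m SL3_mx B. Proof. by []. Qed.
Lemma SL3_invE A : SL3_mx A^-1%g = \adj (SL3_mx A). Proof. by []. Qed.

End SpecialLinearGroup.

(** * Words in the free group F_2 and representations *)

Inductive gen := X1 | X2.

(* [(x, false)] stands for the generator [x] and [(x, true)] for its inverse.
   Words are not required to be reduced: a word denotes an element of F_2. *)
Definition word := seq (gen * bool).

Definition winv (w : word) : word := [seq (l.1, ~~ l.2) | l <- rev w].

(* Hom(F_2, SL(3, C)), a representation being given by the images [(A, B)] of
   [X1] and [X2]. *)
Definition rep (R : realType) : Type := (SL3 R * SL3 R)%type.

Section CharacterVariety.
Variable R : realType.
Local Notation C := (R[i]).
Local Notation rep := (rep R).
Implicit Types (rho : rep) (w : word).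

HB.instance Definition _ := Pointed.on rep.

Definition eval_letter rho (l : gen * bool) : SL3 R :=
  let g := if l.1 is X1 then rho.1 else rho.2 in if l.2 then (g^-1)%g else g.

Definition eval rho w : SL3 R := \big[*%g/1%g]_(l <- w) eval_letter rho l.

Definition conj_rep (g : SL3 R) rho : rep :=
  ((g * rho.1 * g^-1)%g, (g * rho.2 * g^-1)%g).

Lemma eval_nil rho : eval rho [::] = 1%g.
Proof. by rewrite /eval big_nil. Qed.

Lemma eval_cons rho l w : eval rho (l :: w) = (eval_letter rho l * eval rho w)%g.
Proof. by rewrite /eval big_cons. Qed.

Lemma eval_conj g rho w : eval (conj_rep g rho) w = (g * eval rho w * g^-1)%g.
Proof.
elim: w => [|l w IH]; first by rewrite !eval_nil mulg1 mulgV.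
rewrite !eval_cons IH; case: l => -[] [] /=;
  by rewrite /eval_letter /= ?invgM ?invgK !mulgA mulgVK.
Qed.

(* The ring C[Hom(F_2, SL(3, C))] of regular functions: the polynomial
   functions in the matrix entries of the two generators. *)
Inductive regular : (rep -> C) -> Prop :=
| regular_cst (c : C) : regular (cst c)
| regular_fst i j : regular (fun rho => SL3_mx rho.1 i j)
| regular_snd i j : regular (fun rho => SL3_mx rho.2 i j)
| regular_add (p q : rep -> C) : regular p -> regular q -> regular (p + q)
| regular_mul (p q : rep -> C) : regular p -> regular q -> regular (p * q).

Definition invariant (f : rep -> C) :=
  forall (g : SL3 R) rho, f (conj_rep g rho) = f rho.

Definition invariant_regular : {pred rep -> C} :=
  fun f => `[< regular f /\ invariant f >].

Fact invariant_regular_subring : subring_closed invariant_regular.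
Proof.
have regN f : regular f -> regular (- f).
  move=> rf; rewrite -mulN1r; apply: regular_mul => //.
  by rewrite [-1](_ : _ = cst (-1)); [exact: regular_cst|exact/funext].
split=> [|f g|f g].
- by apply/asboolP; split; [exact: regular_cst|].
- move=> /asboolP[rf if_] /asboolP[rg ig]; apply/asboolP; split.
    by apply: regular_add => //; exact: regN.
  by move=> h rho; rewrite !fctE if_ ig.
- move=> /asboolP[rf if_] /asboolP[rg ig]; apply/asboolP; split.
    exact: regular_mul.
  by move=> h rho; rewrite !fctE if_ ig.
Qed.
HB.instance Definition _ :=
  GRing.isSubringClosed.Build _ invariant_regular invariant_regular_subring.

Fact invariant_regular_scale : GRing.scaler_closed invariant_regular.
Proof.
move=> c f /asboolP[rf if_]; apply/asboolP; split.
  by apply: (regular_mul (regular_cst c)).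
by move=> h rho; rewrite !fctE if_.
Qed.
HB.instance Definition _ :=
  GRing.isScaleClosed.Build C _ invariant_regular invariant_regular_scale.

(* The coordinate ring C[X] of the categorical quotient
   X = Hom(F_2, SL(3, C)) // SL(3, C). *)
Record CX := MkCX { CX_fun :> rep -> C; CX_mem : CX_fun \in invariant_regular }.

HB.instance Definition _ := [isSub for CX_fun].
HB.instance Definition _ := [Choice of CX by <:].
HB.instance Definition _ := [SubChoice_isSubComNzRing of CX by <:].
HB.instance Definition _ := [SubZmodule_isSubLmodule of CX by <:].
Fact CX_scalerAl (c : C) (f g : CX) : c *: (f * g) = (c *: f) * g.
Proof.
by apply: val_inj; apply/funext => rho; exact: mulrA.
Qed.
HB.instance Definition _ := GRing.Lmodule_isLalgebra.Build C CX CX_scalerAl.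
HB.instance Definition _ := GRing.Lalgebra_isComAlgebra.Build C CX.

Lemma regular_sum n (F : 'I_n -> rep -> C) :
  (forall i, regular (F i)) -> regular (fun rho => \sum_i F i rho).
Proof.
move=> rF; rewrite -[X in regular X]fct_sumE.
elim/big_rec: _ => [|i f _ rf]; last exact: regular_add.
exact: (regular_cst 0).
Qed.

Lemma regular_prod n (F : 'I_n -> rep -> C) :
  (forall i, regular (F i)) -> regular (fun rho => \prod_i F i rho).
Proof.
move=> rF; rewrite -[X in regular X]fct_prodE.
elim/big_rec: _ => [|i f _ rf]; last exact: regular_mul.
exact: (regular_cst 1).
Qed.

Lemma regular_det n (F : rep -> 'M[C]_n) :
  (forall i j, regular (fun rho => F rho i j)) ->
  regular (fun rho => \det (F rho)).
Proof.
move=> rF; rewrite /determinant -[X in regular X]fct_sumE.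
elim/big_rec: _ => [|s f _ rf]; first exact: (regular_cst 0).
apply: regular_add => //; apply: (regular_mul (regular_cst _)).
exact: regular_prod.
Qed.

Lemma regular_eval_letter l i j :
  regular (fun rho => SL3_mx (eval_letter rho l) i j).
Proof.
have adj (F : rep -> SL3 R) :
    (forall i j, regular (fun rho => SL3_mx (F rho) i j)) ->
    regular (fun rho => SL3_mx (F rho)^-1%g i j).
  move=> rF; under eq_fun do rewrite SL3_invE mxE /cofactor.
  apply: (regular_mul (regular_cst _)); apply: regular_det => k m.
  by under eq_fun do rewrite !mxE.
case: l => -[] []; rewrite /eval_letter /=; try apply: adj => k m;
  by [exact: regular_fst|exact: regular_snd].
Qed.

Lemma regular_eval w i j : regular (fun rho => SL3_mx (eval rho w) i j).
Proof.
elim: w i j => [|l w IH] i j.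
  by under eq_fun do rewrite eval_nil SL3_1E; exact: regular_cst.
under eq_fun do rewrite eval_cons SL3_mulE mxE.
apply: regular_sum => k; apply: regular_mul; last exact: IH.
exact: regular_eval_letter.
Qed.

Fact trX_subproof w :
  (fun rho => \tr (SL3_mx (eval rho w))) \in invariant_regular.
Proof.
apply/asboolP; split.
  by apply: regular_sum => i; exact: regular_eval.
move=> g rho; rewrite eval_conj !SL3_mulE -mulmxA mxtrace_mulC -mulmxA.
by rewrite -SL3_mulE mulVg SL3_1E mulmx1.
Qed.

Definition trX w : CX := MkCX (trX_subproof w).

(* t_(1), t_(-1), t_(2), t_(-2), t_(3), t_(-3), t_(4), t_(-4), t_(5) *)
Definition t_ (i : 'I_9) : CX :=
  let a : word := [:: (X1, false)] in let b : word := [:: (X2, false)] in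
  let a' := winv a in let b' := winv b in
  trX (nth [::] [:: a; a'; b; b'; a ++ b; a' ++ b'; a ++ b'; a' ++ b;
                   a ++ b ++ a' ++ b'] i).

(* Closed points of X = Spec C[X]. *)
Definition closed_point := {lrmorphism CX -> C | *%R}.

Definition zariski_open (U : set closed_point) :=
  exists S : set CX, U = [set x | exists2 f, S f & x f != 0].

Definition zariski_dense (U : set closed_point) :=
  forall V, zariski_open V -> V !=set0 -> U `&` V !=set0.

End CharacterVariety.

(** * Surfaces, loops and intersections *)

Definition plane (R : realType) : Type := (R * R)%type.

Section Surfaces.
Variable R : realType.
Local Notation plane := (plane R).

HB.instance Definition _ := NormedModule.on plane.

(* A surface presented as the quotient of a region of the plane by a group of
   translations preserving it, together with a marking: [marking x] is the
   sequence of steps of a polygonal path, based at the origin of the plane,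
   whose image in the surface is the based loop representing the generator [x]
   of pi_1 = F_2. *)
Record surface := Surface {
  region : set plane;
  deck : set plane;
  marking : gen -> seq plane }.

Definition holes : set plane := [set z | exists m n : int,
  (z.1 - m%:~R - 2^-1) ^+ 2 + (z.2 - n%:~R - 2^-1) ^+ 2 < 4^-1 ^+ 2].

Definition north : plane := (0, 1).
Definition east : plane := (1, 0).

(* The one-holed torus: R^2 / Z^2 minus the open disc of radius 1/4 centred at
   (1/2, 1/2), with X1 = alpha the vertical and X2 = beta the horizontal loop.
   The commutator [alpha, beta] runs once clockwise around the unit square. *)
Definition Sigma11 := Surface (~` holes)
  [set v | exists m n : int, v = (m%:~R, n%:~R)]
  (fun x => if x is X1 then [:: north] else [:: east]).

(* The three-holed sphere: the annulus [0, 1] x (R / Z) minus the same disc.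
   The boundary curve X1 = b_1 is the circle {0} x (R / Z) run upwards; X2 = b_2
   is the circle {1} x (R / Z) run downwards, joined to the base point by the
   horizontal segment; b_1 b_2 runs once clockwise around the unit square, hence
   it is the inverse of the boundary curve b_3 around the disc. *)
Definition Sigma30 := Surface ([set z | 0 <= z.1 <= 1] `\` holes)
  [set v | exists n : int, v = (0, n%:~R)]
  (fun x => if x is X1 then [:: north] else [:: east; - north; - east]).

Section OnSurface.
Variable S : surface.

(* Maps from R / Z to the surface, given by a continuous lift R -> plane. *)
Record loop := Loop {
  loop_fun :> R -> plane;
  period : plane;
  loop_continuous : continuous loop_fun;
  loop_region : forall s, region S (loop_fun s);
  loop_deck : deck S period;
  loop_periodic : forall s, loop_fun (s + 1) = loop_fun s + period }.

(* Free homotopy. The first coordinate of [H] is the time, which may range over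
   R because a homotopy on [0, 1] extends constantly; the displacement over one
   period is constant in time because [deck S] is discrete. *)
Definition homotopic (c d : loop) := exists (H : R * R -> plane) (v : plane),
  [/\ continuous H,
      forall z, region S (H z),
      forall s u, H (s, u + 1) = H (s, u) + period c,
      deck S v &
      forall u, H (0, u) = c u /\ H (1, u) = d u + v].

Definition steps (w : word) : seq plane :=
  flatten [seq if l.2 then [seq - v | v <- rev (marking S l.1)]
               else marking S l.1 | l <- w].

(* The polygonal path [0, 1] -> plane based at the origin with given steps, all
   run in the same time. *)
Definition polygon (vs : seq plane) (u : R) : plane :=
  \sum_(k < size vs)
     Num.max 0 (Num.min 1 ((size vs)%:R * u - k%:R)) *: nth 0 vs k.

(* The free homotopy class of the loop [c] is the conjugacy class of [w]. *)
Definition represents (c : loop) (w : word) := exists2 d : loop,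
  forall u, 0 <= u <= 1 -> d u = polygon (steps w) u & homotopic c d.

(* The pairs of parameters at which [c] and [d] meet in the surface. *)
Definition crossings (c d : loop) : set (R * R) :=
  [set p | [/\ 0 <= p.1 < 1, 0 <= p.2 < 1 & deck S (c p.1 - d p.2)]].

Definition det2 (u v : plane) : R := u.1 * v.2 - u.2 * v.1.

(* [c] and [d] meet in finitely many transverse double points: every point of
   the intersection lies on one branch of [c] and one branch of [d], which have
   linearly independent velocities there. Regularity away from the crossings is
   irrelevant to intersection numbers and homotopy classes. *)
Definition transverse (c d : loop) :=
  [/\ finite_set (crossings c d),
      forall p p', crossings c d p -> crossings c d p' ->
        deck S (c p.1 - c p'.1) -> p = p' &
      forall p, crossings c d p ->
        [/\ derivable c p.1 1, derivable d p.2 1 &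
            det2 ('D_1 c p.1) ('D_1 d p.2) != 0]].

(* The two orientations of a connected surface: [false] is the orientation
   inherited from the plane, [true] the opposite one. The sign below is +1 if
   the frame [(u, v)] is positive and -1 if it is negative. *)
Definition frame_sign (o : bool) (u v : plane) : int :=
  (-1) ^+ o * sgz (det2 u v).

(* Oriented intersection number at the crossing [p]. *)
Definition crossing_sign (o : bool) (c d : loop) (p : R * R) : int :=
  frame_sign o ('D_1 c p.1) ('D_1 d p.2).

(* [e] is the product of [c] and [d] as loops based at the crossing [p]: it
   runs along [c], then along the translate of the lift [d] that starts where
   the lift [c] ends. *)
Definition is_product (c d : loop) (p : R * R) (e : loop) :=
  forall u, (0 <= u <= 2^-1 -> e u = c (p.1 + 2 * u)) /\
    (2^-1 <= u <= 1 ->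
       e u = d (p.2 + (2 * u - 1)) + (c (p.1 + 1) - d p.2)).

Section Bracket.
Variables (o : bool) (br : CX R -> CX R -> CX R).

Definition product_formula := forall (c d : loop) (u v : word),
  represents c u -> represents d v -> transverse c d ->
  forall w : R * R -> word,
    (forall p, crossings c d p ->
       exists2 e, is_product c d p e & represents e (w p)) ->
  br (trX R u) (trX R v) =
    \sum_(p \in crossings c d)
       (trX R (w p) - 3^-1 *: (trX R u * trX R v)) *~ crossing_sign o c d p.

(* [br] is the Poisson bracket of C[X(S)] for the orientation [o]. *)
Record is_goldman_bracket : Prop := {
  goldman_linear : forall h, linear (br^~ h);
  goldman_antisym : forall f g, br f g = - br g f;
  goldman_jacobi : forall f g h,
    br f (br g h) + br g (br h f) + br h (br f g) = 0;
  goldman_leibniz : forall f g h, br (f * g) h = f * br g h + br f h * g;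
  goldman_formula : product_formula }.

End Bracket.
End OnSurface.

(** * The quotient map *)

(* The lift to the plane of the quotient map Sigma30 -> Sigma11, which glues
   (0, y) to (1, y). *)
Definition glue (z : plane) : plane := z.

Lemma glue_region z : region Sigma30 z -> region Sigma11 (glue z).
Proof. by case. Qed.

Lemma glue_fibre z z' : region Sigma30 z -> region Sigma30 z' ->
  deck Sigma11 (glue z - glue z') <->
  [\/ deck Sigma30 (z - z'),
      z.1 = 0 /\ z'.1 = 1 /\ deck Sigma30 (0, z.2 - z'.2) |
      z.1 = 1 /\ z'.1 = 0 /\ deck Sigma30 (0, z.2 - z'.2)].
Proof.
move=> [/= /andP[z0 z1] _] [/= /andP[z'0 z'1] _]; rewrite /glue; split.
  move=> [m [n [mE nE]]].
  have : (m <= 1) && (-1 <= m).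
    rewrite -(ler_int R) -(ler_int R (-1)) -mE rmorphN /= rmorph1.
    by apply/andP; lra.
  move=> /andP[m1 m'1].
  have [m0|m0|m0] : [\/ m = 0, m = 1 | m = -1].
    have /orP[/orP[/eqP|/eqP]|/eqP] : (m == 0) || (m == 1) || (m == -1) by lia.
    - by constructor 1.
    - by constructor 2.
    - by constructor 3.
  - by constructor 1; exists n; rewrite -nE [LHS]surjective_pairing /= mE m0.
  - have e : z.1 - z'.1 = 1 by rewrite mE m0.
    by constructor 3; do ! split; [lra|lra|exists n; rewrite -nE].
  - have e : z.1 - z'.1 = -1 by rewrite mE m0.
    by constructor 2; do ! split; [lra|lra|exists n; rewrite -nE].
case=> [[n nE]|[e [e' [n [nE]]]]|[e [e' [n [nE]]]]].
- by exists 0, n.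
- exists (-1), n; rewrite [z - z']surjective_pairing /= nE e e'.
  by rewrite sub0r rmorphN rmorph1.
- by exists 1, n; rewrite [z - z']surjective_pairing /= nE e e' subr0 rmorph1.
Qed.

Definition glue_preserves_orientation (o3 o1 : bool) :=
  forall z, (region Sigma30)° z -> forall u v : plane,
    frame_sign o1 ('d glue z u) ('d glue z v) = frame_sign o3 u v.

Definition glue_reverses_orientation (o3 o1 : bool) :=
  forall z, (region Sigma30)° z -> forall u v : plane,
    frame_sign o1 ('d glue z u) ('d glue z v) = - frame_sign o3 u v.

(* The homomorphism induced by the quotient map on fundamental groups; see
   [glue_marking]. *)
Definition q_sharp (x : gen) : word :=
  if x is X1 then [:: (X1, false)]
  else [:: (X2, false); (X1, true); (X2, true)].

Lemma glue_marking x :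
  [seq glue v | v <- marking Sigma30 x] = steps Sigma11 (q_sharp x).
Proof. by case: x. Qed.

Definition q_star (rho : rep R) : rep R :=
  (eval rho (q_sharp X1), eval rho (q_sharp X2)).

Lemma q_starE (A B : SL3 R) : q_star (A, B) = (A, (B * A^-1 * B^-1)%g).
Proof.
by rewrite /q_star /= !eval_cons eval_nil /eval_letter /= !mulg1 mulgA.
Qed.

Fact q_pull_subproof (f : CX R) : f \o q_star \in @invariant_regular R.
Proof.
have /asboolP[rf if_] := CX_mem f; apply/asboolP; split.
  elim: (CX_fun f) / rf => [c|i j|i j|g h _ rg _ rh|g h _ rg _ rh].
  - exact: regular_cst.
  - exact: regular_eval.
  - exact: regular_eval.
  - exact: regular_add.
  - exact: regular_mul.
move=> g rho /=; rewrite -(if_ g (q_star rho)); congr (CX_fun f _).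
by rewrite /q_star !eval_conj.
Qed.

Definition q_pull (f : CX R) : CX R := MkCX (q_pull_subproof f).

Fact q_pull_linear : linear q_pull.
Proof. by move=> c f g; apply: val_inj. Qed.
HB.instance Definition _ :=
  GRing.isLinear.Build R[i] (CX R) (CX R) _ q_pull q_pull_linear.
Fact q_pull_monoid : monoid_morphism q_pull.
Proof. by split=> [|f g]; apply: val_inj. Qed.
HB.instance Definition _ :=
  GRing.isMonoidMorphism.Build (CX R) (CX R) q_pull q_pull_monoid.

Section Statements.
Variables br3 br1 : CX R -> CX R -> CX R.

Definition poisson_morphism :=
  forall f g, br1 (q_pull f) (q_pull g) = q_pull (br3 f g).

Definition anti_poisson_morphism :=
  forall f g, br1 (q_pull f) (q_pull g) = - q_pull (br3 f g).

Definition rank30 (x : closed_point R) : nat :=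
  \rank (\matrix_(i < 9, j < 9) x (br3 (t_ R i) (t_ R j))).

Definition rank11_restricted (x : closed_point R) : nat :=
  \rank (\matrix_(i < 9, j < 9) x (br1 (q_pull (t_ R i)) (q_pull (t_ R j)))).

End Statements.
End Surfaces.

(* Main.v *)
(* Both brackets are biderivations, so it is enough to compare them on traces
   that generate the function field. Conjugating the first matrix to a diagonal
   one, every invariant function is seen to be rational in the eigenvalues and
   the nine traces; averaging over the orderings of the eigenvalues removes
   them. As the commutator trace t_(5) is a root of a quadratic polynomial over
   the eight others, a biderivation is determined by its values on these eight.
   The map [q_star] is not dominant, hence denominators must also be nonzero on
   its image, which is checked at an explicit pair.
   The eight traces are carried by explicit piecewise linear loops in the
   interior of the pair of pants, where the gluing map is injective: the loops of
   the boundary traces are disjoint from all others, and those of t_(4) and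
   t_(-4), a figure eight and its reverse, meet at two points of opposite signs.
   So the boundary traces are Casimirs, {t_(4), t_(-4)} is the difference of the
   traces of the two commutators up to sign, and the rank is 2 wherever this
   difference does not vanish. *)
From HB Require Import structures.
Require Import Defs.
From mathcomp Require Import all_boot all_order all_algebra.
From mathcomp Require Import complex zify ring lra.
From mathcomp Require Import all_classical all_reals all_analysis.

Set Implicit Arguments.
Unset Strict Implicit.
Unset Printing Implicit Defensive.

Import Order.TTheory GRing.Theory Num.Theory.
Import numFieldNormedType.Exports.

Local Open Scope classical_set_scope.
Local Open Scope ring_scope.

(** * The ring of regular functions is a domain *)

(** The brackets are known only through the product formula, so every value on generators needs
    loops whose free homotopy classes and crossings are proved. The geometry is therefore made
    integral, in units of 1/64, in which a hole has radius 16; the checks are run by computation and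
    proved sound once. A loop avoiding the glued circles has the same lift, class and crossings in
    both surfaces, so one computation serves both brackets and only the orientation sign differs. No
    bracket with t_(5) is ever computed from loops. The function field itself does not appear. Its
    role is played by a subring [K] of C[X], later the kernel of a derivation, from which a factor
    [D] can be cancelled; that this cancellation is legitimate rests on C[X] being a domain. *)

Section Domain.
Variable R : realType.
Local Notation C := (R[i]).

(** Scaling a single row keeps the entries rational in those of [M]; scaling the whole matrix would
    require a cube root. *)
Definition scale_row0 (M : 'M[C]_3) : 'M[C]_3 :=
  \matrix_(i, j) (if i == 0 then (\det M)^-1 * M i j else M i j).

Lemma scale_row0E (M : 'M[C]_3) :
  scale_row0 M = diag_mx (\row_i (if i == 0 then (\det M)^-1 else 1)) *m M.
Proof.
apply/matrixP => i j; rewrite mul_diag_mx !mxE.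
by case: eqP => _; rewrite ?mul1r.
Qed.

Lemma det_scale_row0 (M : 'M[C]_3) : \det M != 0 -> \det (scale_row0 M) == 1.
Proof.
move=> M0; rewrite scale_row0E det_mulmx det_diag !big_ord_recl big_ord0 !mxE /=.
by rewrite !mulr1 mulVf.
Qed.

(** Matching on [idP] provides the proof that [MkSL3] demands; singular matrices get the default
    value 1. *)
Definition normalize_det (M : 'M[C]_3) : SL3 R :=
  if @idP (\det M != 0) is ReflectT M0 then MkSL3 (det_scale_row0 M0)
  else SL3_one R.

Lemma normalize_detE (M : 'M[C]_3) :
  \det M != 0 -> SL3_mx (normalize_det M) = scale_row0 M.
Proof. by rewrite /normalize_det; case: {-}_ / idP. Qed.

Lemma normalize_det_id (A : SL3 R) : normalize_det (SL3_mx A) = A.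
Proof.
have detA := eqP (SL3_det A); apply: val_inj => /=.
rewrite normalize_detE ?detA ?oner_neq0//.
apply/matrixP => i j; rewrite mxE detA invr1 mul1r.
by case: ifP.
Qed.

Definition pencil (A0 A1 : SL3 R) : 'M[{poly C}]_3 :=
  map_mx polyC (SL3_mx A0) + 'X *: map_mx polyC (SL3_mx A1 - SL3_mx A0).

Lemma pencil_eval A0 A1 (t : C) i j :
  (pencil A0 A1 i j).[t] = (SL3_mx A0 + t *: (SL3_mx A1 - SL3_mx A0)) i j.
Proof. by rewrite !mxE !hornerE. Qed.

Definition pencil_at A0 A1 t : SL3 R :=
  normalize_det (SL3_mx A0 + t *: (SL3_mx A1 - SL3_mx A0)).

Lemma pencil_det A0 A1 (t : C) : (\det (pencil A0 A1)).[t] =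
  \det (SL3_mx A0 + t *: (SL3_mx A1 - SL3_mx A0)).
Proof.
rewrite -[LHS]horner_evalE -det_map_mx; congr (\det _).
by apply/matrixP => i j; rewrite mxE /= -pencil_eval.
Qed.

Lemma pencil_at0 A0 A1 : pencil_at A0 A1 0 = A0.
Proof. by rewrite /pencil_at scale0r addr0 normalize_det_id. Qed.

Lemma pencil_at1 A0 A1 : pencil_at A0 A1 1 = A1.
Proof. by rewrite /pencil_at scale1r addrC subrK normalize_det_id. Qed.

Lemma pencil_atE A0 A1 t i j : (\det (pencil A0 A1)).[t] != 0 ->
  (\det (pencil A0 A1)).[t] * SL3_mx (pencil_at A0 A1 t) i j =
  (if i == 0 then pencil A0 A1 i j else \det (pencil A0 A1) * pencil A0 A1 i j).[t].
Proof.
rewrite pencil_det => d0; rewrite normalize_detE// mxE.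
case: ifP => _; rewrite ?hornerM pencil_eval ?pencil_det//.
by rewrite mulrA divff// mul1r.
Qed.

(** Each matrix entry costs one determinant in the denominator; taking the product of both
    determinants as [d] gives the two matrices a common denominator, which sums and products
    preserve. *)
Lemma regular_pencil (r0 r1 : rep R) (F : rep R -> C) : regular F ->
  let d := \det (pencil r0.1 r1.1) * \det (pencil r0.2 r1.2) in
  exists n (P : {poly C}), forall t, d.[t] != 0 ->
    d.[t] ^+ n * F (pencil_at r0.1 r1.1 t, pencil_at r0.2 r1.2 t) = P.[t].
Proof.
move=> rF d; have dE : d = \det (pencil r0.1 r1.1) * \det (pencil r0.2 r1.2) by [].
clearbody d; elim: F / rF => [c|i j|i j|f g _ [n [P hP]] _ [m [Q hQ]]|f g _ [n [P hP]] _ [m [Q hQ]]].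
- by exists 0, c%:P => t _; rewrite hornerC mul1r.
- exists 1%N, ((\det (pencil r0.2 r1.2)) * (if i == 0 then pencil r0.1 r1.1 i j else \det (pencil r0.1 r1.1) * pencil r0.1 r1.1 i j)) => t.
  rewrite expr1 dE !hornerM mulf_eq0 negb_or => /andP[d1 d2].
  by rewrite -(pencil_atE i j d1) mulrCA mulrA.
- exists 1%N, ((\det (pencil r0.1 r1.1)) * (if i == 0 then pencil r0.2 r1.2 i j else \det (pencil r0.2 r1.2) * pencil r0.2 r1.2 i j)) => t.
  rewrite expr1 dE !hornerM mulf_eq0 negb_or => /andP[d1 d2].
  by rewrite -(pencil_atE i j d2) mulrA.
- exists (n + m)%N, (d ^+ m * P + d ^+ n * Q) => t dt.
  rewrite hornerD 2!hornerM !horner_exp -(hP _ dt) -(hQ _ dt) fctE exprD; set x := d.[t]; move: (f _) (g _) => y z; ring.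
- exists (n + m)%N, (P * Q) => t dt.
  by rewrite hornerM -(hP _ dt) -(hQ _ dt) fctE exprD mulrACA.
Qed.

(* Two points are joined by a rational curve along which regular functions
   are rational functions of one variable. *)
Lemma regular_domain (f g : rep R -> C) : regular f -> regular g ->
  (forall rho, f rho * g rho = 0) -> (forall rho, f rho = 0) \/ (forall rho, g rho = 0).
Proof.
move=> rf rg fg0; apply/or_asboolP; apply: contrapT => /negP.
rewrite negb_or => /andP[/asboolPn/existsNP[r0 f0] /asboolPn/existsNP[r1 g1]].
have [n [P hP]] := regular_pencil r0 r1 rf.
have [m [Q hQ]] := regular_pencil r0 r1 rg.
set d := _ * _ in hP hQ.
have d0 : d.[0] = 1.
  rewrite hornerM !pencil_det !scale0r !addr0.
  by rewrite (eqP (SL3_det r0.1)) (eqP (SL3_det r0.2)) mulr1.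
have d1 : d.[1] = 1.
  rewrite hornerM !pencil_det !scale1r ![_ + (_ - _)]addrC !subrK.
  by rewrite (eqP (SL3_det r1.1)) (eqP (SL3_det r1.2)) mulr1.
(* The factor [d] makes the product vanish at every scalar, including those where the pencil is
   singular. In characteristic 0 the natural numbers then give more roots than the degree allows. *)
clearbody d; have : d * (P * Q) = 0.
  apply/eqP/negPn/negP => nz.
  pose s := [seq (k%:R : C) | k <- iota 0 (size (d * (P * Q)))].
  have := max_poly_roots nz (rs := s).
  rewrite size_map size_iota ltnn => H; suff : false by [].
  apply: H; last first.
    by rewrite map_inj_uniq ?iota_uniq// => a b /eqP; rewrite eqr_nat => /eqP.
  apply/allP => t _; rewrite rootE !hornerM.
  have [->|dt] := eqVneq d.[t] 0; first by rewrite mul0r.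
  rewrite -hP// -hQ// mulrACA fg0 mulr0 mulr0//.
have : d != 0 by apply/eqP => dz; move: d0; rewrite dz horner0 => /eqP; rewrite eq_sym oner_eq0.
move=> /negPf dn /eqP; rewrite mulf_eq0 dn /= mulf_eq0 => /orP[/eqP P0|/eqP Q0].
- have := hP 0; rewrite d0 oner_eq0 P0 horner0 expr1n mul1r !pencil_at0 => /(_ isT).
  by rewrite -surjective_pairing.
- have := hQ 1; rewrite d1 oner_eq0 Q0 horner0 expr1n mul1r !pencil_at1 => /(_ isT).
  by rewrite -surjective_pairing.
Qed.

Lemma CX_regular (f : CX R) : regular f.
Proof. by have /asboolP[] := CX_mem f. Qed.

Lemma CX_invariant (f : CX R) : Defs.invariant f.
Proof. by have /asboolP[] := CX_mem f. Qed.

Lemma CX_eqP (f g : CX R) : (forall rho, f rho = g rho) -> f = g.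
Proof. by move=> fg; apply/val_inj/funext. Qed.

Lemma CX_mulf_eq0 (f g : CX R) : f * g = 0 -> f = 0 \/ g = 0.
Proof.
move=> fg0; have fg rho : f rho * g rho = 0.
  by have /(congr1 (fun h : CX R => h rho)) := fg0.
have [f0|g0] := regular_domain (CX_regular f) (CX_regular g) fg.
- by left; apply: CX_eqP.
- by right; apply: CX_eqP.
Qed.

End Domain.

(** * Diagonalization *)

Section Matrices3.
Variable F : comNzRingType.
Implicit Types M N : 'M[F]_3.

Definition i0 : 'I_3 := @Ordinal 3 0 isT.
Definition i1 : 'I_3 := @Ordinal 3 1 isT.
Definition i2 : 'I_3 := @Ordinal 3 2 isT.

Lemma ord3P (P : 'I_3 -> Prop) : P i0 -> P i1 -> P i2 -> forall i, P i.
Proof.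
move=> P0 P1 P2 [[|[|[|//]]] p].
- by rewrite (_ : Ordinal p = i0)//; apply: val_inj.
- by rewrite (_ : Ordinal p = i1)//; apply: val_inj.
- by rewrite (_ : Ordinal p = i2)//; apply: val_inj.
Qed.

Lemma sum3 (V : nmodType) (f : 'I_3 -> V) : \sum_i f i = f i0 + f i1 + f i2.
Proof.
rewrite !big_ord_recl big_ord0 addr0 addrA; congr (f _ + f _ + f _); exact: val_inj.
Qed.

Lemma mulmx3 (n p : nat) (M : 'M[F]_(n, 3)) (N : 'M[F]_(3, p)) i j :
  (M *m N) i j = M i i0 * N i0 j + M i i1 * N i1 j + M i i2 * N i2 j.
Proof. by rewrite mxE sum3. Qed.

Lemma mxtrace3 M : \tr M = M i0 i0 + M i1 i1 + M i2 i2.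
Proof. exact: sum3. Qed.

Lemma det2E (M : 'M[F]_2) : \det M = M 0 0 * M 1 1 - M 0 1 * M 1 0.
Proof.
rewrite (expand_det_row _ 0) !big_ord_recl big_ord0 addr0 /cofactor !det_mx11 !mxE /=.
rewrite expr0 expr1 mul1r mulN1r mulrN.
by congr (M _ _ * M _ _ - M _ _ * M _ _); apply: val_inj.
Qed.

(** With cyclic indices the cofactors of a 3 by 3 matrix carry no sign. *)
Definition next (i : 'I_3) : 'I_3 := if i == i0 then i1 else if i == i1 then i2 else i0.

Lemma cofactor3 M i j :
  cofactor M i j = M (next i) (next j) * M (next (next i)) (next (next j))
                 - M (next i) (next (next j)) * M (next (next i)) (next j).
Proof.
have [l00 l01] : lift i0 (0 : 'I_2) = i1 /\ lift i0 (1 : 'I_2) = i2.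
  by split; apply: val_inj.
have [l10 l11] : lift i1 (0 : 'I_2) = i0 /\ lift i1 (1 : 'I_2) = i2.
  by split; apply: val_inj.
have [l20 l21] : lift i2 (0 : 'I_2) = i0 /\ lift i2 (1 : 'I_2) = i1.
  by split; apply: val_inj.
rewrite /cofactor det2E -signr_odd !mxE.
by elim/ord3P: i; elim/ord3P: j; rewrite ?(l00, l01, l10, l11, l20, l21) /next /=
  ?expr0 ?expr1; ring.
Qed.

Lemma adj3 M i j :
  (\adj M) i j = M (next j) (next i) * M (next (next j)) (next (next i))
               - M (next j) (next (next i)) * M (next (next j)) (next i).
Proof. by rewrite mxE cofactor3. Qed.

Lemma det3 M : \det M =
  M i0 i0 * (M i1 i1 * M i2 i2 - M i1 i2 * M i2 i1)
  + M i0 i1 * (M i1 i2 * M i2 i0 - M i1 i0 * M i2 i2)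
  + M i0 i2 * (M i1 i0 * M i2 i1 - M i1 i1 * M i2 i0).
Proof. by rewrite (expand_det_row _ i0) sum3 !cofactor3 /next /=; ring. Qed.

Definition dg (a b c : F) : 'M[F]_3 :=
  \matrix_(i, j) (if i == j then (if i == i0 then a else if i == i1 then b else c) else 0).

Lemma dgE a b c i j : dg a b c i j =
  if i == j then (if i == i0 then a else if i == i1 then b else c) else 0.
Proof. by rewrite mxE. Qed.

Lemma adj_dg a b c : \adj (dg a b c) = dg (b * c) (a * c) (a * b).
Proof.
apply/matrixP => i j; rewrite adj3.
by elim/ord3P: i; elim/ord3P: j; rewrite /next !dgE /=; ring.
Qed.

Lemma det_dg a b c : \det (dg a b c) = a * b * c.
Proof. by rewrite det3 !dgE /=; ring. Qed.

Lemma mul_dg_mx a b c M i j :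
  (dg a b c *m M) i j = (if i == i0 then a else if i == i1 then b else c) * M i j.
Proof. by rewrite mulmx3 !dgE; elim/ord3P: i => /=; ring. Qed.

Lemma mul_mx_dg a b c M i j :
  (M *m dg a b c) i j = M i j * (if j == i0 then a else if j == i1 then b else c).
Proof. by rewrite mulmx3 !dgE; elim/ord3P: j => /=; ring. Qed.

End Matrices3.

Section Diagonalization.
Variable R : realType.
Local Notation C := (R[i]).

(* [mxtrace], pinned to one instance of the additive structure of [C] so that
   occurrences elaborated in different contexts match syntactically. *)
Definition tr3 (M : 'M[C]_3) : C := \tr M.

(* The eigenvalues of [A], by Vieta: as [\det A = 1], the second elementary
   symmetric function is the trace of the inverse. *)
Definition eigentriple (a b c : C) (A : SL3 R) :=
  [/\ a + b + c = tr3 (SL3_mx A), a * b + a * c + b * c = tr3 (SL3_mx A^-1%g) &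
      a * b * c = 1].

Lemma char_poly3 (A : SL3 R) (x : C) : (char_poly (SL3_mx A)).[x] =
  x ^+ 3 - tr3 (SL3_mx A) * x ^+ 2 + tr3 (SL3_mx A^-1%g) * x - 1.
Proof.
have -> : (char_poly (SL3_mx A)).[x] = \det (x%:M - SL3_mx A).
  rewrite -[LHS]horner_evalE -det_map_mx; congr (\det _).
  apply/matrixP => i j; rewrite !mxE /= /horner_eval !hornerE.
  by case: (i == j); rewrite ?hornerE.
suff -> : \det (x%:M - SL3_mx A) = x ^+ 3 - tr3 (SL3_mx A) * x ^+ 2 +
    tr3 (SL3_mx A^-1%g) * x - \det (SL3_mx A) by rewrite (eqP (SL3_det A)).
by rewrite SL3_invE /tr3 !mxtrace3 !adj3 !det3 /next !mxE /=; ring.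
Qed.

(** The values at 0, 1 and -1 already determine the three coefficients, since 2 is invertible. *)
Lemma vieta3 (t t' a b c : C) :
  (forall x, x ^+ 3 - t * x ^+ 2 + t' * x - 1 = (x - a) * (x - b) * (x - c)) ->
  [/\ a + b + c = t, a * b + a * c + b * c = t' & a * b * c = 1].
Proof.
move=> E; have E0 := E 0; have E1 := E 1; have E2 := E (-1).
have n2 : (2 : C) != 0 by rewrite pnatr_eq0.
have abc : a * b * c = 1.
  have -> : a * b * c = - ((0 - a) * (0 - b) * (0 - c)) by ring.
  by rewrite -E0; ring.
have H1 : 2 * (a + b + c) = 2 * t.
  have -> : 2 * (a + b + c) = - ((1 - a) * (1 - b) * (1 - c)
    + (-1 - a) * (-1 - b) * (-1 - c)) - 2 * (a * b * c) by ring.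
  by rewrite -E1 -E2 abc; ring.
have H2 : 2 * (a * b + a * c + b * c) = 2 * t'.
  have -> : 2 * (a * b + a * c + b * c) = ((1 - a) * (1 - b) * (1 - c)
    - (-1 - a) * (-1 - b) * (-1 - c)) - 2 by ring.
  by rewrite -E1 -E2; ring.
by split=> //; apply: (mulfI n2).
Qed.

Lemma eigentriple_ex (A : SL3 R) : exists a b c, eigentriple a b c A.
Proof.
have [rs] := closed_field_poly_normal (char_poly (SL3_mx A)).
rewrite (monicP (char_poly_monic _)) scale1r => pE.
have := size_char_poly (SL3_mx A); rewrite pE size_prod_XsubC => -[].
case: rs pE => [|a [|b [|c [|//]]]] // pE _; exists a, b, c.
apply: vieta3 => x.
by rewrite -char_poly3 pE !big_cons big_nil !hornerE /= mulr1.
Qed.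

Lemma eigentriple_root (A : SL3 R) a b c x : eigentriple a b c A ->
  (char_poly (SL3_mx A)).[x] = (x - a) * (x - b) * (x - c).
Proof. by move=> [e1 e2 e3]; rewrite char_poly3 -e1 -e2 -e3; ring. Qed.

Lemma eigentriple_eigenvector (A : SL3 R) a b c : eigentriple a b c A ->
  exists2 v : 'rV[C]_3, v != 0 & v *m SL3_mx A = a *: v.
Proof.
move=> abc; have : eigenvalue (SL3_mx A) a.
  by rewrite eigenvalue_root_char rootE (eigentriple_root _ abc) subrr !mul0r.
by move=> /eigenvalueP[v vA v0]; exists v.
Qed.

Lemma eigentriple_rot (A : SL3 R) a b c : eigentriple a b c A -> eigentriple b c a A.
Proof. by rewrite /eigentriple => -[<- <- abc]; split; [ring|ring|rewrite -abc; ring]. Qed.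

Lemma eigentriple_swap (A : SL3 R) a b c : eigentriple a b c A -> eigentriple b a c A.
Proof. by rewrite /eigentriple => -[<- <- abc]; split; [ring|ring|rewrite -abc; ring]. Qed.

Lemma diagonalize (A : SL3 R) a b c : eigentriple a b c A ->
  a != b -> a != c -> b != c ->
  exists g : SL3 R, SL3_mx (g * A * g^-1)%g = dg a b c.
Proof.
move=> abc ab ac bc.
have [u u0 uA] := eigentriple_eigenvector abc.
have [v v0 vA] := eigentriple_eigenvector (eigentriple_rot abc).
have [w w0 wA] := eigentriple_eigenvector (eigentriple_rot (eigentriple_rot abc)).
pose rw (i : 'I_3) := if i == i0 then u else if i == i1 then v else w.
pose G := \matrix_(i < 3) rw i.
have GA : G *m SL3_mx A = dg a b c *m G.
  apply/row_matrixP => i; rewrite row_mul rowK; apply/rowP => j.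
  rewrite [RHS]mxE mul_dg_mx [G i j]mxE.
  have -> : rw i *m SL3_mx A = (if i == i0 then a else if i == i1 then b else c) *: rw i.
    by elim/ord3P: i => /=; [exact: uA|exact: vA|exact: wA].
  by rewrite mxE.
(* If [z *m G = 0], then [z] times any polynomial in [dg a b c] is also killed by [G]. The quadratic
   vanishing at two of the eigenvalues isolates one coordinate of [z] times a nonzero
   eigenvector. *)
have Gu : G \in unitmx.
  rewrite -row_free_unit; apply: inj_row_free => z zG.
  have zD (y : 'rV_3) : y *m G = 0 -> y *m dg a b c *m G = 0.
    by move=> yG; rewrite -mulmxA -GA mulmxA yG mul0mx.
  have z1 := zD _ zG; have z2 := zD _ z1.
  have key p q (Y : 'rV[C]_3) : Y = z *m dg a b c *m dg a b c - p *: (z *m dg a b c) + q *: z ->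
     Y *m G = 0.
    by move=> ->; rewrite mulmxDl mulmxBl -!scalemxAl z2 z1 zG !scaler0 subr0 addr0.
  have kk (x : 'rV[C]_3) (i : 'I_3) (k : C) : k *: x = 0 -> k != 0 -> x != 0 -> False.
    by move=> /eqP; rewrite scaler_eq0 => /orP[/eqP->|/eqP->]; rewrite eqxx.
  have nz (x y : C) : x != y -> x - y != 0 by rewrite subr_eq0.
  have E (i : 'I_3) p q k : k != 0 ->
      (forall j, (z *m dg a b c *m dg a b c - p *: (z *m dg a b c) + q *: z) 0 j =
        if j == i then k * z 0 i else 0) -> z 0 i = 0.
    move=> k0 H; have := key p q _ erefl.
    have -> : z *m dg a b c *m dg a b c - p *: (z *m dg a b c) + q *: z =
        \row_j (if j == i then k * z 0 i else 0).
      by apply/rowP => j; rewrite H [RHS]mxE.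
    have -> : (\row_j (if j == i then k * z 0 i else 0)) *m G = (k * z 0 i) *: rw i.
      apply/rowP => j; rewrite mulmx3 !mxE.
      by elim/ord3P: i {H} => /=; ring.
    move=> /eqP; rewrite scaler_eq0 mulf_eq0 (negPf k0) /= => /orP[/eqP//|].
    by rewrite /rw; elim/ord3P: i {H} => /=; rewrite ?(negPf u0) ?(negPf v0) ?(negPf w0).
  have R0 (x : 'rV[C]_3) j : (x *m dg a b c) 0 j =
      x 0 j * (if j == i0 then a else if j == i1 then b else c).
    by rewrite mulmx3 !dgE; elim/ord3P: j => /=; ring.
  have R1 p q j : let e := if j == i0 then a else if j == i1 then b else c in
      (z *m dg a b c *m dg a b c - p *: (z *m dg a b c) + q *: z) 0 j =
      z 0 j * e * e - p * (z 0 j * e) + q * z 0 j.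
    by move=> e; rewrite -!R0 !mxE.
  apply/rowP => i; rewrite [RHS]mxE; elim/ord3P: i.
  - apply: (E i0 (b + c) (b * c) ((a - b) * (a - c))).
      by rewrite mulf_neq0 ?nz.
    by apply: ord3P; rewrite R1 /=; ring.
  - apply: (E i1 (a + c) (a * c) ((b - a) * (b - c))).
      by rewrite mulf_neq0 ?nz// eq_sym.
    by apply: ord3P; rewrite R1 /=; ring.
  - apply: (E i2 (a + b) (a * b) ((a - c) * (b - c))).
      by rewrite mulf_neq0 ?nz.
    by apply: ord3P; rewrite R1 /=; ring.
(* Rescaling one eigenvector brings the determinant to 1. *)
pose k := \det G.
have k0 : k != 0 by rewrite -unitfE.
have dk : \det (dg k^-1 1 1 *m G) == 1.
  by rewrite det_mulmx det_dg !mulr1 mulVf.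
exists (MkSL3 dk); set g := MkSL3 dk.
have : SL3_mx g *m SL3_mx A = dg a b c *m SL3_mx g.
  rewrite /= -mulmxA GA !mulmxA; congr (_ *m G).
  by apply/matrixP => i j; rewrite !mul_dg_mx !dgE; elim/ord3P: i; elim/ord3P: j => /=; ring.
rewrite !SL3_mulE => ->.
by rewrite -mulmxA -SL3_mulE mulgV mulmx1.
Qed.

End Diagonalization.

(** * Traces of a pair with diagonal first matrix *)

Section TraceCoordinates.
Variable R : realType.
Local Notation C := (R[i]).

Definition tn (k : nat) (lt_k9 : (k < 9)%N) : CX R := t_ R (Ordinal lt_k9).
Local Notation T k := (@tn k isT).

(* The other root of the quadratic equation satisfied by t_(5). *)
Definition t5' : CX R :=
  trX R [:: (X2, false); (X1, false); (X2, true); (X1, true)].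

Lemma trXE w (r : rep R) : trX R w r = tr3 (SL3_mx (Defs.eval r w)).
Proof. by []. Qed.

Lemma SL3_inv_dg (A : SL3 R) a b c : SL3_mx A = dg a b c ->
  SL3_mx A^-1%g = dg (b * c) (a * c) (a * b).
Proof. by rewrite SL3_invE => ->; exact: adj_dg. Qed.

Lemma eigentriple_dg (A : SL3 R) a b c : SL3_mx A = dg a b c -> eigentriple a b c A.
Proof.
move=> AE; have AV := SL3_inv_dg AE.
split; rewrite ?AV ?AE /tr3 ?mxtrace3 ?dgE //=; first by ring.
by rewrite -(eqP (SL3_det A)) AE det_dg.
Qed.

Section AtDiagonal.
Variables (a b c : C) (A B : SL3 R).
Hypothesis AE : SL3_mx A = dg a b c.
Let M := SL3_mx B.
Let N := SL3_mx B^-1%g.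

Let letterE := (erefl : eval_letter (A, B) (X1, false) = A,
  erefl : eval_letter (A, B) (X2, false) = B,
  erefl : eval_letter (A, B) (X1, true) = A^-1%g,
  erefl : eval_letter (A, B) (X2, true) = B^-1%g).
Let evalE := (@eval_cons R, @eval_nil R, @mulg1 (SL3 R), letterE).

Lemma T2_dg : T 2 (A, B) = M i0 i0 + M i1 i1 + M i2 i2.
Proof. by rewrite /tn /t_ trXE /winv /= !evalE /tr3 mxtrace3. Qed.

Lemma T3_dg : T 3 (A, B) = N i0 i0 + N i1 i1 + N i2 i2.
Proof. by rewrite /tn /t_ trXE /winv /= !evalE /tr3 mxtrace3. Qed.

Lemma T4_dg : T 4 (A, B) = a * M i0 i0 + b * M i1 i1 + c * M i2 i2.
Proof.
by rewrite /tn /t_ trXE /winv /= !evalE SL3_mulE AE /tr3 mxtrace3 !mul_dg_mx.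
Qed.

Lemma T5_dg : T 5 (A, B) = b * c * N i0 i0 + a * c * N i1 i1 + a * b * N i2 i2.
Proof.
by rewrite /tn /t_ trXE /winv /= !evalE SL3_mulE (SL3_inv_dg AE) /tr3 mxtrace3 !mul_dg_mx.
Qed.

Lemma T6_dg : T 6 (A, B) = a * N i0 i0 + b * N i1 i1 + c * N i2 i2.
Proof.
by rewrite /tn /t_ trXE /winv /= !evalE SL3_mulE AE /tr3 mxtrace3 !mul_dg_mx.
Qed.

Lemma T7_dg : T 7 (A, B) = b * c * M i0 i0 + a * c * M i1 i1 + a * b * M i2 i2.
Proof.
by rewrite /tn /t_ trXE /winv /= !evalE SL3_mulE (SL3_inv_dg AE) /tr3 mxtrace3 !mul_dg_mx.
Qed.

Lemma T8_dg : T 8 (A, B) =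
  a * (M i0 i0 * (b * c) * N i0 i0 + M i0 i1 * (a * c) * N i1 i0 + M i0 i2 * (a * b) * N i2 i0)
  + b * (M i1 i0 * (b * c) * N i0 i1 + M i1 i1 * (a * c) * N i1 i1 + M i1 i2 * (a * b) * N i2 i1)
  + c * (M i2 i0 * (b * c) * N i0 i2 + M i2 i1 * (a * c) * N i1 i2 + M i2 i2 * (a * b) * N i2 i2).
Proof.
rewrite /tn /t_ trXE /winv /= !evalE !SL3_mulE (SL3_inv_dg AE) AE /tr3 mxtrace3 !mul_dg_mx /=.
by rewrite !(mulmx3 (SL3_mx B)) !mul_dg_mx /= !mulrA.
Qed.

Lemma t5'_dg : t5' (A, B) =
  M i0 i0 * a * N i0 i0 * (b * c) + M i0 i1 * b * N i1 i0 * (b * c) + M i0 i2 * c * N i2 i0 * (b * c)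
  + (M i1 i0 * a * N i0 i1 * (a * c) + M i1 i1 * b * N i1 i1 * (a * c) + M i1 i2 * c * N i2 i1 * (a * c))
  + (M i2 i0 * a * N i0 i2 * (a * b) + M i2 i1 * b * N i1 i2 * (a * b) + M i2 i2 * c * N i2 i2 * (a * b)).
Proof.
rewrite /tn /t_ trXE /winv /= !evalE !SL3_mulE (SL3_inv_dg AE) AE /tr3 mxtrace3.
by rewrite !(mulmx3 (SL3_mx B)) !mul_dg_mx /= !mul_mx_dg /= !mulrA.
Qed.

Lemma N_entries i j : N i j = M (next j) (next i) * M (next (next j)) (next (next i))
               - M (next j) (next (next i)) * M (next (next j)) (next i).
Proof. by rewrite /N SL3_invE adj3. Qed.

End AtDiagonal.
End TraceCoordinates.

(** * Elimination of the eigenvalues *)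

Section Eigenfunctions.
Variable R : realType.
Local Notation C := (R[i]).
Local Notation T k := (@tn R k isT).

(* Functions of a pair of matrices and of an ordered eigentriple of the first. *)
Local Notation efun := (C -> C -> C -> rep R -> C).

Definition sym6 (f : efun) : efun := fun a b c r =>
  f a b c r + f b c a r + f c a b r + f b a c r + f a c b r + f c b a r.

Section OverSubring.
Variable K : CX R -> Prop.
Hypothesis Kcst : forall x : C, K (x%:A).
Hypothesis KD : forall f g, K f -> K g -> K (f + g).
Hypothesis KM : forall f g, K f -> K g -> K (f * g).
Hypothesis KT : forall k (k9 : (k < 9)%N), (k < 8)%N -> K (tn R k9).

(** Polynomials in the eigenvalues with coefficients in [K]. Only products with a variable are
    constructors, so that [sym6_eigenfun] can absorb the variables one by one into a monomial;
    general products are derived. *)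
Inductive eigenfun : efun -> Prop :=
| eigenfun_base (h : CX R) : K h -> eigenfun (fun _ _ _ r => h r)
| eigenfun_add (f g : efun) : eigenfun f -> eigenfun g ->
    eigenfun (fun a b c r => f a b c r + g a b c r)
| eigenfun_mul1 (f : efun) : eigenfun f -> eigenfun (fun a b c r => a * f a b c r)
| eigenfun_mul2 (f : efun) : eigenfun f -> eigenfun (fun a b c r => b * f a b c r)
| eigenfun_mul3 (f : efun) : eigenfun f -> eigenfun (fun a b c r => c * f a b c r).

Lemma eigenfun_ext (f g : efun) :
  (forall a b c r, f a b c r = g a b c r) -> eigenfun f -> eigenfun g.
Proof. by move=> fg; rewrite (_ : f = g)//; do 4 apply/funext => ?. Qed.

Lemma eigenfun_cst x : eigenfun (fun _ _ _ _ => x).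
Proof.
apply: (eigenfun_ext _ (eigenfun_base (Kcst x))) => a b c r.
exact: (mulr1 x).
Qed.

Lemma eigenfun_var1 : eigenfun (fun a _ _ _ => a).
Proof. by apply: (eigenfun_ext _ (eigenfun_mul1 (eigenfun_cst 1))) => a b c r; rewrite mulr1. Qed.

Lemma eigenfun_var2 : eigenfun (fun _ b _ _ => b).
Proof. by apply: (eigenfun_ext _ (eigenfun_mul2 (eigenfun_cst 1))) => a b c r; rewrite mulr1. Qed.

Lemma eigenfun_var3 : eigenfun (fun _ _ c _ => c).
Proof. by apply: (eigenfun_ext _ (eigenfun_mul3 (eigenfun_cst 1))) => a b c r; rewrite mulr1. Qed.

Lemma eigenfun_mul (f g : efun) : eigenfun f -> eigenfun g ->
  eigenfun (fun a b c r => f a b c r * g a b c r).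
Proof.
move=> ef; elim: g / => [h Kh|g1 g2 _ IH1 _ IH2|g _ IH|g _ IH|g _ IH].
- elim: f / ef => [h' Kh'|f1 f2 _ IH1 _ IH2|f _ IH|f _ IH|f _ IH].
  + exact: (eigenfun_ext _ (eigenfun_base (KM Kh' Kh))).
  + by apply: (eigenfun_ext _ (eigenfun_add IH1 IH2)) => a b c r; rewrite mulrDl.
  + by apply: (eigenfun_ext _ (eigenfun_mul1 IH)) => a b c r; rewrite mulrA.
  + by apply: (eigenfun_ext _ (eigenfun_mul2 IH)) => a b c r; rewrite mulrA.
  + by apply: (eigenfun_ext _ (eigenfun_mul3 IH)) => a b c r; rewrite mulrA.
- by apply: (eigenfun_ext _ (eigenfun_add IH1 IH2)) => a b c r; rewrite mulrDr.
- by apply: (eigenfun_ext _ (eigenfun_mul1 IH)) => a b c r; rewrite mulrCA.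
- by apply: (eigenfun_ext _ (eigenfun_mul2 IH)) => a b c r; rewrite mulrCA.
- by apply: (eigenfun_ext _ (eigenfun_mul3 IH)) => a b c r; rewrite mulrCA.
Qed.

Lemma eigenfun_exp (f : efun) n : eigenfun f -> eigenfun (fun a b c r => f a b c r ^+ n).
Proof.
move=> ef; elim: n => [|n IH]; first exact: (eigenfun_cst 1).
by apply: (eigenfun_ext _ (eigenfun_mul ef IH)) => a b c r; rewrite exprS.
Qed.

Lemma eigenfun_opp (f : efun) : eigenfun f -> eigenfun (fun a b c r => - f a b c r).
Proof.
by move=> ef; apply: (eigenfun_ext _ (eigenfun_mul (eigenfun_cst (-1)) ef)) => a b c r; rewrite mulN1r.
Qed.

Lemma eigentripleT a b c (r : rep R) : eigentriple a b c r.1 ->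
  a + b + c = T 0 r /\ a * b + a * c + b * c = T 1 r.
Proof.
have E (g : SL3 R) : tr3 (SL3_mx g) = tr3 (SL3_mx (g * 1)%g) by rewrite mulg1.
move=> [e1 e2 _]; split; rewrite /tn /t_ trXE /winv /= eval_cons eval_nil -E.
  exact: e1.
exact: e2.
Qed.

(** Newton's recurrence, with elementary symmetric functions [T 0], [T 1] and 1. It has order three,
    hence the induction carries three consecutive power sums. *)
Lemma power_sum n : exists2 h : CX R, K h &
  forall a b c r, eigentriple a b c r.1 -> a ^+ n + b ^+ n + c ^+ n = h r.
Proof.
have K1 : K 1 by have := Kcst 1; rewrite scale1r.
suff: [/\ exists2 h : CX R, K h &
    forall a b c r, eigentriple a b c r.1 -> a ^+ n + b ^+ n + c ^+ n = h r,
  exists2 h : CX R, K h &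
    forall a b c r, eigentriple a b c r.1 -> a ^+ n.+1 + b ^+ n.+1 + c ^+ n.+1 = h r &
  exists2 h : CX R, K h &
    forall a b c r, eigentriple a b c r.1 -> a ^+ n.+2 + b ^+ n.+2 + c ^+ n.+2 = h r].
  by case.
elim: n => [|n [[h0 Kh0 h0E] [h1 Kh1 h1E] [h2 Kh2 h2E]]].
  split.
  - exists (1 + 1 + 1); first by do 2 apply: KD => //.
    by move=> a b c r _; rewrite !expr0.
  - exists (T 0); first exact: KT.
    by move=> a b c r /eigentripleT[<- _]; rewrite !expr1.
  - exists (T 0 * T 0 + (- (2 : C))%:A * T 1).
      by apply: KD; apply: KM; [exact: KT|exact: KT|exact: Kcst|exact: KT].
    move=> a b c r /eigentripleT[h0 h1].
    have -> : (T 0 * T 0 + (- (2 : C))%:A * T 1) r = T 0 r * T 0 r + (- 2 * 1) * T 1 r by [].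
    by rewrite -h0 -h1; ring.
split; [by exists h1|by exists h2|].
exists (T 0 * h2 + ((-1)%:A * (T 1 * h1) + h0)).
  by apply: KD; [apply: KM => //; exact: KT|apply: KD => //; apply: KM => //; apply: KM => //; exact: KT].
move=> a b c r abc; have [e0 e1] := eigentripleT abc; have [_ _ e2] := abc.
have -> : (T 0 * h2 + ((-1)%:A * (T 1 * h1) + h0)) r =
  T 0 r * h2 r + ((-1 * 1) * (T 1 r * h1 r) + h0 r) by [].
rewrite -(h0E _ _ _ _ abc) -(h1E _ _ _ _ abc) -(h2E _ _ _ _ abc) -e0 -e1.
(* The term of lowest degree is multiplied by [a * b * c = 1], so that the recurrence becomes a
   polynomial identity. *)
have e x : x = a * b * c * x by rewrite e2 mul1r.
by rewrite [X in _ + (_ + X)]e !exprS; ring.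
Qed.

(** Inclusion and exclusion: the product of three power sums, minus the terms in which two or three
    of the chosen eigenvalues coincide. *)
Lemma sym6_monomial i j k : exists2 h : CX R, K h &
  forall a b c r, eigentriple a b c r.1 ->
    sym6 (fun a b c _ => a ^+ i * b ^+ j * c ^+ k) a b c r = h r.
Proof.
have [pi Kpi piE] := power_sum i; have [pj Kpj pjE] := power_sum j.
have [pk Kpk pkE] := power_sum k; have [pij Kpij pijE] := power_sum (i + j).
have [pik Kpik pikE] := power_sum (i + k); have [pjk Kpjk pjkE] := power_sum (j + k).
have [pijk Kpijk pijkE] := power_sum (i + j + k).
pose m : CX R := (-1)%:A.
exists (pi * pj * pk + m * (pij * pk) + m * (pik * pj) + m * (pjk * pi) + (2 : C)%:A * pijk).
  by do ! [apply: KD | apply: KM | apply: Kcst]; assumption.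
move=> a b c r abc.
have -> : (pi * pj * pk + m * (pij * pk) + m * (pik * pj) + m * (pjk * pi) + (2 : C)%:A * pijk) r =
  pi r * pj r * pk r + (-1 * 1) * (pij r * pk r) + (-1 * 1) * (pik r * pj r)
  + (-1 * 1) * (pjk r * pi r) + (2 * 1) * pijk r by [].
rewrite -(piE _ _ _ _ abc) -(pjE _ _ _ _ abc) -(pkE _ _ _ _ abc) -(pijE _ _ _ _ abc).
rewrite -(pikE _ _ _ _ abc) -(pjkE _ _ _ _ abc) -(pijkE _ _ _ _ abc) /sym6 !exprD.
ring.
Qed.

Lemma sym6_eigenfun (f : efun) : eigenfun f -> exists2 h : CX R, K h &
  forall a b c r, eigentriple a b c r.1 -> sym6 f a b c r = h r.
Proof.
move=> ef; suff: forall i j k, exists2 h : CX R, K h & forall a b c r, eigentriple a b c r.1 ->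
    sym6 (fun a b c r => f a b c r * (a ^+ i * b ^+ j * c ^+ k)) a b c r = h r.
  move=> /(_ 0 0 0)%N[h Kh hE]; exists h => // a b c r abc.
  by rewrite -(hE _ _ _ _ abc) /sym6 !expr0 !mulr1.
elim: f / ef => [h Kh|f g _ IHf _ IHg|f _ IH|f _ IH|f _ IH] i j k.
- have [g Kg gE] := sym6_monomial i j k; exists (h * g); first exact: KM.
  move=> a b c r abc; have -> : (h * g) r = h r * g r by [].
  by rewrite -(gE _ _ _ _ abc) /sym6; ring.
- have [hf Khf hfE] := IHf i j k; have [hg Khg hgE] := IHg i j k.
  exists (hf + hg); first exact: KD.
  move=> a b c r abc; have -> : (hf + hg) r = hf r + hg r by [].
  by rewrite -(hfE _ _ _ _ abc) -(hgE _ _ _ _ abc) /sym6; ring.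
- have [h Kh hE] := IH i.+1 j k; exists h => // a b c r abc.
  by rewrite -(hE _ _ _ _ abc) /sym6 !exprS; ring.
- have [h Kh hE] := IH i j.+1 k; exists h => // a b c r abc.
  by rewrite -(hE _ _ _ _ abc) /sym6 !exprS; ring.
- have [h Kh hE] := IH i j k.+1; exists h => // a b c r abc.
  by rewrite -(hE _ _ _ _ abc) /sym6 !exprS; ring.
Qed.

(** Derivative of the characteristic polynomial at [a]; the product [Vd] of the three is minus the
    discriminant. *)
Definition Vd1 (a b c : C) := (a - b) * (a - c).
Definition Vd2 (a b c : C) := (b - a) * (b - c).
Definition Vd3 (a b c : C) := (c - a) * (c - b).
Definition Vd (a b c : C) := Vd1 a b c * Vd2 a b c * Vd3 a b c.

(* [(A - b) (A - c) = A^-1 + a A - a (b + c)] when [a], [b], [c] are the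
   eigenvalues of [A]; the trace of its product with [B] is [numer], with [x],
   [y], [z] the traces of [A^-1 B], [A B] and [B]. If [A] is diagonal, this is
   [(a - b) (a - c)] times the first diagonal entry of [B]. *)
Definition numer (a b c x y z : C) := x + a * y - a * (b + c) * z.
Definition nB (a b c : C) (r : rep R) := numer a b c (T 7 r) (T 4 r) (T 2 r).
Definition nV (a b c : C) (r : rep R) := numer a b c (T 5 r) (T 6 r) (T 3 r).

(** A diagonal entry of the inverse is a 2 by 2 minor. At a diagonal first matrix this is therefore
    [Vd] times the product of the entries (1, 2) and (2, 1) of the second, indices starting at 0;
    see [X_dg]. *)
Definition Xn1 : efun := fun a b c r =>
  Vd1 a b c * nB b a c r * nB c a b r - Vd2 a b c * Vd3 a b c * nV a b c r.
Definition Xn2 : efun := fun a b c r => Xn1 b a c r.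
Definition Xn3 : efun := fun a b c r => Xn1 c a b r.
Definition XV : efun := fun a b c r => Vd a b c * (Xn1 a b c r * Xn2 a b c r * Xn3 a b c r).

Lemma Xn1C a b c r : Xn1 a c b r = Xn1 a b c r.
Proof. by rewrite /Xn1 /nB /nV /numer /Vd1 /Vd2 /Vd3; ring. Qed.

Lemma XV_sym a b c r : sym6 XV a b c r = 6 * XV a b c r.
Proof.
rewrite /sym6 /XV /Xn2 /Xn3 (Xn1C a c b) (Xn1C b c a) (Xn1C c b a) (Xn1C a b c) (Xn1C b a c) (Xn1C c a b).
rewrite /Vd /Vd1 /Vd2 /Vd3; move: (Xn1 a b c r) (Xn1 b a c r) (Xn1 c a b r) => x y z; ring.
Qed.

Ltac eigen_tac := repeat first
  [ exact: eigenfun_cst | exact: eigenfun_var1 | exact: eigenfun_var2 | exact: eigenfun_var3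
  | apply: eigenfun_base; exact: KT | assumption
  | apply: eigenfun_add | apply: eigenfun_opp | apply: eigenfun_mul | apply: eigenfun_exp ].

Lemma eigenfun_Xn1 : eigenfun Xn1.
Proof. rewrite /Xn1 /nB /nV /numer /Vd1 /Vd2 /Vd3; eigen_tac. Qed.
Lemma eigenfun_Xn2 : eigenfun Xn2.
Proof. rewrite /Xn2 /Xn1 /nB /nV /numer /Vd1 /Vd2 /Vd3; eigen_tac. Qed.
Lemma eigenfun_Xn3 : eigenfun Xn3.
Proof. rewrite /Xn3 /Xn1 /nB /nV /numer /Vd1 /Vd2 /Vd3; eigen_tac. Qed.
Lemma eigenfun_XV : eigenfun XV.
Proof.
have e1 := eigenfun_Xn1; have e2 := eigenfun_Xn2; have e3 := eigenfun_Xn3.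
rewrite /XV /Vd /Vd1 /Vd2 /Vd3; eigen_tac.
Qed.

(** [XV] is symmetric in the eigenvalues, so symmetrizing it only multiplies it by 6. *)
Lemma discriminant_ex : exists2 D : CX R, K D &
  forall a b c r, eigentriple a b c r.1 -> D r = 6 * XV a b c r.
Proof.
have [D KD' DE] := sym6_eigenfun eigenfun_XV; exists D => // a b c r abc.
by rewrite -(DE _ _ _ _ abc) XV_sym.
Qed.

Lemma eigenfun_conj (f : efun) a b c g r : eigenfun f ->
  f a b c (conj_rep g r) = f a b c r.
Proof.
move=> ef; elim: f / ef => [h _|f1 f2 _ IH1 _ IH2|f _ IH|f _ IH|f _ IH].
- exact: CX_invariant.
- by rewrite IH1 IH2.
- by rewrite IH.
- by rewrite IH.
- by rewrite IH.
Qed.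

(* [D] plays the role of a discriminant: where it does not vanish, the first
   matrix has distinct eigenvalues and, in an eigenbasis, the second one has no
   zero entry off the diagonal. *)
Section Localization.
Variable D : CX R.
Hypothesis KD' : K D.
Hypothesis DE : forall a b c r, eigentriple a b c r.1 -> D r = 6 * XV a b c r.
Hypothesis Ksat : forall f, K (D * f) -> K f.

(** Eigenvalue polynomials with powers of [D] as denominators. Equality is asked only at diagonal
    first matrices, which meet every conjugacy class off the zeros of [D]. *)
Definition localized (f : efun) := exists n, exists2 N, eigenfun N &
  forall a b c r, SL3_mx r.1 = dg a b c -> D r != 0 ->
    D r ^+ n * f a b c r = N a b c r.

Lemma localized_ext (f g : efun) :
  (forall a b c r, SL3_mx r.1 = dg a b c -> D r != 0 -> f a b c r = g a b c r) ->
  localized f -> localized g.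
Proof.
move=> fg [n [N eN fN]]; exists n, N => // a b c r rE Dr.
by rewrite -fg// fN.
Qed.

Lemma localized_eigenfun (f : efun) : eigenfun f -> localized f.
Proof. by move=> ef; exists 0, f => // a b c r _ _; rewrite mul1r. Qed.

Lemma localized_add (f g : efun) : localized f -> localized g ->
  localized (fun a b c r => f a b c r + g a b c r).
Proof.
move=> [n [N eN fN]] [m [P eP gP]].
have eD : eigenfun (fun _ _ _ r => D r) by exact: eigenfun_base.
exists (n + m)%N, (fun a b c r => D r ^+ m * N a b c r + D r ^+ n * P a b c r).
  by eigen_tac.
move=> a b c r rE Dr; rewrite -(fN _ _ _ _ rE Dr) -(gP _ _ _ _ rE Dr) exprD; ring.
Qed.

Lemma localized_mul (f g : efun) : localized f -> localized g ->
  localized (fun a b c r => f a b c r * g a b c r).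
Proof.
move=> [n [N eN fN]] [m [P eP gP]].
exists (n + m)%N, (fun a b c r => N a b c r * P a b c r); first by eigen_tac.
by move=> a b c r rE Dr; rewrite -(fN _ _ _ _ rE Dr) -(gP _ _ _ _ rE Dr) exprD; ring.
Qed.

Lemma localized_opp (f : efun) : localized f -> localized (fun a b c r => - f a b c r).
Proof.
move=> [n [N eN fN]]; exists n, (fun a b c r => - N a b c r); first by eigen_tac.
by move=> a b c r rE Dr; rewrite -(fN _ _ _ _ rE Dr); ring.
Qed.

Lemma localized_exp (f : efun) n : localized f -> localized (fun a b c r => f a b c r ^+ n).
Proof.
move=> lf; elim: n => [|n IH].
  exact/localized_eigenfun/(eigenfun_cst 1).
by apply: (localized_ext _ (localized_mul lf IH)) => a b c r _ _; rewrite exprS.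
Qed.

Ltac loc_tac := repeat first
  [ assumption
  | apply: localized_eigenfun; first [ exact: eigenfun_cst | exact: eigenfun_var1
     | exact: eigenfun_var2 | exact: eigenfun_var3 | apply: eigenfun_base; exact: KT ]
  | apply: localized_add | apply: localized_opp | apply: localized_mul | apply: localized_exp ].

Lemma D_neq0_distinct a b c r : eigentriple a b c r.1 -> D r != 0 ->
  [/\ a != b, a != c & b != c].
Proof.
move=> abc; rewrite (DE abc) /XV /Vd /Vd1 /Vd2 /Vd3.
rewrite !mulf_eq0 !negb_or !subr_eq0 => /and3P[_ H _].
by move: H; rewrite -!andbA => /and5P[-> -> _ -> _].
Qed.

(** Every ordering of the eigenvalues is realized by a diagonalizing conjugation, which changes
    neither [h] nor [N]. Hence [D ^+ n * h] equals [N] at all six orderings, and 6 times it is the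
    symmetrization of [N], which lies in [K]. *)
Lemma localized_invariant (h : CX R) (f : efun) : localized f ->
  (forall a b c r, SL3_mx r.1 = dg a b c -> D r != 0 -> h r = f a b c r) -> K h.
Proof.
move=> [n [N eN fN]] hf; have [S KS SE] := sym6_eigenfun eN.
(* The additional factor [D] makes the identity hold trivially where [D] vanishes; [Ksat] removes it
   afterwards. *)
have K6 : K (D * (D ^+ n * ((6 : C)%:A * h))).
  rewrite (_ : D * _ = D * S); first exact: KM.
  apply: CX_eqP => r.
  have -> : (D * S) r = D r * S r by [].
  have -> : (D * (D ^+ n * ((6 : C)%:A * h))) r = D r * ((D ^+ n : CX R) r * ((6 * 1) * h r)) by [].
  have -> : (D ^+ n : CX R) r = D r ^+ n.
    by elim: n {fN} => [//|n IH]; rewrite !exprS -IH.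
  have [->|Dr] := eqVneq (D r) 0; first by rewrite !mul0r.
  have [a [b [c abc]]] := eigentriple_ex r.1.
  have key a' b' c' : eigentriple a' b' c' r.1 -> D r ^+ n * h r = N a' b' c' r.
    move=> abc'; have [ab ac bc] := D_neq0_distinct abc' Dr.
    have [g gE] := diagonalize abc' ab ac bc.
    have E := CX_invariant _ g r; rewrite -(E D) -(E h) -(eigenfun_conj a' b' c' g r eN).
    have Dr' : D (conj_rep g r) != 0 by rewrite E.
    by rewrite -fN// (hf a' b' c').
  congr (_ * _); rewrite -(SE _ _ _ _ abc) /sym6.
  have abc2 := eigentriple_rot abc; have abc3 := eigentriple_rot abc2.
  have bac := eigentriple_swap abc; have bac2 := eigentriple_rot bac.
  have bac3 := eigentriple_rot bac2.
  by rewrite -!key//; ring.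
have K6' : K ((6 : C)%:A * h).
  by move: K6 => /Ksat; elim: n {fN} => [|n IH]; rewrite ?expr0 ?mul1r// exprS -mulrA => /Ksat.
rewrite (_ : h = (6^-1 : C)%:A * ((6 : C)%:A * h)); first exact: KM.
by rewrite mulrA -scalerAl mul1r scalerA mulVf ?scale1r ?mul1r// pnatr_eq0.
Qed.

(** * Torus invariants of the second matrix in an eigenbasis of the first *)

Definition ent (i j : 'I_3) : efun := fun _ _ _ r => SL3_mx r.2 i j.
Definition x12 : efun := fun _ _ _ r => SL3_mx r.2 i0 i1 * SL3_mx r.2 i1 i0.
Definition x13 : efun := fun _ _ _ r => SL3_mx r.2 i0 i2 * SL3_mx r.2 i2 i0.
Definition x23 : efun := fun _ _ _ r => SL3_mx r.2 i1 i2 * SL3_mx r.2 i2 i1.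
Definition c1 : efun := fun _ _ _ r =>
  SL3_mx r.2 i0 i1 * SL3_mx r.2 i1 i2 * SL3_mx r.2 i2 i0.
Definition c2 : efun := fun _ _ _ r =>
  SL3_mx r.2 i0 i2 * SL3_mx r.2 i2 i1 * SL3_mx r.2 i1 i0.

Lemma nB_dg a b c r : SL3_mx r.1 = dg a b c ->
  [/\ nB a b c r = Vd1 a b c * SL3_mx r.2 i0 i0,
      nB b a c r = Vd2 a b c * SL3_mx r.2 i1 i1 &
      nB c a b r = Vd3 a b c * SL3_mx r.2 i2 i2].
Proof.
case: r => A B; rewrite -[(A, B).1]/A -?[(A, B).2]/B => rE; rewrite /nB /numer /Vd1 /Vd2 /Vd3.
rewrite (T7_dg _ rE) (T4_dg _ rE) T2_dg; split; ring.
Qed.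

Lemma nV_dg a b c r : SL3_mx r.1 = dg a b c ->
  [/\ nV a b c r = Vd1 a b c * SL3_mx r.2^-1%g i0 i0,
      nV b a c r = Vd2 a b c * SL3_mx r.2^-1%g i1 i1 &
      nV c a b r = Vd3 a b c * SL3_mx r.2^-1%g i2 i2].
Proof.
case: r => A B; rewrite -[(A, B).1]/A -?[(A, B).2]/B => rE; rewrite /nV /numer /Vd1 /Vd2 /Vd3.
rewrite (T5_dg _ rE) (T6_dg _ rE) T3_dg; split; ring.
Qed.

Lemma X_dg a b c r : SL3_mx r.1 = dg a b c ->
  [/\ Xn1 a b c r = Vd a b c * x23 a b c r,
      Xn2 a b c r = Vd a b c * x13 a b c r &
      Xn3 a b c r = Vd a b c * x12 a b c r].
Proof.
move=> rE; have [n1 n2 n3] := nB_dg rE; have [m1 m2 m3] := nV_dg rE.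
rewrite /Xn2 /Xn3 /Xn1 /x23 /x13 /x12.
have nBC x y z : nB x y z r = nB x z y r by rewrite /nB /numer; ring.
rewrite (nBC b c a) (nBC a c b) (nBC c b a) n1 n2 n3 m1 m2 m3 !N_entries /next /=.
by rewrite /Vd /Vd1 /Vd2 /Vd3; split; ring.
Qed.

Lemma XV_dg a b c r : SL3_mx r.1 = dg a b c ->
  XV a b c r = Vd a b c ^+ 4 * (x12 a b c r * x13 a b c r * x23 a b c r).
Proof. by move=> rE; have [e1 e2 e3] := X_dg rE; rewrite /XV e1 e2 e3; ring. Qed.

Lemma D_dg a b c r : SL3_mx r.1 = dg a b c ->
  D r = 6 * (Vd a b c ^+ 4 * (x12 a b c r * x13 a b c r * x23 a b c r)).
Proof. by move=> rE; rewrite (DE (eigentriple_dg rE)) XV_dg. Qed.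

Lemma D_neq0_dg a b c r : SL3_mx r.1 = dg a b c -> D r != 0 ->
  [/\ Vd a b c != 0, x12 a b c r != 0, x13 a b c r != 0 & x23 a b c r != 0].
Proof.
move=> rE; rewrite (D_dg rE); move: (Vd a b c) (x12 _ _ _ _) (x13 _ _ _ _) (x23 _ _ _ _).
move=> v x y z; rewrite 2!mulf_eq0 2!negb_or expf_eq0 /= 2!mulf_eq0 2!negb_or.
by move=> /and3P[_ -> /andP[/andP[-> ->] ->]].
Qed.

Ltac eigenX_tac := have e1 := eigenfun_Xn1; have e2 := eigenfun_Xn2; have e3 := eigenfun_Xn3;
  rewrite /Vd /nB /nV /numer /Vd1 /Vd2 /Vd3; eigen_tac.

Lemma localized_D (f N : efun) : eigenfun N ->
  (forall a b c r, SL3_mx r.1 = dg a b c -> D r != 0 ->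
    XV a b c r * f a b c r = N a b c r) -> localized f.
Proof.
move=> eN fN; exists 1%N, (fun a b c r => 6 * N a b c r); first by eigen_tac.
by move=> a b c r rE Dr; rewrite expr1 (DE (eigentriple_dg rE)) -fN// mulrA.
Qed.

Lemma localized_ent00 : localized (ent i0 i0).
Proof.
apply: (@localized_D _ (fun a b c r => nB a b c r * (Vd2 a b c * Vd3 a b c) *
  (Xn1 a b c r * Xn2 a b c r * Xn3 a b c r))); first by eigenX_tac.
by move=> a b c r rE _; have [-> _ _] := nB_dg rE; rewrite /ent /XV /Vd; ring.
Qed.

Lemma localized_ent11 : localized (ent i1 i1).
Proof.
apply: (@localized_D _ (fun a b c r => nB b a c r * (Vd1 a b c * Vd3 a b c) *
  (Xn1 a b c r * Xn2 a b c r * Xn3 a b c r))); first by eigenX_tac.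
by move=> a b c r rE _; have [_ -> _] := nB_dg rE; rewrite /ent /XV /Vd; ring.
Qed.

Lemma localized_ent22 : localized (ent i2 i2).
Proof.
apply: (@localized_D _ (fun a b c r => nB c a b r * (Vd1 a b c * Vd2 a b c) *
  (Xn1 a b c r * Xn2 a b c r * Xn3 a b c r))); first by eigenX_tac.
by move=> a b c r rE _; have [_ _ ->] := nB_dg rE; rewrite /ent /XV /Vd; ring.
Qed.

Lemma localized_x23 : localized x23.
Proof.
apply: (@localized_D _ (fun a b c r => Xn1 a b c r * (Xn1 a b c r * Xn2 a b c r * Xn3 a b c r))).
  by eigenX_tac.
by move=> a b c r rE _; have [e _ _] := X_dg rE; rewrite /XV {2}e; ring.
Qed.

Lemma localized_x13 : localized x13.
Proof.
apply: (@localized_D _ (fun a b c r => Xn2 a b c r * (Xn1 a b c r * Xn2 a b c r * Xn3 a b c r))).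
  by eigenX_tac.
by move=> a b c r rE _; have [_ e _] := X_dg rE; rewrite /XV {2}e; ring.
Qed.

Lemma localized_x12 : localized x12.
Proof.
apply: (@localized_D _ (fun a b c r => Xn3 a b c r * (Xn1 a b c r * Xn2 a b c r * Xn3 a b c r))).
  by eigenX_tac.
by move=> a b c r rE _; have [_ _ e] := X_dg rE; rewrite /XV {2}e; ring.
Qed.

Lemma localized_x23V : localized (fun a b c r => (x23 a b c r)^-1).
Proof.
apply: (@localized_D _ (fun a b c r => Vd a b c ^+ 2 * (Xn2 a b c r * Xn3 a b c r))).
  by eigenX_tac.
move=> a b c r rE Dr; have [e _ _] := X_dg rE; have [_ _ _ nz] := D_neq0_dg rE Dr.
by rewrite /XV e; field.
Qed.

Lemma localized_x12V : localized (fun a b c r => (x12 a b c r)^-1).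
Proof.
apply: (@localized_D _ (fun a b c r => Vd a b c ^+ 2 * (Xn1 a b c r * Xn2 a b c r))).
  by eigenX_tac.
move=> a b c r rE Dr; have [_ _ e] := X_dg rE; have [_ nz _ _] := D_neq0_dg rE Dr.
by rewrite /XV e; field.
Qed.

Definition Delta (a b c : C) := (a - b) * (b - c) * (a - c).

Lemma Vd_Delta a b c : Vd a b c = - Delta a b c ^+ 2.
Proof. by rewrite /Vd /Vd1 /Vd2 /Vd3 /Delta; ring. Qed.

Lemma localized_DeltaV : localized (fun a b c _ => (Delta a b c)^-1).
Proof.
apply: (@localized_D _ (fun a b c r => - Delta a b c * (Xn1 a b c r * Xn2 a b c r * Xn3 a b c r))).
  by rewrite /Delta; eigenX_tac.
move=> a b c r rE Dr; have [nz _ _ _] := D_neq0_dg rE Dr.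
rewrite Vd_Delta oppr_eq0 expf_eq0 /= in nz.
by rewrite /XV Vd_Delta; field.
Qed.

Definition csum : efun := fun a b c r =>
  1 - ent i0 i0 a b c r * ent i1 i1 a b c r * ent i2 i2 a b c r
  + ent i0 i0 a b c r * x23 a b c r + ent i1 i1 a b c r * x13 a b c r
  + ent i2 i2 a b c r * x12 a b c r.

(** [csum] is the equation det = 1 of the second matrix, solved for the contribution of its two
    3-cycles. *)
Lemma csumE a b c r : c1 a b c r + c2 a b c r = csum a b c r.
Proof. by rewrite /csum -(eqP (SL3_det r.2)) det3 /ent /c1 /c2 /x12 /x13 /x23; ring. Qed.

(** [gam] and [gam'] are the coefficients of the two 3-cycles in the trace of one commutator, and
    are exchanged in that of the other. *)
Definition gam (a b c : C) := a ^+ 2 * c + b ^+ 2 * a + c ^+ 2 * b.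
Definition gam' (a b c : C) := a ^+ 2 * b + b ^+ 2 * c + c ^+ 2 * a.

Definition ktr : efun := fun a b c r =>
  let m0 := ent i0 i0 a b c r in let m1 := ent i1 i1 a b c r in let m2 := ent i2 i2 a b c r in
  let x := x12 a b c r in let y := x13 a b c r in let z := x23 a b c r in
  a * b * c * (m0 * (m1 * m2 - z) + m1 * (m0 * m2 - y) + m2 * (m0 * m1 - x))
  - (a ^+ 2 * c + b ^+ 2 * c) * (x * m2) - (a ^+ 2 * b + c ^+ 2 * b) * (y * m1)
  - (b ^+ 2 * a + c ^+ 2 * a) * (z * m0).

Lemma T8_ktr a b c r : SL3_mx r.1 = dg a b c ->
  T 8 r = gam a b c * c1 a b c r + gam' a b c * c2 a b c r + ktr a b c r.
Proof.
case: r => A B; rewrite -[(A, B).1]/A -?[(A, B).2]/B => rE; rewrite (T8_dg _ rE) !N_entries /next /=.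
by rewrite /gam /gam' /c1 /c2 /ktr /ent /x12 /x13 /x23 /=; ring.
Qed.

Lemma t5'_ktr a b c r : SL3_mx r.1 = dg a b c ->
  t5' R r = gam' a b c * c1 a b c r + gam a b c * c2 a b c r + ktr a b c r.
Proof.
case: r => A B; rewrite -[(A, B).1]/A -?[(A, B).2]/B => rE; rewrite (t5'_dg _ rE) !N_entries /next /=.
by rewrite /gam /gam' /c1 /c2 /ktr /ent /x12 /x13 /x23 /=; ring.
Qed.

Ltac locX_tac := have l00 := localized_ent00; have l11 := localized_ent11;
  have l22 := localized_ent22; have l12 := localized_x12; have l13 := localized_x13;
  have l23 := localized_x23; have l12V := localized_x12V; have l23V := localized_x23V;
  have lD := localized_DeltaV; rewrite /csum /ktr /gam /gam'; loc_tac.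

(** Exchanging [c1] and [c2] exchanges the two commutator traces. Their sum and product are thus
    symmetric in [c1] and [c2], hence expressible by [csum] and the product [c1 * c2]. *)
Lemma K_t5D : K (T 8 + t5' R).
Proof.
apply: (@localized_invariant _ (fun a b c r =>
  (gam a b c + gam' a b c) * csum a b c r + 2 * ktr a b c r)); first by locX_tac.
move=> a b c r rE _; have -> : (T 8 + t5' R) r = T 8 r + t5' R r by [].
by rewrite (T8_ktr rE) (t5'_ktr rE) -csumE; ring.
Qed.

Lemma K_t5M : K (T 8 * t5' R).
Proof.
apply: (@localized_invariant _ (fun a b c r =>
  let x := x12 a b c r * x13 a b c r * x23 a b c r in
  let g := gam a b c in let g' := gam' a b c in
  let s := csum a b c r in let k := ktr a b c r in
  g * g' * (s ^+ 2 - 2 * x) + (g ^+ 2 + g' ^+ 2) * x + k * (g + g') * s + k ^+ 2)).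
  by locX_tac.
move=> a b c r rE _; have -> : (T 8 * t5' R) r = T 8 r * t5' R r by [].
rewrite (T8_ktr rE) (t5'_ktr rE) -csumE /=.
(* Both sides are the product of all six off-diagonal entries. *)
have -> : x12 a b c r * x13 a b c r * x23 a b c r = c1 a b c r * c2 a b c r.
  by rewrite /x12 /x13 /x23 /c1 /c2; ring.
by move: (gam _ _ _) (gam' _ _ _) (c1 _ _ _ _) (c2 _ _ _ _) (ktr _ _ _ _) => *; ring.
Qed.

Hypothesis KT8 : K (T 8).

(** As [gam' - gam] is [Delta], the commutator trace separates the two 3-cycles once their sum is
    known. This is where [KT8] enters. *)
Lemma localized_c2 : localized c2.
Proof.
apply: (@localized_ext (fun a b c r =>
   (T 8 r - gam a b c * csum a b c r - ktr a b c r) * (Delta a b c)^-1)).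
  move=> a b c r rE Dr; have [nz _ _ _] := D_neq0_dg rE Dr.
  rewrite Vd_Delta oppr_eq0 expf_eq0 /= in nz.
  rewrite (T8_ktr rE) -csumE; apply: (mulIf nz); rewrite mulfVK//.
  rewrite /gam /gam' /Delta; ring.
have lT : localized (fun _ _ _ r => T 8 r) by apply/localized_eigenfun/eigenfun_base.
by locX_tac.
Qed.

Lemma localized_c1 : localized c1.
Proof.
have lc2 := localized_c2.
apply: (@localized_ext (fun a b c r => csum a b c r - c2 a b c r)).
  by move=> a b c r rE Dr; rewrite -csumE; ring.
by locX_tac.
Qed.

(* The conjugating matrix is diagonal, with determinant normalised by a cube
   root; the entries of the conjugate are then invariants of the torus. *)
Lemma normal_form_ex (r : rep R) : exists r' : rep R,
  forall a b c, SL3_mx r.1 = dg a b c -> D r != 0 ->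
  [/\ exists g, r' = conj_rep g r, r'.1 = r.1 &
   [/\ forall i, SL3_mx r'.2 i i = SL3_mx r.2 i i,
      SL3_mx r'.2 i0 i1 = 1, SL3_mx r'.2 i1 i2 = 1 &
   [/\ SL3_mx r'.2 i1 i0 = x12 a b c r, SL3_mx r'.2 i2 i1 = x23 a b c r,
      SL3_mx r'.2 i2 i0 = c1 a b c r &
      SL3_mx r'.2 i0 i2 = c2 a b c r * (x12 a b c r)^-1 * (x23 a b c r)^-1]]].
Proof.
(* The pair [r'] must not depend on [a], [b], [c], since [choice] will turn it into a function of
   [r] alone; elsewhere it is [r] by default. *)
have [rE|nrE] := pselect (exists a b c, SL3_mx r.1 = dg a b c /\ D r != 0); last first.
  by exists r => a b c rE Dr; exfalso; apply: nrE; exists a, b, c.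
have [a0 [b0 [c0 [rE0 Dr]]]] := rE.
have [_ + _ +] := D_neq0_dg rE0 Dr; rewrite /x12 /x23 !mulf_eq0 !negb_or.
set p := SL3_mx r.2 i0 i1; set q := SL3_mx r.2 i1 i2 => /andP[p0 p'0] /andP[q0 q'0].
(* Conjugation by the diagonal matrix (d, d p, d p q) divides the entries (0, 1) and (1, 2) by [p]
   and [q], turning them into 1; the cube root makes its determinant 1. *)
pose d := 3.-root ((p ^+ 2 * q)^-1).
have d3 : d ^+ 3 = (p ^+ 2 * q)^-1 by rewrite rootCK.
have d0 : d != 0.
  have : d ^+ 3 != 0 by rewrite d3 invr_eq0 mulf_neq0// expf_neq0.
  by apply: contra_neq => ->; rewrite expr0n.
have dpq : d ^+ 3 * p ^+ 2 * q = 1 by rewrite d3; field; rewrite p0 q0.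
have gd : \det (dg d (d * p) (d * p * q)) == 1.
  by rewrite det_dg -dpq; apply/eqP; ring.
pose g := MkSL3 gd.
exists (conj_rep g r) => a b c rE' _.
have gV : SL3_mx g^-1%g = dg (d * p * (d * p * q)) (d * (d * p * q)) (d * (d * p)).
  by rewrite (@SL3_inv_dg _ g _ _ _ erefl).
have E i j : SL3_mx (conj_rep g r).2 i j =
    (if i == i0 then d else if i == i1 then d * p else d * p * q) * SL3_mx r.2 i j *
    (if j == i0 then d * p * (d * p * q) else if j == i1 then d * (d * p * q) else d * (d * p)).
  by rewrite -[(conj_rep g r).2]/(g * r.2 * g^-1)%g !SL3_mulE gV mul_mx_dg mul_dg_mx.
split.
- by exists g.
- apply: val_inj.
  rewrite -[LHS]/(SL3_mx (g * r.1 * g^-1)%g) -[RHS]/(SL3_mx r.1) !SL3_mulE gV.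
  apply/matrixP => i j; rewrite mul_mx_dg mul_dg_mx rE' !dgE.
  elim/ord3P: i; elim/ord3P: j => /=; rewrite ?(mulr0, mul0r)//.
  + by rewrite -[RHS]mul1r -dpq; ring.
  + by rewrite -[RHS]mul1r -dpq; ring.
  + by rewrite -[RHS]mul1r -dpq; ring.
have F x y : d ^+ 3 * p ^+ 2 * q * x = y -> x = y by rewrite dpq mul1r.
split.
- by move=> i; rewrite E; symmetry; apply: F; elim/ord3P: i => /=; ring.
- by rewrite E /= -/p -dpq; ring.
- by rewrite E /= -/q -dpq; ring.
rewrite /x12 /x23 /c1 /c2 -/p -/q; split; rewrite E /=.
- by symmetry; apply: F; ring.
- by symmetry; apply: F; ring.
- by symmetry; apply: F; ring.
- set u := SL3_mx r.2 i0 i2; set p' := SL3_mx r.2 i1 i0; set q' := SL3_mx r.2 i2 i1.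
  have -> : u * q' * p' * (p * p')^-1 * (q * q')^-1 = u * (p * q)^-1.
    by field; rewrite p0 p'0 q0 q'0.
  apply: (mulIf (mulf_neq0 p0 q0)); rewrite mulfVK ?mulf_neq0//.
  by rewrite -[RHS]mulr1 -dpq; ring.
Qed.

(** An invariant function may be evaluated at the normal form, all of whose entries are localized;
    since [f] is a polynomial in the entries, it is localized as well. *)
Lemma K_all f : K f.
Proof.
have [nf nfP] := choice normal_form_ex.
apply: (@localized_invariant _ (fun _ _ _ r => f (nf r))); last first.
  move=> a b c r rE Dr; have [[g ->] _ _] := nfP r a b c rE Dr.
  by rewrite CX_invariant.
elim: (CX_fun f) / (CX_regular f) => [x|i j|i j|p q _ lp _ lq|p q _ lp _ lq].
- exact/localized_eigenfun/eigenfun_cst.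
- apply: (@localized_ext (fun a b c r => dg a b c i j)).
    by move=> a b c r rE Dr; have [_ -> _] := nfP r a b c rE Dr; rewrite rE.
  apply: localized_eigenfun.
  under [X in eigenfun X]eq_fun => a do under eq_fun => b do under eq_fun => c do
    under eq_fun => r do rewrite dgE.
  elim/ord3P: i; elim/ord3P: j => /=; eigen_tac.
- have e : forall (g : efun), (forall a b c r, SL3_mx r.1 = dg a b c -> D r != 0 ->
      SL3_mx (nf r).2 i j = g a b c r) -> localized g ->
      localized (fun _ _ _ r => SL3_mx (nf r).2 i j).
    by move=> g gE; apply: localized_ext => a b c r rE Dr; rewrite (gE a b c).
  have lc1 := localized_c1; have lc2 := localized_c2.
  elim/ord3P: i e; elim/ord3P: j => e.
  + apply: (e (ent i0 i0)); last exact: localized_ent00.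
    by move=> a b c r rE Dr; have [_ _ [H _ _ _]] := nfP r a b c rE Dr.
  + apply: (e (fun _ _ _ _ => 1)); last by locX_tac.
    by move=> a b c r rE Dr; have [_ _ [_ H _ _]] := nfP r a b c rE Dr.
  + apply: (e (fun a b c r => c2 a b c r * (x12 a b c r)^-1 * (x23 a b c r)^-1)); last by locX_tac.
    by move=> a b c r rE Dr; have [_ _ [_ _ _ [_ _ _ H]]] := nfP r a b c rE Dr.
  + apply: (e x12); last by locX_tac.
    by move=> a b c r rE Dr; have [_ _ [_ _ _ [H _ _ _]]] := nfP r a b c rE Dr.
  + apply: (e (ent i1 i1)); last exact: localized_ent11.
    by move=> a b c r rE Dr; have [_ _ [H _ _ _]] := nfP r a b c rE Dr.
  + apply: (e (fun _ _ _ _ => 1)); last by locX_tac.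
    by move=> a b c r rE Dr; have [_ _ [_ _ H _]] := nfP r a b c rE Dr.
  + apply: (e c1); last by locX_tac.
    by move=> a b c r rE Dr; have [_ _ [_ _ _ [_ _ H _]]] := nfP r a b c rE Dr.
  + apply: (e x23); last by locX_tac.
    by move=> a b c r rE Dr; have [_ _ [_ _ _ [_ H _ _]]] := nfP r a b c rE Dr.
  + apply: (e (ent i2 i2)); last exact: localized_ent22.
    by move=> a b c r rE Dr; have [_ _ [H _ _ _]] := nfP r a b c rE Dr.
- exact: localized_add.
- exact: localized_mul.
Qed.

End Localization.
End OverSubring.
End Eigenfunctions.

(** * Derivations of the coordinate ring *)

Section Derivations.
Variable R : realType.
Local Notation C := (R[i]).
Local Notation T k := (@tn R k isT).

Definition rows3 (s : seq (seq C)) : 'M[C]_3 := \matrix_(i, j) nth 0 (nth [::] s i) j.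

Definition Adiag : 'M[C]_3 := dg 1 2 2^-1.
Definition Bgen : 'M[C]_3 := rows3 [:: [:: 0; 1; 1]; [:: 1; 0; 1]; [:: 1; 1; 1]].

Fact Adiag_det : \det Adiag == 1.
Proof. by rewrite det_dg mul1r divff// pnatr_eq0. Qed.

Fact Bgen_det : \det Bgen == 1.
Proof. by rewrite det3 !mxE /=; apply/eqP; ring. Qed.

(* Any pair whose image under [q_star] is off the discriminant and separates the
   two commutator traces would do. *)
Definition rho0 : rep R := (MkSL3 Adiag_det, MkSL3 Bgen_det).
Definition rho1 : rep R := q_star rho0.

Lemma rho1_fst : SL3_mx rho1.1 = dg 1 2 2^-1.
Proof. by rewrite /rho1 q_starE. Qed.

Lemma rho1_snd : SL3_mx rho1.2 = rows3 [:: [:: 2; 3/2; - (3/2)]; [:: 1; 2; -1];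
  [:: 1; 3/2; - 2^-1]].
Proof.
have n2 : (2 : C) != 0 by rewrite pnatr_eq0.
rewrite /rho1 q_starE -[(_, _).2]/(_ * _)%g !SL3_mulE.
rewrite (@SL3_inv_dg _ (MkSL3 Adiag_det) _ _ _ erefl).
have BV i j : SL3_mx (MkSL3 Bgen_det)^-1%g i j =
  rows3 [:: [:: -1; 0; 1]; [:: 0; -1; 1]; [:: 1; 1; -1]] i j.
  rewrite SL3_invE adj3 !mxE.
  by elim/ord3P: i; elim/ord3P: j; rewrite /next /=; ring.
apply/matrixP => i j; rewrite mulmx3 !BV !mul_mx_dg !mxE.
by elim/ord3P: i; elim/ord3P: j => /=; field.
Qed.

Lemma rho1_generic (D : CX R) : (forall a b c r, eigentriple a b c r.1 -> D r = 6 * XV a b c r) ->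
  D rho1 != 0.
Proof.
move=> DE; rewrite (DE _ _ _ _ (eigentriple_dg rho1_fst)) (XV_dg rho1_fst).
have n2 : (2 : C) != 0 by rewrite pnatr_eq0.
have n3 : (3 : C) != 0 by rewrite pnatr_eq0.
(* The products [x12], [x13], [x23] take the values 3/2, -3/2, -3/2 at [rho1]. *)
have VE : Vd 1 2 (2^-1 : C) = - (3 / 4) ^+ 2.
  by rewrite /Vd /Vd1 /Vd2 /Vd3; field.
rewrite VE /x12 /x13 /x23 rho1_snd !mxE /=.
rewrite [X in X != 0](_ : _ = 6 * (3 / 4) ^+ 8 * (3 / 2) ^+ 3); last by field.
by rewrite !mulf_neq0 ?expf_neq0 ?mulf_neq0 ?invr_eq0 ?pnatr_eq0.
Qed.

Lemma rho1_t5 : T 8 rho1 != t5' R rho1.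
Proof.
have n2 : (2 : C) != 0 by rewrite pnatr_eq0.
rewrite (T8_ktr rho1_fst) (t5'_ktr rho1_fst) -subr_eq0.
(* The terms [ktr] cancel; both factors of what remains equal 3/4. *)
rewrite [X in X != 0](_ : _ = (gam 1 2 2^-1 - gam' 1 2 2^-1) * (c1 1 2 2^-1 rho1 - c2 1 2 2^-1 rho1)); last ring.
rewrite /c1 /c2 /gam /gam' rho1_snd !mxE /=.
rewrite [X in X != 0](_ : _ = 9 / 16); last by field.
by rewrite mulf_neq0 ?invr_eq0 ?pnatr_eq0.
Qed.

(* The kernel of [delta] is a subalgebra stable under division by elements that
   [phi] does not kill; it contains the commutator trace since the latter is a
   root of a separable quadratic polynomial over the kernel. *)
Lemma derivation_eq0 (phi delta : CX R -> CX R) :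
  (exists r0, forall f, phi f r0 = f rho1) -> phi 1 = 1 ->
  linear delta ->
  (forall f g, delta (f * g) = phi f * delta g + delta f * phi g) ->
  (forall k (k9 : (k < 9)%N), (k < 8)%N -> delta (tn R k9) = 0) ->
  forall f, delta f = 0.
Proof.
move=> [r0 phiE] phi1 dlin dM dT.
have dD f g : delta (f + g) = delta f + delta g by have := dlin 1 f g; rewrite !scale1r.
have d1 : delta 1 = 0.
  by have := dM 1 1; rewrite phi1 !mul1r mulr1 -[LHS]addr0 => /addrI.
have d0 : delta 0 = 0 by have := dD 0 0; rewrite addr0 -[LHS]addr0 => /addrI.
pose K f := delta f = 0.
have Kcst (x : C) : K x%:A.
  by have := dlin x 1 0; rewrite addr0 d1 d0 scaler0 addr0.
have KD f g : K f -> K g -> K (f + g) by rewrite /K dD => -> ->; rewrite addr0.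
have KM f g : K f -> K g -> K (f * g) by rewrite /K dM => -> ->; rewrite mulr0 mul0r addr0.
have phi_neq0 (f : CX R) : f rho1 != 0 -> phi f != 0.
  by apply: contra_neq => f0; rewrite -phiE f0.
have [D KD' DE] := discriminant_ex Kcst KD KM dT.
have Ksat (f : CX R) : K (D * f) -> K f.
  (* As [D] is in the kernel, [delta (D * f)] is [phi D * delta f], and [phi D] is nonzero because
     [D rho1] is. *)
  rewrite /K dM KD' mul0r addr0 => /CX_mulf_eq0[D0|//].
  by have := phi_neq0 D (rho1_generic DE); rewrite D0 eqxx.
apply: (K_all Kcst KD KM dT KD' DE Ksat).
have kD : K (T 8 + t5' R) by exact: (K_t5D Kcst KD KM dT KD' DE Ksat).
have kM : K (T 8 * t5' R) by exact: (K_t5M Kcst KD KM dT KD' DE Ksat).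
rewrite /K dD in kD; have dt5' : delta (t5' R) = - delta (T 8).
  by apply/eqP; rewrite -addr_eq0 addrC kD.
(* The derivative of the quadratic equation of t_(5): its discriminant is the squared difference of
   the two roots, which [rho1] keeps apart. *)
have : (phi (t5' R) - phi (T 8)) * delta (T 8) = 0.
  by rewrite -kM dM dt5'; ring.
move=> /CX_mulf_eq0[/(congr1 (fun h : CX R => h r0))|//].
have -> : (phi (t5' R) - phi (T 8)) r0 = phi (t5' R) r0 - phi (T 8) r0 by [].
rewrite !phiE => /eqP; rewrite [_ == _]subr_eq0 eq_sym => E.
by have := rho1_t5; rewrite E.
Qed.

End Derivations.

(** * Piecewise linear paths *)

Section PiecewiseLinear.
Variable R : realType.
Local Notation plane := (plane R).
Implicit Types (V W : int -> plane) (k : int) (x t : R).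

(** The vertices are indexed by all integers, so that the lift of a closed loop has no end points to
    treat separately. *)
Definition PL V x : plane :=
  V (Num.floor x) + (x - (Num.floor x)%:~R) *: (V (Num.floor x + 1) - V (Num.floor x)).

Lemma PL_edge V k t : 0 <= t <= 1 -> PL V (k%:~R + t) = V k + t *: (V (k + 1) - V k).
Proof.
move=> /andP[t0]; rewrite le_eqVlt => /predU1P[->|t1].
  have -> : k%:~R + 1 = (k + 1)%:~R :> R by rewrite intrD.
  by rewrite /PL intrKfloor subrr scale0r addr0 scale1r [RHS]addrC subrK.
have fE : Num.floor (k%:~R + t) = k.
  by apply: floor_def; rewrite intrD; apply/andP; split; lra.
by rewrite /PL fE [k%:~R + t]addrC addrK.
Qed.

Lemma PLP x : exists k t, [/\ 0 <= t < 1, x = k%:~R + t & k = Num.floor x].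
Proof.
exists (Num.floor x), (x - (Num.floor x)%:~R); split=> //.
  have := floor_itv x; rewrite intrD => /andP[? ?].
  by apply/andP; split; lra.
by rewrite addrCA subrr addr0.
Qed.

Lemma PL_int V k : PL V k%:~R = V k.
Proof. by rewrite -[k%:~R]addr0 PL_edge ?scale0r ?addr0// lexx ler01. Qed.

Lemma PL_continuous V : continuous (PL V).
Proof.
move=> x; set m := Num.floor x.
(* Near [x] only the two edges meeting at vertex [m] matter; min and max join them in one continuous
   formula. *)
pose g y : plane := V m + Num.min 0 (y - m%:~R) *: (V m - V (m - 1))
  + Num.max 0 (y - m%:~R) *: (V (m + 1) - V m).
have gc : {for x, continuous g}.
  have sc : {for x, continuous (fun y : R => y - m%:~R : R^o)}.
    by apply: cvgB; [exact: cvg_id|exact: cvg_cst].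
  have zc : {for x, continuous (fun _ : R => 0 : R^o)} by exact: cvg_cst.
  apply: cvgD; [apply: cvgD; first exact: cvg_cst|]; apply: cvgZr_tmp.
  - exact: (continuous_min zc sc).
  - exact: (continuous_max zc sc).
have gE : {near x, g =1 PL V}.
  have /andP[mx xm] := floor_itv x; rewrite intrD in xm.
  near=> y.
  have y1 : m%:~R - 1 < y.
    by near: y; apply: lt_nbhsr; rewrite -/m in mx; lra.
  have y2 : y < m%:~R + 1 by near: y; apply: lt_nbhsl; rewrite /m.
  have [my|ym] := leP m%:~R y.
    have -> : y = m%:~R + (y - m%:~R) by rewrite addrCA subrr addr0.
    rewrite PL_edge; last by apply/andP; split; lra.
    rewrite /g [m%:~R + _]addrC addrK.
    rewrite (min_idPl _) ?(max_idPr _) ?scale0r ?addr0//; lra.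
  have -> : y = (m - 1)%:~R + (y - (m%:~R - 1)) by rewrite intrD; ring.
  rewrite PL_edge; last by apply/andP; split; lra.
  rewrite /g subrK intrD.
  have -> : (m%:~R + (-1)%:~R + (y - (m%:~R - 1)) - m%:~R : R) = y - m%:~R by ring.
  rewrite (min_idPr _) ?(max_idPl _) ?scale0r ?addr0; [|lra|lra].
  have -> : y - (m%:~R - 1) = 1 + (y - m%:~R) by ring.
  by rewrite [in RHS]scalerDl scale1r addrA [V (m - 1) + _]addrC subrK.
have gx : g x = PL V x by exact: (nbhs_singleton gE).
rewrite /continuous_at -gx.
apply: cvg_trans gc; exact: near_eq_cvg gE.
Unshelve. all: by end_near. Qed.
End PiecewiseLinear.

Section PLTheory.
Variable R : realType.
Local Notation plane := (plane R).
Implicit Types (V W : int -> plane) (k : int) (x t : R).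

Lemma plane_eq (z w : plane) : z.1 = w.1 -> z.2 = w.2 -> z = w.
Proof. by case: z w => ? ? [? ?] /= -> ->. Qed.

Lemma plane1D (z w : plane) : (z + w).1 = z.1 + w.1. Proof. by []. Qed.
Lemma plane2D (z w : plane) : (z + w).2 = z.2 + w.2. Proof. by []. Qed.
Lemma plane1N (z : plane) : (- z).1 = - z.1. Proof. by []. Qed.
Lemma plane2N (z : plane) : (- z).2 = - z.2. Proof. by []. Qed.
Lemma plane1Z t (z : plane) : (t *: z).1 = t * z.1. Proof. by []. Qed.
Lemma plane2Z t (z : plane) : (t *: z).2 = t * z.2. Proof. by []. Qed.
Definition planeE := (plane1D, plane2D, plane1N, plane2N, plane1Z, plane2Z).

Lemma PL_itvP (n : nat) x : (0 < n)%N -> 0 <= x <= n%:R ->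
  exists (k : nat) t, [/\ (k < n)%N, 0 <= t <= 1 & x = k%:R + t].
Proof.
move=> n0 /andP[x0 xn]; have [k [t [/andP[t0 t1] xE _]]] := PLP x.
have k0 : 0 <= k.
  rewrite -ltzD1 -(ltr_int R) intrD; lra.
case: k k0 xE => // k _; rewrite -pmulrn => xE.
have : (k <= n)%N by rewrite -(ler_nat R); lra.
rewrite leq_eqVlt => /predU1P[kn|kn]; last first.
  by exists k, t; split=> //; apply/andP; split; lra.
(* The right end [x = n] belongs to the last edge, with parameter 1. *)
have n1 : (n.-1 < n)%N by rewrite ltn_predL.
have nE : n%:R = n.-1%:R + 1 :> R by rewrite -[n in LHS](prednK n0) -addn1 natrD.
exists n.-1, 1; split=> //; first by rewrite ler01 lexx.
by rewrite -nE; move: xE; rewrite kn; lra.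
Qed.

(** Only [n] consecutive edges are compared, because a product loop follows each of its factors for
    a single period. *)
Lemma PL_shift V W (n : nat) i z x : (0 < n)%N -> 0 <= x <= n%:R ->
  (forall k : nat, (k <= n)%N -> W k = V (k%:Z + i) + z) ->
  PL W x = PL V (x + i%:~R) + z.
Proof.
move=> n0 /(PL_itvP n0)[k [t [kn t01 ->]]] WV; rewrite pmulrn.
rewrite (_ : _ + _ + i%:~R = (k%:Z + i)%:~R + t :> R); last by rewrite intrD; ring.
rewrite !PL_edge// (_ : k%:Z + 1 = k.+1%:Z); last by rewrite -addn1.
rewrite !WV// 1?ltnW// [k.+1%:Z + i](_ : _ = k%:Z + i + 1); last by rewrite -addn1 PoszD; ring.
by rewrite opprD addrACA subrr addr0 addrAC.
Qed.

Lemma PL_shiftT V W i z x : (forall k, W k = V (k + i) + z) ->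
  PL W x = PL V (x + i%:~R) + z.
Proof.
move=> WV; have [k [t [/andP[t0 t1] -> _]]] := PLP x.
have t01 : 0 <= t <= 1 by apply/andP; split; lra.
rewrite (_ : _ + _ + i%:~R = (k + i)%:~R + t :> R); last by rewrite intrD; ring.
rewrite !PL_edge// !WV (_ : k + 1 + i = k + i + 1); last by ring.
by rewrite opprD addrACA subrr addr0 addrAC.
Qed.

Lemma PL_mix V W s x : PL (fun k => (1 - s) *: V k + s *: W k) x =
  (1 - s) *: PL V x + s *: PL W x.
Proof.
have [k [t [/andP[t0 t1] -> _]]] := PLP x.
have t01 : 0 <= t <= 1 by apply/andP; split; lra.
rewrite !PL_edge//; move: (V k) (V (k + 1)) (W k) (W (k + 1)) => a b c d.
by apply: plane_eq; rewrite !planeE; ring.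
Qed.

Lemma is_derive_affine (f : R -> plane) x w :
  (\forall y \near x, f y = f x + (y - x) *: w) -> is_derive x 1 f w.
Proof.
move=> fE; have dE : h^-1 *: (f (h *: 1 + x) - f x) @[h --> (0 : R)^'] --> w.
  apply: (@cvg_trans _ ((fun=> w) @ (0 : R)^')); last exact: cvg_cst.
  apply: near_eq_cvg; near=> h.
  have h0 : h != 0 by near: h; exact: nbhs_dnbhs_neq.
  have -> : f (h *: 1 + x) = f x + (h *: 1 + x - x) *: w.
    near: h; apply: nbhs_dnbhs.
    have hc : (h *: (1 : R) + x) @[h --> (0 : R)] --> x.
      rewrite -[X in _ --> X]add0r -[X in X + _](scale0r (1 : R)).
      by apply: cvgD; [apply: cvgZr_tmp; exact: cvg_id|exact: cvg_cst].
    exact: hc fE.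
  by rewrite addrK addrAC subrr add0r /GRing.scale/= mulr1 -/(GRing.scale _ _) scalerA mulVf// scale1r.
split; first by apply/cvg_ex; exists w.
exact: cvg_lim dE.
Unshelve. all: by end_near. Qed.

Lemma PL_near V k : V (k + 1) - V k = V k - V (k - 1) ->
  \forall y \near (k%:~R : R), PL V y = V k + (y - k%:~R) *: (V (k + 1) - V k).
Proof.
move=> Vk; near=> y.
have y1 : k%:~R - 1 < y by near: y; apply: lt_nbhsr; lra.
have y2 : y < k%:~R + 1 by near: y; apply: lt_nbhsl; lra.
have [my|ym] := leP k%:~R y.
  have -> : PL V y = PL V (k%:~R + (y - k%:~R)) by rewrite addrCA subrr addr0.
  by rewrite PL_edge//; apply/andP; split; lra.
have -> : PL V y = PL V ((k - 1)%:~R + (y - (k%:~R - 1))).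
  by congr (PL V _); rewrite intrD; ring.
rewrite PL_edge; last by apply/andP; split; lra.
rewrite subrK Vk (_ : y - (k%:~R - 1) = 1 + (y - k%:~R)); last by ring.
by rewrite [in LHS]scalerDl scale1r addrA [V (k - 1) + _]addrC subrK.
Unshelve. all: by end_near. Qed.

(** The loops cross at vertices. A velocity exists there since the two edges at the vertex are equal
    as vectors. *)
Lemma PL_is_derive V k (n : nat) : (0 < n)%N -> V (k + 1) - V k = V k - V (k - 1) ->
  is_derive (k%:~R / n%:R : R) 1 (fun u => PL V (n%:R * u)) (n%:R *: (V (k + 1) - V k)).
Proof.
move=> n0 Vk; have nR : (n%:R : R) != 0 by rewrite pnatr_eq0 -lt0n.
have xE : n%:R * (k%:~R / n%:R) = k%:~R :> R by rewrite mulrCA divff// mulr1.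
apply: is_derive_affine; rewrite xE PL_int.
have hc : (n%:R * u) @[u --> (k%:~R / n%:R : R)] --> (k%:~R : R).
  by rewrite -[X in _ --> X]xE; exact: mulrl_continuous.
have H : \forall u \near (k%:~R / n%:R : R), PL V (n%:R * u) =
    V k + (n%:R * u - k%:~R) *: (V (k + 1) - V k) := hc _ (PL_near Vk).
apply: filterS H => u ->.
rewrite scalerA; congr (_ + _ *: _).
by rewrite mulrBl divfK// [u * _]mulrC.
Qed.

End PLTheory.

(** * Piecewise linear loops in the pair of pants *)

Section Pants.
Variable R : realType.
Local Notation plane := (plane R).
Local Notation S3 := (Sigma30 R).
Implicit Types (V W : int -> plane) (k : int) (x t : R).

Definition convex_set (Q : set plane) :=
  forall z w t, 0 <= t <= 1 -> Q z -> Q w -> Q ((1 - t) *: z + t *: w).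

(** A convex piece of the region that contains an edge of each of two paths contains every stage of
    the linear homotopy between these edges. *)
Definition fits (a b c d : plane) := exists Q : set plane,
  [/\ Q `<=` region S3, convex_set Q & [/\ Q a, Q b, Q c & Q d]].

Lemma deck30Z (v : plane) m : deck S3 v -> deck S3 (m%:~R *: v).
Proof.
by move=> [n ->]; exists (m * n); apply: plane_eq; rewrite !planeE /= ?intrM; ring.
Qed.

Lemma region30D (z v : plane) : deck S3 v -> region S3 z -> region S3 (z + v).
Proof.
move=> [m ->] [/= z01 zh]; split; first by rewrite addr0.
move=> [i [j H]]; apply: zh; exists i, (j - m).
by move: H; rewrite !planeE /= addr0 intrB; congr (_ + _ ^+ 2 < _); ring.
Qed.

Lemma fitsD v a b c d : deck S3 v -> fits a b c d ->
  fits (a + v) (b + v) (c + v) (d + v).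
Proof.
move=> dv [Q [QS Qc [Qa Qb Qc' Qd]]]; exists [set z | Q (z - v)]; split.
- by move=> z /QS /(region30D dv); rewrite subrK.
- move=> z w t t01 /= Qz Qw; have := Qc _ _ _ t01 Qz Qw.
  by congr Q; apply: plane_eq; rewrite !planeE; ring.
- by rewrite /= !addrK.
Qed.

Definition quasi (n : nat) (P : plane) V := forall k, V (k + n%:Z) = V k + P.

Definition edges_fit V W := forall k, fits (V k) (V (k + 1)) (W k) (W (k + 1)).

Lemma quasiZ n P V m k : quasi n P V -> V (k + m * n%:Z) = V k + m%:~R *: P.
Proof.
move=> qV; have qN i j : V (i + j%:Z * n%:Z) = V i + j%:~R *: P.
  elim: j => [|j IH]; first by rewrite mul0r scale0r !addr0.
  by rewrite -addn1 PoszD mulrDl mul1r addrA qV IH intrD scalerDl scale1r addrA.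
case: m => // m; rewrite NegzE mulNr.
have := qN (k - m.+1%:Z * n%:Z) m.+1; rewrite subrK => ->.
by rewrite intrN scaleNr addrK.
Qed.

Lemma edges_fit_period n P V W : (0 < n)%N -> deck S3 P -> quasi n P V -> quasi n P W ->
  (forall k : nat, (k < n)%N -> fits (V k%:Z) (V (k%:Z + 1)) (W k%:Z) (W (k%:Z + 1))) ->
  edges_fit V W.
Proof.
move=> n0 dP qV qW H k.
have nZ : n%:Z != 0 by rewrite eqz_nat -lt0n.
have kE : k = ((k %% n%:Z)%Z + (k %/ n%:Z)%Z * n%:Z).
  by rewrite addrC -divz_eq.
have r0 := modz_ge0 k nZ; have rn := ltz_mod k nZ.
move: kE r0 rn; case: (_ %% _)%Z => // r; move: (_ %/ _)%Z => q -> _ rn.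
rewrite [_ + 1]addrAC !(quasiZ _ _ qV) !(quasiZ _ _ qW).
by apply: fitsD; [exact: deck30Z|apply: H; move: rn; rewrite ltz_nat].
Qed.

Lemma region_PL V x : edges_fit V V -> region S3 (PL V x).
Proof.
move=> fV; have [k [t [/andP[t0 t1] -> _]]] := PLP x.
have t01 : 0 <= t <= 1 by apply/andP; split; lra.
have [Q [QS Qc [Qa Qb _ _]]] := fV k.
apply: QS; rewrite PL_edge// (_ : _ + _ = (1 - t) *: V k + t *: V (k + 1)); first exact: Qc.
by apply: plane_eq; rewrite !planeE; ring.
Qed.

Lemma region_PL_mix V W s x : 0 <= s <= 1 -> edges_fit V W ->
  region S3 ((1 - s) *: PL V x + s *: PL W x).
Proof.
move=> s01 fVW; have [k [t [/andP[t0 t1] -> _]]] := PLP x.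
have t01 : 0 <= t <= 1 by apply/andP; split; lra.
have [Q [QS Qc [Qa Qb Qa' Qb']]] := fVW k.
apply: QS; rewrite -PL_mix PL_edge//.
rewrite (_ : _ + _ = (1 - t) *: ((1 - s) *: V k + s *: W k) +
   t *: ((1 - s) *: V (k + 1) + s *: W (k + 1))).
  by apply: (Qc _ _ _ t01); exact: (Qc _ _ _ s01).
by apply: plane_eq; rewrite !planeE; ring.
Qed.

Lemma PL_quasi n P V x : quasi n P V -> PL V (x + n%:R) = PL V x + P.
Proof.
move=> qV; rewrite -[n%:R]/(n%:Z%:~R) -[LHS](subrK P); congr (_ + _).
by rewrite (@PL_shiftT _ V V n%:Z (- P) x)// => k; rewrite qV addrK.
Qed.

Section MakeLoop.
Variables (n : nat) (P : plane) (V : int -> plane).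
Hypotheses (n0 : (0 < n)%N) (dP : deck S3 P) (qV : quasi n P V) (fV : edges_fit V V).

Fact PL_loop_continuous : continuous (fun u : R => PL V (n%:R * u)).
Proof.
move=> u; apply: (@continuous_comp _ _ _ ( *%R (n%:R : R)) (PL V)).
  exact: mulrl_continuous.
exact: PL_continuous.
Qed.

Fact PL_loop_periodic u : PL V (n%:R * (u + 1)) = PL V (n%:R * u) + P.
Proof. by rewrite mulrDr mulr1 (PL_quasi _ qV). Qed.

Definition PL_loop : loop S3 := @Loop R S3 (fun u => PL V (n%:R * u)) P
  PL_loop_continuous (fun u => region_PL _ fV) dP PL_loop_periodic.

End MakeLoop.

(** Homotopies have time in all of [R]; clamping extends one constantly beyond [0, 1]. *)
Definition clamp01 (s : R) : R := Num.max 0 (Num.min 1 s).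

Lemma clamp01_itv s : 0 <= clamp01 s <= 1.
Proof.
by rewrite /clamp01 le_max lexx /= ge_max ler01 ge_min lexx.
Qed.

Lemma clamp01_continuous : continuous clamp01.
Proof.
move=> x; have c0 : {for x, continuous (fun=> 0 : R^o)} by exact: cvg_cst.
have c1 : {for x, continuous (fun=> 1 : R^o)} by exact: cvg_cst.
have ci : {for x, continuous (fun y : R => y : R^o)} by exact: cvg_id.
exact: (continuous_max c0 (continuous_min c1 ci)).
Qed.

(* The homotopy interpolates linearly between the loops while shifting the time
   by [j] vertices. *)
Lemma homotopic_PL n P V W j v (c d : loop S3) :
  (forall u, c u = PL V (n%:R * u)) -> (forall u, d u = PL W (n%:R * u)) ->
  quasi n P V -> quasi n P W -> period c = P -> deck S3 v ->
  edges_fit V (fun k => W (k - j) + v) -> homotopic c d.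
Proof.
move=> cE dE qV qW cP dv fVW; set W' := fun k => W (k - j) + v in fVW.
pose arg (z : R * R) : R := n%:R * z.2 + clamp01 z.1 * j%:~R.
exists (fun z => (1 - clamp01 z.1) *: PL V (arg z) + clamp01 z.1 *: PL W' (arg z)), v.
have qW' : quasi n P W' by move=> k; rewrite /W' addrAC qW addrAC.
split=> //.
- move=> z; have cz : {for z, continuous (fun z : R * R => clamp01 z.1)}.
    apply: (@continuous_comp _ _ _ (fun z : R * R => z.1) clamp01); first exact: cvg_fst.
    exact: clamp01_continuous.
  have az : {for z, continuous arg}.
    apply: cvgD.
      apply: (@continuous_comp _ _ _ (fun z : R * R => z.2) ( *%R (n%:R : R))); first exact: cvg_snd.
      exact: mulrl_continuous.
    apply: (@continuous_comp _ _ _ (fun z : R * R => clamp01 z.1) ( *%R^~ (j%:~R : R))) => //.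
    exact: mulrr_continuous.
  have PLc U : {for z, continuous (fun z => PL U (arg z))}.
    by apply: (@continuous_comp _ _ _ arg (PL U)) => //; exact: PL_continuous.
  apply: cvgD; apply: cvgZ => //; try exact: PLc.
  by apply: cvgB => //; exact: cvg_cst.
- by move=> z; apply: region_PL_mix => //; exact: clamp01_itv.
- move=> s u /=; have -> : arg (s, u + 1) = arg (s, u) + n%:R by rewrite /arg /=; ring.
  rewrite (PL_quasi _ qV) (PL_quasi _ qW') cP.
  by apply: plane_eq; rewrite !planeE; ring.
- move=> u; split.
    rewrite /arg /= /clamp01 (min_idPr _) ?ler01// maxxx.
    by rewrite subr0 scale1r scale0r mul0r !addr0 cE.
  rewrite /arg /= /clamp01 minxx (max_idPr _) ?ler01//.
  rewrite subrr scale0r scale1r add0r mul1r dE.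
  rewrite (@PL_shiftT _ W W' (- j) v)// intrN.
  by congr (PL W _ + v); ring.
Qed.

Definition straight V k := V (k + 1) - V k = V k - V (k - 1).

(** The hypotheses relating [U] to its factors involve finitely many vertices, hence can be checked
    by computation: the first half of a period of [U] follows [V] from vertex [i], the second half a
    translate of [W] from vertex [j]. *)
Lemma is_product_PL n P P' V W U i j (c d e : loop S3) : (0 < n)%N ->
  (forall u, c u = PL V (n%:R * u)) -> (forall u, d u = PL W (n%:R * u)) ->
  (forall u, e u = PL U ((n + n)%:R * u)) ->
  quasi n P V -> quasi n P' W ->
  (forall k : nat, (k <= n)%N -> U k%:Z = V (k%:Z + i)) ->
  (forall k : nat, (k <= n)%N -> U (k + n)%N%:Z = W (k%:Z + j) + (V i + P - W j)) ->
  is_product c d (i%:~R / n%:R, j%:~R / n%:R) e.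
Proof.
move=> n0 cE dE eE qV qW UV UW u.
have nR : (n%:R : R) != 0 by rewrite pnatr_eq0 -lt0n.
have ng0 : 0 < n%:R :> R by rewrite ltr0n.
have shiftE (k : int) (y : R) : n%:R * (k%:~R / n%:R + y) = n%:R * y + k%:~R.
  by rewrite mulrDr mulrCA divff// mulr1 addrC.
split=> /andP[u0 u1].
  rewrite eE cE shiftE -[RHS]addr0 (@PL_shift _ V U n i 0)//.
  - by congr (PL V (_ + _) + 0); rewrite natrD; ring.
  - rewrite natrD; apply/andP; split; nra.
  - by move=> k kn; rewrite addr0 UV.
rewrite eE cE 2!dE 2!shiftE.
have -> : PL V (n%:R * 1 + i%:~R) = V i + P.
  by rewrite mulr1 addrC (PL_quasi _ qV) PL_int.
have -> : PL W (n%:R * (j%:~R / n%:R)) = W j.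
  by rewrite mulrCA divff// mulr1 PL_int.
pose U' k := U (k + n%:Z).
have -> : PL U ((n + n)%:R * u) = PL U' (n%:R * (2 * u - 1)).
  rewrite (@PL_shiftT _ U U' n%:Z 0); last by move=> k; rewrite addr0.
  by rewrite addr0 -pmulrn; congr (PL U _); rewrite natrD; ring.
rewrite (@PL_shift _ W U' n j (V i + P - W j))//.
by apply/andP; split; nra.
Qed.

Lemma polygonE (vs : seq plane) (q : nat) x : (q < size vs)%N -> q%:R <= x <= q%:R + 1 ->
  \sum_(k < size vs) Num.max 0 (Num.min 1 (x - k%:R)) *: nth 0 vs k =
  \sum_(k < q) nth 0 vs k + (x - q%:R) *: nth 0 vs q.
Proof.
move=> qn /andP[qx xq].
rewrite -(big_mkord xpredT (fun k : nat => Num.max 0 (Num.min 1 (x - k%:R)) *: nth 0 vs k)).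
rewrite (@big_cat_nat _ _ _ q)//=; last exact: ltnW.
rewrite big_mkord [X in _ + X]big_ltn//; congr (_ + _).
  apply: eq_bigr => k _; have kq : (k.+1 <= q)%N by [].
  rewrite -(ler_nat R) -addn1 natrD in kq.
  rewrite (min_idPl _); last by lra.
  by rewrite (max_idPr _) ?ler01// scale1r.
rewrite big_nat big1 ?addr0; last first.
  move=> k /andP[qk _]; rewrite -(ler_nat R) -addn1 natrD in qk.
  rewrite (min_idPr _); last by lra.
  by rewrite (max_idPl _) ?scale0r//; lra.
rewrite (min_idPr _); last by lra.
by rewrite (max_idPr _)//; lra.
Qed.

(* Steps are cut in two so that polygonal paths of words have vertices to match
   those of the loops below. *)
Definition subdivides W (vs : seq plane) := forall q : nat, (q < size vs)%N ->
  let s := \sum_(k < q) nth 0 vs k in let v := nth 0 vs q in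
  [/\ W (2 * q)%N%:Z = s, W (2 * q).+1%:Z = s + 2^-1 *: v & W (2 * q).+2%:Z = s + v].

Lemma polygon_PL W (vs : seq plane) u : (0 < size vs)%N -> subdivides W vs ->
  0 <= u <= 1 -> polygon vs u = PL W ((2 * size vs)%:R * u).
Proof.
move=> n0 Wvs /andP[u0 u1]; set n := size vs in n0 *.
have ng0 : 0 < n%:R :> R by rewrite ltr0n.
have u02 : 0 <= (2 * n)%:R * u <= (2 * n)%:R by rewrite natrM; apply/andP; split; nra.
have n20 : (0 < 2 * n)%N by rewrite muln_gt0.
have [k [t [kn t01 xE]]] := PL_itvP n20 u02.
have uE : n%:R * u = k%:R / 2 + t / 2.
  by rewrite -mulrDl -xE natrM; field.
have kE := odd_double_half k; move: kE kn xE uE; set q := k./2 => kE kn xE uE.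
have qn : (q < n)%N.
  by rewrite -ltn_double -mul2n -[n.*2]mul2n mul2n; apply: leq_ltn_trans kn; rewrite -kE leq_addl.
have [W0 W1 W2] := Wvs q qn.
have /andP[t0 t1] := t01.
rewrite /polygon -/n xE -[k%:R]/(k%:Z%:~R) PL_edge// (_ : k%:Z + 1 = k.+1%:Z); last by rewrite -addn1.
move: kE uE; case: (odd k) => /= <-; rewrite ?add0n ?add1n -mul2n => uE.
- have -> : n%:R * u = q%:R + (2^-1 + t / 2).
    by rewrite uE -addn1 natrD natrM; field.
  rewrite (@polygonE vs q)//; last by apply/andP; split; lra.
  by rewrite W1 W2; apply: plane_eq; rewrite !planeE; field.
- have -> : n%:R * u = q%:R + t / 2 by rewrite uE natrM; field.
  rewrite (@polygonE vs q)//; last by apply/andP; split; lra.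
  by rewrite W0 W1; apply: plane_eq; rewrite !planeE; field.
Qed.

Lemma represents_PL P V W j v (w : word) (c : loop S3) :
  let vs := steps S3 w in (0 < size vs)%N ->
  (forall u, c u = PL V ((2 * size vs)%:R * u)) -> period c = P -> deck S3 P ->
  quasi (2 * size vs) P V -> quasi (2 * size vs) P W ->
  subdivides W vs -> deck S3 v ->
  edges_fit W W -> edges_fit V (fun k => W (k - j) + v) -> represents c w.
Proof.
move=> vs n0 cE cP dP qV qW Wvs dv fW fVW.
exists (PL_loop dP qW fW); first by move=> u u01; rewrite (polygon_PL n0 Wvs).
exact: (homotopic_PL cE _ qV qW cP dv fVW).
Qed.

End Pants.

(** * Explicit loops *)

Section IntegerVertices.

Definition ipt : Type := (int * int)%type.
Implicit Types (vs : seq ipt) (a b : ipt).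

Definition iadd a b : ipt := (a.1 + b.1, a.2 + b.2).

(* The quasi-periodic sequence of vertices, in units of 1/64, of a loop with
   one period [vs] and with period [(0, p)]. *)
Definition vert vs (p k : int) : ipt :=
  iadd (nth (0, 0) vs `|(k %% (size vs)%:Z)%Z|%N) (0, 64 * p * (k %/ (size vs)%:Z)%Z).

(* The four points lie in the left strip, in the right strip or in one of the
   bridges between two consecutive holes. *)
Definition fitsb a b c d : bool :=
  let zs := [:: a; b; c; d] in
  [|| all (fun z => (0 <= z.1) && (z.1 <= 16)) zs,
      all (fun z => (48 <= z.1) && (z.1 <= 64)) zs |
      has (fun m : int => all (fun z => [&& 0 <= z.1, z.1 <= 64, m * 64 - 16 <= z.2 &
        z.2 <= m * 64 + 16]) zs) [:: -4; -3; -2; -1; 0; 1; 2; 3; 4]].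

Definition fits_check vs p ws r j m : bool :=
  all (fun k : nat => fitsb (vert vs p k) (vert vs p (k%:Z + 1))
     (iadd (vert ws r (k%:Z - j)) (0, 64 * m)) (iadd (vert ws r (k%:Z + 1 - j)) (0, 64 * m)))
    (iota 0 (size vs)).

Definition imark (x : gen) : seq ipt :=
  if x is X1 then [:: (0, 64)] else [:: (64, 0); (0, -64); (-64, 0)].

Definition isteps (w : word) : seq ipt :=
  flatten [seq if l.2 then [seq (- v.1, - v.2) | v <- rev (imark l.1)] else imark l.1 | l <- w].

Definition isum (vs : seq ipt) (q : nat) : ipt := foldr iadd (0, 0) (take q vs).

Definition word_vertices (w : word) : seq ipt :=
  flatten [seq let s := isum (isteps w) q in let s' := isum (isteps w) q.+1 in
     [:: s; (((s.1 + s'.1) %/ 2)%Z, ((s.2 + s'.2) %/ 2)%Z)] | q <- iota 0 (size (isteps w))].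

(** Midpoints are compared after doubling, which certifies that the integer halving in
    [word_vertices] is exact. The last partial sum falls in the next period and so certifies [p]. *)
Definition word_check (w : word) p : bool :=
  let vs := isteps w in let ws := word_vertices w in
  [&& (0 < size vs)%N, size ws == (2 * size vs)%N, fits_check ws p ws p 0 0 &
   all (fun q : nat => let s := isum vs q in let s' := isum vs q.+1 in
     [&& vert ws p (2 * q)%N%:Z == s,
      iadd (vert ws p (2 * q).+1%:Z) (vert ws p (2 * q).+1%:Z) == iadd s s' &
      vert ws p (2 * q).+2%:Z == s']) (iota 0 (size vs))].

(** A homotopy matches vertices one to one, so [vs] needs two per step of the word; loops with fewer
    corners repeat vertices. [j] shifts time, [m] is a vertical translation. *)
Definition represents_check vs p (w : word) j m : bool :=
  [&& word_check w p, size vs == (2 * size (isteps w))%N &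
      fits_check vs p (word_vertices w) p j m].

(** Listed in units of 1/16. The lift passes successive holes on the left and on the right in turn
    and closes up after winding twice around the annulus. [t4'_vertices] does so downwards,
    displaced so as to meet it at two points only. *)
Definition t4_vertices : seq ipt := [seq (4 * z.1, 4 * z.2) | z : ipt <-
  [:: (8, -1); (2, 1); (1, 8); (2, 15); (8, 17); (14, 19); (13, 24); (14, 29)]].
Definition t4'_vertices : seq ipt := [seq (4 * z.1, 4 * z.2) | z : ipt <-
  [:: (8, -1); (2, -3); (3, -8); (2, -13); (8, -15); (14, -17); (15, -24); (14, -31)]].


(* A linear form separates the segments [ab] and [a'b'] without their endpoints
   [b] and [b'], which belong to the next edges. *)
Definition half_separated a b a' b' : bool :=
  let f (l : ipt) (z : ipt) := l.1 * z.1 + l.2 * z.2 in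
  has (fun l : ipt =>
    let x := f l a in let y := f l b in let x' := f l a' in let y' := f l b' in
    if x < x' then [&& y < x', x <= y' & y <= y']
    else [&& x' < x, y' < x, x' <= y & y' <= y])
  [:: (1, 0); (-1, 0); (0, 1); (0, -1); (1, 3); (1, -3); (-1, 3); (-1, -3);
      (6, 1); (6, -1); (-6, 1); (-6, -1)].

(** Two heights within this bound differ by at most 272/64 < 5, so translates by more than 4 cannot
    meet. *)
Definition heights_check vs p : bool :=
  all (fun i : nat => (-136 <= (vert vs p i%:Z).2) && ((vert vs p i%:Z).2 <= 136))
    (iota 0 (size vs).+1).

Definition cross_check vs p ws r (exc : seq (nat * nat * int)) : bool :=
  [&& heights_check vs p, heights_check ws r &
  all (fun i : nat => all (fun j : nat => all (fun m : int =>
    if (i, j, m) \in exc then true else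
    half_separated (vert vs p i%:Z) (vert vs p (i%:Z + 1))
      (iadd (vert ws r j%:Z) (0, 64 * m)) (iadd (vert ws r (j%:Z + 1)) (0, 64 * m)))
    [:: -4; -3; -2; -1; 0; 1; 2; 3; 4])
    (iota 0 (size ws))) (iota 0 (size vs))].

(* Vertices, period and word of a loop for each of the traces t_(1), ..., t_(-4);
   the last component is the time shift that matches the vertices with those of
   the polygonal path of the word. *)
Definition basic_loop (k : nat) : seq ipt * int * word * int :=
  match k with
  | 0 => ([:: (1, 0); (1, 32)], 1, [:: (X1, false)], 0)
  | 1 => ([:: (2, 0); (2, -32)], -1, [:: (X1, true)], 0)
  | 2 => ([:: (63, 0); (63, 0); (63, 0); (63, -32); (63, -64); (63, -64)], -1,
          [:: (X2, false)], 0)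
  | 3 => ([:: (62, 0); (62, 0); (62, 0); (62, 32); (62, 64); (62, 64)], 1,
          [:: (X2, true)], 0)
  | 4 => ([:: (14, 14); (14, 32); (14, 50); (32, 50); (50, 50); (50, 32); (50, 14); (32, 14)],
          0, [:: (X1, false); (X2, false)], 0)
  | 5 => ([:: (13, -13); (13, -32); (13, -51); (32, -51); (51, -51); (51, -32); (51, -13);
              (32, -13)], 0, [:: (X1, true); (X2, true)], 0)
  | 6 => (t4_vertices, 2, [:: (X1, false); (X2, true)], 1)
  | _ => (t4'_vertices, -2, [:: (X1, true); (X2, false)], 1)
  end.

Definition basic_check k : bool := let: (vs, p, w, j) := basic_loop k in
  represents_check vs p w j 0.

Definition basic_cross k l exc : bool := let: (vs, p, _, _) := basic_loop k in
  let: (ws, r, _, _) := basic_loop l in cross_check vs p ws r exc.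

(* The products of the last two loops at their two crossings. *)
Definition product_A : seq ipt := [seq (4 * z.1, 4 * z.2) | z : ipt <-
  [:: (8, -1); (2, 1); (1, 8); (2, 15); (8, 17); (14, 19); (13, 24); (14, 29);
      (8, 31); (2, 29); (3, 24); (2, 19); (8, 17); (14, 15); (15, 8); (14, 1)]].
Definition product_B : seq ipt := [seq (4 * z.1, 4 * z.2) | z : ipt <-
  [:: (8, 17); (14, 19); (13, 24); (14, 29); (8, 31); (2, 33); (1, 40); (2, 47);
      (8, 49); (14, 47); (15, 40); (14, 33); (8, 31); (2, 29); (3, 24); (2, 19)]].
Definition word_A : word := [:: (X1, false); (X2, true); (X1, true); (X2, false)].
Definition word_B : word := [:: (X2, true); (X1, false); (X2, false); (X1, true)].

(** The hypotheses of [is_product_PL] for two loops of 8 edges; (0, 128) is the period of the first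
    one. *)
Definition product_check us i j : bool :=
  let V := vert t4_vertices 2 in let W := vert t4'_vertices (-2) in
  all (fun k : nat => (vert us 0 k%:Z == V (k%:Z + i)) &&
     (vert us 0 (k + 8)%N%:Z ==
        iadd (W (k%:Z + j)) (iadd (V i) (iadd (0, 128) (- (W j).1, - (W j).2)))))
    (iota 0 9).

Definition straightb vs p k := 
  let V := vert vs p in
  ((V (k + 1)).1 - (V k).1 == (V k).1 - (V (k - 1)).1) &&
  ((V (k + 1)).2 - (V k).2 == (V k).2 - (V (k - 1)).2).

Fact basic_checked : all basic_check (iota 0 8). Proof. by vm_compute. Qed.
Fact basic_crossed : all (fun k => all (fun l => ((k < l)%N && (k < 6)%N) ==>
  basic_cross k l [::]) (iota 0 8)) (iota 0 8). Proof. by vm_compute. Qed.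
Fact crossed67 : cross_check t4_vertices 2 t4'_vertices (-2)
  [:: (0%N, 0%N, 0); (4%N, 4%N, 2)]. Proof. by vm_compute. Qed.
Fact product_A_checked : represents_check product_A 0 word_A 1 0. Proof. by vm_compute. Qed.
Fact product_A_product : product_check product_A 0 0. Proof. by vm_compute. Qed.
Fact product_B_product : product_check product_B 4 4. Proof. by vm_compute. Qed.
Fact product_B_checked : represents_check product_B 0 word_B (-1) 1. Proof. by vm_compute. Qed.
Fact straight67 : all (fun k => straightb t4_vertices 2 k && straightb t4'_vertices (-2) k) [:: 0; 4].
Proof. by vm_compute. Qed.
End IntegerVertices.

(** * Geometric meaning of the checks *)

Section Soundness.
Variable R : realType.
Local Notation plane := (plane R).
Local Notation S3 := (Sigma30 R).
Implicit Types (vs ws : seq ipt) (a b c d : ipt) (p r : int).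

Definition pt (a : ipt) : plane := (a.1%:~R / 64, a.2%:~R / 64).
Definition PV vs p (k : int) : plane := pt (vert vs p k).

Lemma pt_iadd a b : pt (iadd a b) = pt a + pt b.
Proof. by apply: plane_eq; rewrite planeE /= intrD mulrDl. Qed.

Lemma pt_deck (m : int) : pt (0, 64 * m) = (0, m%:~R).
Proof. by apply: plane_eq; rewrite /= ?mul0r// intrM mulrAC divff ?mul1r// pnatr_eq0. Qed.

Lemma deck_vertical (m : int) : deck S3 ((0, m%:~R) : plane).
Proof. by exists m. Qed.

Lemma PV_quasi vs p : (0 < size vs)%N -> quasi (size vs) (0, p%:~R) (PV vs p).
Proof.
move=> n0 k; have nZ : (size vs)%:Z != 0 by rewrite eqz_nat -lt0n.
rewrite /PV /vert modzDr divzDr ?dvdzz// divzz nZ /= -pt_deck -pt_iadd; congr pt.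
by rewrite /iadd /= addr0 -addrA; congr (_, _ + _); ring.
Qed.

Lemma left_convex : convex_set [set z : plane | 0 <= z.1 <= 4^-1].
Proof.
move=> z w t /andP[t0 t1] /andP[z0 z1] /andP[w0 w1].
by rewrite /mkset !planeE; apply/andP; split; nra.
Qed.

Lemma right_convex : convex_set [set z : plane | 3/4 <= z.1 <= 1].
Proof.
move=> z w t /andP[t0 t1] /andP[z0 z1] /andP[w0 w1].
by rewrite /mkset !planeE; apply/andP; split; nra.
Qed.

Lemma bridge_convex (m : int) : convex_set
  [set z : plane | (0 <= z.1 <= 1) && (m%:~R - 4^-1 <= z.2 <= m%:~R + 4^-1)].
Proof.
move=> z w t /andP[t0 t1] /andP[/andP[z0 z1] /andP[z2 z3]] /andP[/andP[w0 w1] /andP[w2 w3]].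
by rewrite /mkset !planeE; apply/andP; split; apply/andP; split; nra.
Qed.

(** The strips and bridges avoid the whole open square around a hole, so this box is all that the
    disc contributes. *)
Lemma hole_bounds (x y : R) : x ^+ 2 + y ^+ 2 < 4^-1 ^+ 2 ->
  [/\ - 4^-1 < x, x < 4^-1, - 4^-1 < y & y < 4^-1].
Proof. by move=> h; split; nra. Qed.

Lemma left_region : [set z : plane | 0 <= z.1 <= 4^-1] `<=` region S3.
Proof.
move=> z /= /andP[z0 z1]; split; first by apply/andP; split; lra.
move=> [i [j /hole_bounds[h1 h2 _ _]]].
have : (i < 0) && (-1 < i).
  by rewrite -(ltr_int R) -(ltr_int R (-1)) intrN; apply/andP; split; lra.
by move=> /andP[]; lia.
Qed.

Lemma right_region : [set z : plane | 3/4 <= z.1 <= 1] `<=` region S3.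
Proof.
move=> z /= /andP[z0 z1]; split; first by apply/andP; split; lra.
move=> [i [j /hole_bounds[h1 h2 _ _]]].
have : (i < 1) && (0 < i).
  by rewrite -(ltr_int R) -(ltr_int R 0); apply/andP; split; lra.
by move=> /andP[]; lia.
Qed.

Lemma bridge_region (m : int) :
  [set z : plane | (0 <= z.1 <= 1) && (m%:~R - 4^-1 <= z.2 <= m%:~R + 4^-1)] `<=` region S3.
Proof.
move=> z /= /andP[z01 /andP[z2 z3]]; split=> //.
move=> [i [j /hole_bounds[_ _ h1 h2]]].
have : (j < m) && (m - 1 < j).
  by rewrite -(ltr_int R) -(ltr_int R (m - 1)) intrB; apply/andP; split; lra.
by move=> /andP[]; lia.
Qed.

Lemma pt_le (x y : int) : x <= y -> x%:~R / 64 <= y%:~R / 64 :> R.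
Proof. by move=> xy; rewrite ler_pM2r ?invr_gt0 ?ltr0n// ler_int. Qed.

Lemma fitsbP a b c d : fitsb a b c d -> fits (pt a) (pt b) (pt c) (pt d).
Proof.
have all4 (T : eqType) (P : pred T) (x y z w : T) :
    all P [:: x; y; z; w] -> [/\ P x, P y, P z & P w].
  by move=> /= /and5P[].
move=> /or3P[/all4 H|/all4 H|/hasP[m _ /all4 H]].
- exists [set z : plane | 0 <= z.1 <= 4^-1]; split.
  + exact: left_region.
  + exact: left_convex.
  + have K (z : ipt) : (0 <= z.1) && (z.1 <= 16) -> 0 <= (pt z).1 <= 4^-1.
      move=> /andP[/pt_le z0 /pt_le z1]; rewrite mul0r in z0; rewrite z0 /=.
      by apply: le_trans z1 _; lra.
    by case: H => /K ? /K ? /K ? /K ?.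
- exists [set z : plane | 3/4 <= z.1 <= 1]; split.
  + exact: right_region.
  + exact: right_convex.
  + have K (z : ipt) : (48 <= z.1) && (z.1 <= 64) -> 3/4 <= (pt z).1 <= 1.
      move=> /andP[/pt_le z0 /pt_le z1]; apply/andP; split; rewrite /=; lra.
    by case: H => /K ? /K ? /K ? /K ?.
- exists [set z : plane | (0 <= z.1 <= 1) && (m%:~R - 4^-1 <= z.2 <= m%:~R + 4^-1)]; split.
  + exact: bridge_region.
  + exact: bridge_convex.
  + have K (z : ipt) : [&& 0 <= z.1, z.1 <= 64, m * 64 - 16 <= z.2 & z.2 <= m * 64 + 16] ->
        (0 <= (pt z).1 <= 1) && (m%:~R - 4^-1 <= (pt z).2 <= m%:~R + 4^-1).
      move=> /and4P[/pt_le z0 /pt_le z1 /pt_le z2 /pt_le z3].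
      rewrite intrB intrM in z2; rewrite intrD intrM in z3.
      by apply/andP; split; apply/andP; split; rewrite /=; lra.
    by case: H => /K ? /K ? /K ? /K ?.
Qed.

Lemma fits_checkP vs p ws j (m : int) : (0 < size vs)%N -> size ws = size vs ->
  fits_check vs p ws p j m ->
  edges_fit (PV vs p) (fun k => PV ws p (k - j) + (0, m%:~R)).
Proof.
move=> n0 sE /allP H; apply: (@edges_fit_period _ _ _ _ _ n0 (deck_vertical p)).
- exact: PV_quasi.
- by move=> k; rewrite addrAC -sE PV_quasi ?sE// addrAC.
move=> k kn; have /H/fitsbP : k \in iota 0 (size vs) by rewrite mem_iota.
by rewrite !(fun a => pt_iadd a (0, 64 * m)) pt_deck.
Qed.

Lemma steps_isteps (w : word) : steps S3 w = [seq pt a | a <- isteps w].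
Proof.
have E (x y : int) : pt (64 * x, 64 * y) = (x%:~R, y%:~R) :> plane.
  by apply: plane_eq; rewrite /= intrM mulrAC divff ?mul1r// pnatr_eq0.
have E1 := E 1 0; have E2 := E 0 1; have E3 := E (-1) 0; have E4 := E 0 (-1).
rewrite /steps /isteps map_flatten -map_comp; congr flatten; apply: eq_map => -[[] []] /=;
  rewrite /north /east /=.
- by rewrite /rev /= E4; congr [:: _]; apply: plane_eq; rewrite !planeE /=; ring.
- by rewrite E2.
- rewrite /rev /= E1 E2 E3; congr [:: _; _; _]; apply: plane_eq; rewrite !planeE /=; ring.
- rewrite E1 E4 E3; congr [:: _; _; _]; apply: plane_eq; rewrite !planeE /=; ring.
Qed.

Lemma isumE (vs : seq ipt) q : (q <= size vs)%N ->
  pt (isum vs q) = \sum_(k < q) nth 0 [seq pt a | a <- vs] k.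
Proof.
have pt0 : pt (0, 0) = 0 by apply: plane_eq; rewrite /= mul0r.
rewrite /isum; elim: vs q => [|a vs IH] [|q] //= qn; rewrite ?big_ord0//.
by rewrite big_ord_recl /= pt_iadd IH.
Qed.

Lemma represents_checkP vs p (w : word) j (m : int) (c : loop S3) :
  (forall u, c u = PL (PV vs p) ((size vs)%:R * u)) -> period c = (0, p%:~R) ->
  represents_check vs p w j m -> represents c w.
Proof.
move=> cE cP /and3P[/and4P[n0 /eqP sw fW /allP sub] /eqP sv fV].
have st : size (steps S3 w) = size (isteps w) by rewrite steps_isteps size_map.
have sV0 : (0 < size vs)%N by rewrite sv muln_gt0.
have sW0 : (0 < size (word_vertices w))%N by rewrite sw muln_gt0.
apply: (@represents_PL _ (0, p%:~R) (PV vs p) (PV (word_vertices w) p) j (0, m%:~R)).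
- by rewrite st.
- by rewrite st -sv.
- by [].
- exact: deck_vertical.
- by rewrite st -sv; exact: PV_quasi.
- by rewrite st -sw; exact: PV_quasi.
- move=> q; rewrite st => qn; have /sub/and3P[/eqP s0 s1 /eqP s2] : q \in iota 0 (size (isteps w)).
    by rewrite mem_iota.
  have S0 := isumE (ltnW qn); have S1 := isumE qn; rewrite big_ord_recr /= -S0 in S1.
  rewrite steps_isteps -S0 /=; split.
  + by rewrite /PV s0.
  + move: s1 => /eqP/(congr1 pt); rewrite [LHS]pt_iadd [RHS]pt_iadd S1 => s1.
    have s1' : 2 *: PV (word_vertices w) p (2 * q).+1%:Z =
        2 *: pt (isum (isteps w) q) + nth 0 [seq pt a | a <- isteps w] q.
      by rewrite scaler_nat mulr2n s1 scaler_nat mulr2n addrA.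
    rewrite -[LHS]scale1r -(@mulVf _ (2 : R)) ?pnatr_eq0// -scalerA s1' scalerDr scalerA.
    by rewrite mulVf ?pnatr_eq0// scale1r.
  + by rewrite /PV s2 S1.
- exact: deck_vertical.
- move: (fits_checkP sW0 erefl fW); congr edges_fit; apply/funext => k.
  by rewrite subr0; apply: plane_eq; rewrite !planeE addr0.
- by apply: fits_checkP => //; rewrite sw.
Qed.

End Soundness.

Section Crossings.
Variable R : realType.
Local Notation plane := (plane R).
Local Notation S3 := (Sigma30 R).
Local Notation pt := (pt R).
Local Notation PV := (PV R).
Implicit Types (vs ws : seq ipt) (a b : ipt) (p r : int).

(** Edges are half-open, so that a crossing at a vertex is found on one edge only, in accordance
    with [half_separated]. *)
Lemma PL_edge_uniq vs p u : (0 < size vs)%N -> 0 <= u < 1 ->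
  exists (i : nat) (t : R), [/\ (i < size vs)%N, 0 <= t < 1, u = (i%:R + t) / (size vs)%:R &
    PL (PV vs p) ((size vs)%:R * u) =
      PV vs p i%:Z + t *: (PV vs p (i%:Z + 1) - PV vs p i%:Z)].
Proof.
move=> n0 /andP[u0 u1]; set n := size vs in n0 *.
have ng0 : 0 < n%:R :> R by rewrite ltr0n.
have [k [t [/andP[t0 t1] xE _]]] := PLP (n%:R * u).
have k0 : 0 <= k.
  rewrite -ltzD1 -(ltr_int R) intrD; nra.
case: k k0 xE => // k _ xE; exists k, t; split=> //.
- by rewrite -(ltr_nat R); move: xE; rewrite -pmulrn; nra.
- by apply/andP; split; lra.
- by rewrite -[k%:R]/(k%:Z%:~R) -xE mulrAC divff ?mul1r ?gt_eqF.
- by rewrite xE PL_edge//; apply/andP; split; lra.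
Qed.

Lemma segment_le (x x' s z : R) : 0 <= s <= 1 -> x <= z -> x' <= z ->
  x + s * (x' - x) <= z.
Proof. by move=> /andP[s0 s1] xz x'z; nra. Qed.

Lemma segment_ge (x x' s z : R) : 0 <= s <= 1 -> z <= x -> z <= x' ->
  z <= x + s * (x' - x).
Proof. by move=> /andP[s0 s1] xz x'z; nra. Qed.

Lemma segment_lt (x x' s z : R) : 0 <= s < 1 -> x < z -> x' <= z ->
  x + s * (x' - x) < z.
Proof. by move=> /andP[s0 s1] xz x'z; nra. Qed.

Lemma segment_gt (x x' s z : R) : 0 <= s < 1 -> z < x -> z <= x' ->
  z < x + s * (x' - x).
Proof. by move=> /andP[s0 s1] xz x'z; nra. Qed.

Lemma segments_lt (x x' y y' s s' : R) : x < y -> x' < y -> x <= y' -> x' <= y' ->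
  0 <= s <= 1 -> 0 <= s' < 1 -> x + s * (x' - x) < y + s' * (y' - y).
Proof.
move=> xy x'y xy' x'y' s01 s'01; have [xx'|/ltW xx'] := leP x x'.
  by apply: le_lt_trans (segment_le s01 xx' (lexx _)) _; apply: segment_gt.
by apply: le_lt_trans (segment_le s01 (lexx _) xx') _; apply: segment_gt.
Qed.

Lemma half_separatedP a b a' b' (t t' : R) : half_separated a b a' b' ->
  0 <= t < 1 -> 0 <= t' < 1 ->
  pt a + t *: (pt b - pt a) = pt a' + t' *: (pt b' - pt a') -> False.
Proof.
move=> /hasP[l _ /=] + t01 t'01 E.
have tw : 0 <= t <= 1 by case/andP: t01 => -> /ltW ->.
have tw' : 0 <= t' <= 1 by case/andP: t'01 => -> /ltW ->.
have [E1 E2] : (pt a + t *: (pt b - pt a)).1 = (pt a' + t' *: (pt b' - pt a')).1 /\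
  (pt a + t *: (pt b - pt a)).2 = (pt a' + t' *: (pt b' - pt a')).2 by rewrite E.
rewrite !planeE /= in E1 E2.
pose F (z : ipt) : R := (l.1 * z.1 + l.2 * z.2)%:~R.
have {E1 E2}FE : F a + t * (F b - F a) = F a' + t' * (F b' - F a').
  have n64 : (64 : R) != 0 by rewrite pnatr_eq0.
  have lin x y (s : R) : F x + s * (F y - F x) = 64 * (l.1%:~R * (x.1%:~R / 64 + s * (y.1%:~R / 64 - x.1%:~R / 64))
     + l.2%:~R * (x.2%:~R / 64 + s * (y.2%:~R / 64 - x.2%:~R / 64))).
    by rewrite /F !intrD !intrM; field.
  by rewrite !lin E1 E2.
have ltF x y : l.1 * x.1 + l.2 * x.2 < l.1 * y.1 + l.2 * y.2 -> F x < F y by rewrite ltr_int.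
have leF x y : l.1 * x.1 + l.2 * x.2 <= l.1 * y.1 + l.2 * y.2 -> F x <= F y by rewrite ler_int.
case: ifP => [/ltF h1 /and3P[/ltF h2 /leF h3 /leF h4]|_ /and4P[/ltF h1 /ltF h2 /leF h3 /leF h4]].
  suff: F a + t * (F b - F a) < F a' + t' * (F b' - F a') by rewrite FE ltxx.
  exact: segments_lt.
suff: F a' + t' * (F b' - F a') < F a + t * (F b - F a) by rewrite FE ltxx.
exact: segments_lt.
Qed.

Lemma pt_inj_height vs p (i : nat) : heights_check vs p -> (i <= size vs)%N ->
  - (136 / 64) <= (PV vs p i%:Z).2 <= 136 / 64.
Proof.
move=> /allP H iv; have /H/andP[h1 h2] : i \in iota 0 (size vs).+1 by rewrite mem_iota ltnS.
have := pt_le R h1; have := pt_le R h2; rewrite /PV /pt /= => *.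
by apply/andP; split; lra.
Qed.

Lemma cross_checkP vs p ws r exc (c d : loop S3) x :
  (0 < size vs)%N -> (0 < size ws)%N ->
  (forall u, c u = PL (PV vs p) ((size vs)%:R * u)) ->
  (forall u, d u = PL (PV ws r) ((size ws)%:R * u)) ->
  cross_check vs p ws r exc -> crossings c d x ->
  exists (i j : nat) (m : int) (t t' : R),
   [/\ (i, j, m) \in exc, 0 <= t < 1, 0 <= t' < 1,
       x.1 = (i%:R + t) / (size vs)%:R /\ x.2 = (j%:R + t') / (size ws)%:R &
       PV vs p i%:Z + t *: (PV vs p (i%:Z + 1) - PV vs p i%:Z) =
       PV ws r j%:Z + t' *: (PV ws r (j%:Z + 1) - PV ws r j%:Z) + (0, m%:~R)].
Proof.
move=> n0 n'0 cE dE /and3P[hv hw /allP H] [x1 x2 [m mE]].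
have [i [t [iv t01 xE ciE]]] := PL_edge_uniq p n0 x1.
have [j [t' [jw t'01 x'E djE]]] := PL_edge_uniq r n'0 x2.
rewrite cE dE ciE djE in mE.
have E : PV vs p i%:Z + t *: (PV vs p (i%:Z + 1) - PV vs p i%:Z) =
       PV ws r j%:Z + t' *: (PV ws r (j%:Z + 1) - PV ws r j%:Z) + (0, m%:~R).
  by rewrite -mE [RHS]addrC subrK.
exists i, j, m, t, t'; split=> //.
have mr : m \in [:: -4; -3; -2; -1; 0; 1; 2; 3; 4].
  have e (k : nat) : k%:Z + 1 = k.+1%:Z by rewrite -addn1.
  have hi := pt_inj_height hv (ltnW iv); have hi' := pt_inj_height hv iv.
  have hj := pt_inj_height hw (ltnW jw); have hj' := pt_inj_height hw jw.
  have := congr1 snd E; rewrite -[_.2]/(_.2) -[X in _ = X]/(_.2) !planeE -[(0, m%:~R).2]/(m%:~R) !e.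
  have tw : 0 <= t <= 1 by case/andP: t01 => -> /ltW ->.
  have tw' : 0 <= t' <= 1 by case/andP: t'01 => -> /ltW ->.
  move: (PV vs p i%:Z).2 (PV vs p i.+1%:Z).2 (PV ws r j%:Z).2 (PV ws r j.+1%:Z).2 hi hi' hj hj'.
  move=> y y' z z' /andP[y1 y2] /andP[y3 y4] /andP[z1 z2] /andP[z3 z4].
  move: (segment_le tw y2 y4) (segment_ge tw y1 y3) (segment_le tw' z2 z4) (segment_ge tw' z1 z3).
  move: (y + _) (z + _) => Y Z {tw tw' t01 t'01 y1 y2 y3 y4 z1 z2 z3 z4 H ciE djE hv hw} Y1 Y2 Z1 Z2 EE.
  have : (m < 5) && (-5%:Z < m).
    by rewrite -(ltr_int R) -(ltr_int R (-5%:Z)) intrN; apply/andP; split; nra.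
  rewrite !inE => /andP[]; lia.
have /H/allP/(_ j)H1 : i \in iota 0 (size vs) by rewrite mem_iota.
have /H1/allP/(_ m mr) : j \in iota 0 (size ws) by rewrite mem_iota.
case: ifP => // _ /half_separatedP => /(_ t t' t01 t'01) []; rewrite -/(PV _ _ _) -/(PV _ _ (_ + _)) E.
rewrite !(fun a => pt_iadd R a (0, 64 * m)) pt_deck.
by apply: plane_eq; rewrite !planeE /=; ring.
Qed.

End Crossings.

(** * Loops and brackets under the quotient map *)

Section Transfer.
Variable R : realType.
Local Notation plane := (plane R).
Local Notation S3 := (Sigma30 R).
Local Notation S1 := (Sigma11 R).
Implicit Types (w : word) (c d e : loop S3) (rho : rep R).

Definition qword w : word :=
  flatten [seq if l.2 then winv (q_sharp l.1) else q_sharp l.1 | l <- w].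

(** An equality of lists, with no reduction of words: the marking of [X2] in the pants spells the
    steps of [q_sharp X2]. The same polygonal loop thus serves in both surfaces. *)
Lemma steps_qword w : steps S1 (qword w) = steps S3 w.
Proof.
elim: w => [//|l w IH].
have sc w1 w2 : steps S1 (w1 ++ w2) = steps S1 w1 ++ steps S1 w2.
  by rewrite /steps map_cat flatten_cat.
have -> : qword (l :: w) = (if l.2 then winv (q_sharp l.1) else q_sharp l.1) ++ qword w by [].
have -> : steps S3 (l :: w) = (if l.2 then [seq - v | v <- rev (marking S3 l.1)]
               else marking S3 l.1) ++ steps S3 w by [].
rewrite sc IH; congr (_ ++ _); case: l => -[] [] //=.
by rewrite /winv /rev /steps /= !opprK.
Qed.

Lemma eval_cat rho w1 w2 : Defs.eval rho (w1 ++ w2) = (Defs.eval rho w1 * Defs.eval rho w2)%g.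
Proof. by rewrite /Defs.eval big_cat. Qed.

Lemma eval_winv rho w : Defs.eval rho (winv w) = (Defs.eval rho w)^-1%g.
Proof.
elim: w => [|l w IH]; first by rewrite /winv /= !eval_nil invg1.
rewrite /winv rev_cons map_rcons -cats1 eval_cat -/(winv w) IH !eval_cons eval_nil mulg1 invgM.
by congr (_ * _)%g; case: l => -[] []; rewrite /eval_letter /= ?invgK.
Qed.

Lemma q_pull_trX w : q_pull (trX R w) = trX R (qword w).
Proof.
apply: CX_eqP => rho; rewrite -[LHS]/(\tr (SL3_mx (Defs.eval (q_star rho) w))).
rewrite -[RHS]/(\tr (SL3_mx (Defs.eval rho (qword w)))); congr (\tr (SL3_mx _)).
elim: w => [|l w IH]; first by rewrite /qword /= !eval_nil.
have -> : qword (l :: w) = (if l.2 then winv (q_sharp l.1) else q_sharp l.1) ++ qword w by [].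
rewrite eval_cons eval_cat IH; congr (_ * _)%g.
by case: l => -[] []; rewrite /eval_letter ?eval_winv.
Qed.

Lemma deck_glue (v : plane) : deck S3 v -> deck S1 v.
Proof. by move=> [n ->]; exists 0, n. Qed.

Definition glue_loop c : loop S1 := @Loop R S1 c (period c) (@loop_continuous _ _ c)
  (fun s => glue_region (@loop_region _ _ c s)) (deck_glue (@loop_deck _ _ c))
  (@loop_periodic _ _ c).

Lemma represents_glue c w : represents c w -> represents (glue_loop c) (qword w).
Proof.
move=> [d dE [H [v [Hc Hr Hp dv H01]]]]; exists (glue_loop d).
  by move=> u u01; rewrite steps_qword -dE.
exists H, v; split=> //; last exact: deck_glue.
by move=> z; exact: (glue_region (Hr z)).
Qed.

Definition inner c := forall u, 0 < (c u).1 < 1.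

(** The abscissas differ by less than 1, so an integral translation between the points is
    vertical. *)
Lemma inner_deck (z z' : plane) : 0 < z.1 < 1 -> 0 < z'.1 < 1 ->
  deck S1 (z - z') -> deck S3 (z - z').
Proof.
move=> /andP[z0 z1] /andP[z'0 z'1] [m [n E]].
have mE : z.1 - z'.1 = m%:~R by have := congr1 fst E.
have : (m < 1) && (-1 < m).
  by rewrite -(ltr_int R) -(ltr_int R (-1)) intrN -mE; apply/andP; split; lra.
move=> m01; have m0 : m = 0 by move: m01 => /andP[]; lia.
by exists n; rewrite E m0.
Qed.

Lemma crossings_glue c d : inner c -> inner d ->
  crossings (glue_loop c) (glue_loop d) = crossings c d.
Proof.
move=> ic id; apply/seteqP; split=> x [x1 x2 dx]; split=> //.
  by apply: inner_deck dx; [exact: ic|exact: id].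
exact: deck_glue.
Qed.

Lemma transverse_glue c d : inner c -> inner d -> transverse c d ->
  transverse (glue_loop c) (glue_loop d).
Proof.
move=> ic id [fin dbl tr]; split; rewrite crossings_glue//.
move=> x x' cx cx' dx; apply: dbl => //.
by apply: inner_deck dx; exact: ic.
Qed.

(** * Consequences of the product formula *)

Section Brackets.
Variables (S : surface R) (o : bool) (br : CX R -> CX R -> CX R).
Hypothesis brP : is_goldman_bracket S o br.

Lemma bracket_disjoint (c d : loop S) (u v : word) :
  represents c u -> represents d v -> crossings c d = set0 ->
  br (trX R u) (trX R v) = 0.
Proof.
move=> cu dv cd; have tr : transverse c d by split; rewrite cd.
rewrite (@goldman_formula _ _ _ _ brP _ _ _ _ cu dv tr (fun=> [::])).
- by rewrite cd fsbig_set0.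
- by rewrite cd.
Qed.

(** The crossings have opposite signs, so the terms in the product of the two traces cancel. *)
Lemma bracket_two_crossings (c d : loop S) (u v wx wy : word) (x y : R * R) (ex ey : loop S) :
  represents c u -> represents d v -> transverse c d ->
  crossings c d = [set x; y] -> x != y ->
  is_product c d x ex -> represents ex wx -> is_product c d y ey -> represents ey wy ->
  0 < det2 ('D_1 c x.1) ('D_1 d x.2) -> det2 ('D_1 c y.1) ('D_1 d y.2) < 0 ->
  br (trX R u) (trX R v) = (trX R wx - trX R wy) *~ (-1) ^+ o.
Proof.
move=> cu dv tr cd xy px rx py ry sx sy.
rewrite (@goldman_formula _ _ _ _ brP _ _ _ _ cu dv tr (fun p => if p == x then wx else wy)); last first.
  rewrite cd => p [->|->]; first by rewrite eqxx; exists ex.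
  by rewrite eq_sym (negPf xy); exists ey.
rewrite cd fsbigU//=; first last.
- by move=> z [-> /= E]; move: xy; rewrite E eqxx.
rewrite !fsbig_set1 eqxx eq_sym (negPf xy).
rewrite /crossing_sign /frame_sign gtr0_sgz// ltr0_sgz// mulr1 mulrN1 mulrNz -mulrzBl.
by congr (_ *~ _); rewrite opprB addrA subrK.
Qed.

End Brackets.
End Transfer.

(** * The explicit loops in the pair of pants *)

Definition loop_vertices k := (basic_loop k).1.1.1.
Definition loop_height k := (basic_loop k).1.1.2.
Definition loop_word k := (basic_loop k).1.2.

Definition inner_check (vs : seq ipt) : bool :=
  all (fun z : ipt => (0 < z.1) && (z.1 < 64)) vs.

Fact inner_checked : all (fun k => inner_check (loop_vertices k)) (iota 0 8).
Proof. by vm_compute. Qed.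

Section BasicLoops.
Variable R : realType.
Local Notation plane := (plane R).
Local Notation S3 := (Sigma30 R).
Local Notation S1 := (Sigma11 R).

Definition PL_like (vs : seq ipt) (p : int) (c : loop S3) :=
  (forall u, c u = PL (PV R vs p) ((size vs)%:R * u)) /\ period c = (0, p%:~R).

Lemma checked_loop vs p (w : word) j (m : int) : represents_check vs p w j m ->
  exists c : loop S3, PL_like vs p c /\ represents c w.
Proof.
move=> chk; have /and3P[/and4P[n0 /eqP sw _ _] /eqP sv fV] := chk.
have sV0 : (0 < size vs)%N by rewrite sv muln_gt0.
have fVV : edges_fit (PV R vs p) (PV R vs p).
  have f := fits_checkP R sV0 (etrans sw (esym sv)) fV.
  by move=> k; have [Q [QS Qc [Qa Qb _ _]]] := f k; exists Q.
have [cE cP] : PL_like vs p (PL_loop (deck_vertical R p) (PV_quasi R p sV0) fVV) by [].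
by exists (PL_loop (deck_vertical R p) (PV_quasi R p sV0) fVV); split=> //;
  exact: represents_checkP cE cP chk.
Qed.

Lemma inner_PL_like vs p c : (0 < size vs)%N -> inner_check vs -> PL_like vs p c -> inner c.
Proof.
move=> n0 /allP H [cE _] u; rewrite cE.
have V01 k : 0 < (PV R vs p k).1 < 1.
  rewrite /PV /vert; set i := absz _.
  have /H/andP[z0 z1] : nth (0, 0) vs i \in vs.
    apply: mem_nth; rewrite /i -ltz_nat gez0_abs ?modz_ge0 ?ltz_pmod//.
    by rewrite eqz_nat -lt0n.
  rewrite /pt /iadd /= addr0; move: (nth _ _ _).1 z0 z1 => a a0 a1.
  have a0' : 0 < a%:~R :> R by rewrite ltr0z.
  have a1' : a%:~R < 64 :> R by rewrite (ltr_int R a 64).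
  by apply/andP; split; lra.
have [k [t [/andP[t0 t1] -> _]]] := PLP ((size vs)%:R * u).
have tw : 0 <= t < 1 by rewrite t0.
rewrite PL_edge; last by rewrite t0 ltW.
rewrite !planeE; have /andP[a0 a1] := V01 k; have /andP[b0 b1] := V01 (k + 1).
by rewrite (segment_lt tw a1 (ltW b1)) (segment_gt tw a0 (ltW b0)).
Qed.

Lemma basic_loopP k : (k < 8)%N -> exists c : loop S3,
  [/\ PL_like (loop_vertices k) (loop_height k) c, inner c & represents c (loop_word k)].
Proof.
move=> k8; have k8' : k \in iota 0 8 by rewrite mem_iota.
have := allP basic_checked k k8'; have := allP inner_checked k k8'.
rewrite /basic_check /loop_vertices /loop_height /loop_word.
case: (basic_loop k) => [[[vs p] w] j] /= ichk chk.
have /and3P[/and4P[n0 _ _ _] /eqP sv _] := chk.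
have sV0 : (0 < size vs)%N by rewrite sv muln_gt0.
have [c [cP cw]] := checked_loop chk; exists c; split=> //.
exact: inner_PL_like cP.
Qed.

Lemma loop_vertices_gt0 k : (0 < size (loop_vertices k))%N.
Proof. by rewrite /loop_vertices; do 7 (case: k => [//|k]). Qed.

Lemma basic_disjoint k l (c d : loop S3) : (k < l)%N -> (k < 6)%N -> (l < 8)%N ->
  PL_like (loop_vertices k) (loop_height k) c ->
  PL_like (loop_vertices l) (loop_height l) d -> crossings c d = set0.
Proof.
move=> kl k6 l8 [cE _] [dE _].
have k8 : k \in iota 0 8 by rewrite mem_iota (leq_trans k6).
have l8' : l \in iota 0 8 by rewrite mem_iota.
have := allP (allP basic_crossed k k8) l l8'; rewrite kl k6 /= /basic_cross.
have := loop_vertices_gt0 k; have := loop_vertices_gt0 l; move: cE dE.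
rewrite /loop_vertices /loop_height.
case: (basic_loop k) => [[[vs p] w] j] /=; case: (basic_loop l) => [[[ws r] w'] j'] /=.
move=> cE dE m0 n0 chk; apply/eqP/negPn/negP => /set0P[x xcd].
by have [? [? [? [? [? []]]]]] := cross_checkP n0 m0 cE dE chk xcd.
Qed.

Section FigureEights.
Variables (c d : loop S3).
Hypothesis cP : PL_like t4_vertices 2 c.
Hypothesis dP : PL_like t4'_vertices (-2) d.
Let V := PV R t4_vertices 2.
Let W := PV R t4'_vertices (-2).

Let cE : forall u, c u = PL V (8%:R * u) := cP.1.
Let dE : forall u, d u = PL W (8%:R * u) := dP.1.

Definition xA : R * R := (0%:~R / 8%:R, 0%:~R / 8%:R).
Definition xB : R * R := (4%:~R / 8%:R, 4%:~R / 8%:R).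

Let V_A : V 0 = pt R (32, -4) /\ V (0 + 1) = pt R (8, 4).
Proof. by split; congr (pt R _); vm_compute. Qed.
Let V_B : V 4 = pt R (32, 68) /\ V (4 + 1) = pt R (56, 76).
Proof. by split; congr (pt R _); vm_compute. Qed.
Let W_A : W 0 = pt R (32, -4) /\ W (0 + 1) = pt R (8, -12).
Proof. by split; congr (pt R _); vm_compute. Qed.
Let W_B : W 4 = pt R (32, -60) /\ W (4 + 1) = pt R (56, -68).
Proof. by split; congr (pt R _); vm_compute. Qed.

Let c_at k : c (k%:~R / 8%:R) = V k.
Proof. by rewrite cE mulrCA divff ?pnatr_eq0// mulr1 PL_int. Qed.
Let d_at k : d (k%:~R / 8%:R) = W k.
Proof. by rewrite dE mulrCA divff ?pnatr_eq0// mulr1 PL_int. Qed.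

Lemma figure_eights_crossings : crossings c d = [set xA; xB].
Proof.
have [[VA VA'] [VB VB'] [WA WA'] [WB WB']] := And4 V_A V_B W_A W_B.
apply/seteqP; split=> x.
  move=> /(cross_checkP (isT : (0 < size t4_vertices)%N) (isT : (0 < size t4'_vertices)%N)
    cP.1 dP.1 crossed67).
  move=> [i [j [m [t [t' [+ t01 t'01 [x1 x2] E]]]]]].
  have := congr1 snd E; rewrite -[LHS]/(_.2) -[RHS]/(_.2) !planeE -[(0, m%:~R).2]/(m%:~R : R).
  move: t01 t'01 => /andP[t0 _] /andP[t'0 _].
  rewrite !inE => + /orP[] /eqP[ei ej em]; rewrite {}ei {}ej {}em in x1 x2 *.
  + rewrite -/V -/W VA VA' WA WA' /pt /= => E2; left.
    (* From the common vertex one path rises and the other falls, so the second coordinate alone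
       forces both parameters to be 0. *)
    have [te te'] : t = 0 /\ t' = 0 by split; lra.
    by rewrite [x]surjective_pairing x1 x2 te te' !addr0.
  + rewrite -/V -/W VB VB' WB WB' /pt /= => E2; right.
    have [te te'] : t = 0 /\ t' = 0 by split; lra.
    by rewrite [x]surjective_pairing x1 x2 te te' !addr0.
have hA : 0 <= ((0 : int)%:~R / 8%:R : R) < 1 by rewrite mul0r lexx ltr01.
have hB : 0 <= ((4 : int)%:~R / 8%:R : R) < 1 by apply/andP; split; lra.
move=> [->|->]; split=> //.
  rewrite -[xA.1]/((0 : int)%:~R / 8%:R) -[xA.2]/((0 : int)%:~R / 8%:R) c_at d_at VA WA subrr.
  by exists 0.
rewrite -[xB.1]/((4 : int)%:~R / 8%:R) -[xB.2]/((4 : int)%:~R / 8%:R) c_at d_at VB WB.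
by exists 2; apply: plane_eq; rewrite !planeE /=; lra.
Qed.

Let straight_AB k : k \in [:: 0; 4] -> straight V k /\ straight W k.
Proof.
move=> /(allP straight67)/andP[/andP[/eqP v1 /eqP v2] /andP[/eqP w1 /eqP w2]].
have E (a a' b : ipt) : a.1 - a'.1 = a'.1 - b.1 -> a.2 - a'.2 = a'.2 - b.2 ->
    pt R a - pt R a' = pt R a' - pt R b.
  move=> e1 e2; apply: plane_eq; rewrite !planeE /= -!mulrBl -!intrB.
    by rewrite e1.
  by rewrite e2.
by split; apply: E.
Qed.

Let derive_c k : k \in [:: 0; 4] ->
  is_derive (k%:~R / 8%:R : R) 1 c (8%:R *: (V (k + 1) - V k)).
Proof.
by move=> /straight_AB[Vk _]; rewrite (funext cE); exact: PL_is_derive.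
Qed.

Let derive_d k : k \in [:: 0; 4] ->
  is_derive (k%:~R / 8%:R : R) 1 d (8%:R *: (W (k + 1) - W k)).
Proof.
by move=> /straight_AB[_ Wk]; rewrite (funext dE); exact: PL_is_derive.
Qed.

Lemma figure_eights_det :
  0 < det2 ('D_1 c xA.1) ('D_1 d xA.2) /\ det2 ('D_1 c xB.1) ('D_1 d xB.2) < 0.
Proof.
have [[VA VA'] [VB VB'] [WA WA'] [WB WB']] := And4 V_A V_B W_A W_B.
have := @derive_val _ _ _ _ _ _ _ (derive_c (mem_head _ _)).
rewrite VA VA' => cA; have := @derive_val _ _ _ _ _ _ _ (derive_d (mem_head _ _)).
rewrite WA WA' => dA; have := @derive_val _ _ _ _ _ _ _ (derive_c (mem_last _ [:: 4])).
rewrite VB VB' => cB; have := @derive_val _ _ _ _ _ _ _ (derive_d (mem_last _ [:: 4])).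
rewrite WB WB' => dB.
rewrite -[xA.1]/((0 : int)%:~R / 8%:R) -[xA.2]/((0 : int)%:~R / 8%:R).
rewrite -[xB.1]/((4 : int)%:~R / 8%:R) -[xB.2]/((4 : int)%:~R / 8%:R).
by rewrite cA dA cB dB /det2 !planeE /pt /=; split; lra.
Qed.

Lemma figure_eights_transverse : transverse c d.
Proof.
rewrite /transverse figure_eights_crossings; split.
- exact: finite_set2.
- have [[VA _] [VB _] _ _] := And4 V_A V_B W_A W_B.
  (* The heights of [c] at the two crossings are -4/64 and 68/64; their difference is not an
     integer, so the crossings are distinct points of the surface. *)
  have AB (s : R) : s = 72 \/ s = - 72 -> ~ deck S3 (0, s / 64).
    move=> sE [n nE]; have {nE} : s / 64 = n%:~R := congr1 snd nE.
    case: sE => -> sn.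
      have : (n < 2) && (1 < n).
        by rewrite -(ltr_int R) -(ltr_int R 1) -sn; apply/andP; split; lra.
      by move=> /andP[]; lia.
    have : (n < -1) && (-2%:Z < n).
      by rewrite -(ltr_int R) -(ltr_int R (-2%:Z)) !intrN -sn; apply/andP; split; lra.
    by move=> /andP[]; lia.
  have cAB (x y : R * R) : x = xA -> y = xB ->
      ~ deck S3 (c x.1 - c y.1) /\ ~ deck S3 (c y.1 - c x.1).
    move=> -> ->; rewrite -[xA.1]/((0 : int)%:~R / 8%:R) -[xB.1]/((4 : int)%:~R / 8%:R).
    rewrite !c_at VA VB; split.
    + rewrite (_ : _ - _ = (0, -72 / 64)); first by apply: AB; right.
      by apply: plane_eq; rewrite !planeE /=; lra.
    + rewrite (_ : _ - _ = (0, 72 / 64)); first by apply: AB; left.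
      by apply: plane_eq; rewrite !planeE /=; lra.
  move=> x y [->|->] [->|->] //.
    by have [] := cAB _ _ erefl erefl.
  by have [] := cAB _ _ erefl erefl.
- have [dA dB] := figure_eights_det; move=> x [->|->]; split.
  + exact: (@ex_derive _ _ _ _ _ _ _ (derive_c (mem_head _ _))).
  + exact: (@ex_derive _ _ _ _ _ _ _ (derive_d (mem_head _ _))).
  + by rewrite gt_eqF.
  + exact: (@ex_derive _ _ _ _ _ _ _ (derive_c (mem_last _ [:: 4]))).
  + exact: (@ex_derive _ _ _ _ _ _ _ (derive_d (mem_last _ [:: 4]))).
  + by rewrite lt_eqF.
Qed.

Lemma figure_eights_product us i (e : loop S3) : (0 < size us)%N -> size us = 16 ->
  product_check us i i -> PL_like us 0 e ->
  is_product c d (i%:~R / 8%:R, i%:~R / 8%:R) e.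
Proof.
move=> _ s16 /allP H [eE _].
apply: (@is_product_PL R 8 (0, 2%:~R) (0, (-2)%:~R) V W (PV R us 0)) => //.
- by move=> u; rewrite eE s16.
- exact: (PV_quasi R 2 (isT : (0 < size t4_vertices)%N)).
- exact: (PV_quasi R (-2) (isT : (0 < size t4'_vertices)%N)).
- move=> k k8; have /H/andP[/eqP h _] : k \in iota 0 9 by rewrite mem_iota.
  by rewrite /V /PV -h.
- move=> k k8; have /H/andP[_ /eqP h] : k \in iota 0 9 by rewrite mem_iota.
  rewrite /PV h [LHS]pt_iadd; congr (_ + _).
  rewrite [LHS]pt_iadd -/(V i) -addrA; congr (_ + _).
  rewrite [LHS]pt_iadd (pt_deck R 2); congr (_ + _).
  by apply: plane_eq; rewrite !planeE /= intrN mulNr.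
Qed.

End FigureEights.

End BasicLoops.

(** * Closed points and ranks *)

Section Evaluation.
Variable R : realType.
Local Notation C := (R[i]).

Definition evaluation (rho : rep R) (f : CX R) : C := f rho.

Fact evaluation_linear rho : GRing.linear_for *%R (evaluation rho).
Proof. by []. Qed.
HB.instance Definition _ rho := GRing.isLinear.Build C (CX R) C *%R (evaluation rho)
  (evaluation_linear rho).
Fact evaluation_monoid rho : monoid_morphism (evaluation rho).
Proof. by []. Qed.
HB.instance Definition _ rho := GRing.isMonoidMorphism.Build (CX R) C (evaluation rho)
  (evaluation_monoid rho).
Definition point_of (rho : rep R) : closed_point R := evaluation rho.

(** A nonempty open set contains a point with [f] nonzero for some [f] of its family. In a domain
    [f * w] is then nonzero, so some representation, viewed as a closed point, lies in both sets. *)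
Lemma zariski_denseP (w : CX R) : w != 0 -> zariski_dense [set x : closed_point R | x w != 0].
Proof.
move=> w0 V [S ->] [x [f Sf xf]].
have f0 : f != 0 by apply: contra_neq xf => ->; rewrite rmorph0.
have [rho frho] : exists rho, (f * w) rho != 0.
  apply: contrapT => H; have /CX_mulf_eq0[/eqP|/eqP] : f * w = 0; rewrite ?(negPf f0) ?(negPf w0)//.
  apply: CX_eqP => rho; apply/eqP/negPn/negP => nz; apply: H; by exists rho.
have : f rho * w rho != 0 := frho.
rewrite mulf_eq0 negb_or => /andP[f1 w1].
by exists (point_of rho); split=> //; exists f.
Qed.

(** Nothing is assumed on row 8, that of t_(5): antisymmetry makes it the combination of rows 6 and
    7 recorded in [L]. The block on 6 and 7 gives the lower bound. *)
Lemma rank2_antisym (F : fieldType) (M : 'M[F]_9) : (forall i j, M i j = - M j i) ->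
  (2 : F) != 0 ->
  (forall (i j : 'I_9), (i < 6)%N -> M i j = 0) -> M (@Ordinal 9 6 isT) (@Ordinal 9 7 isT) != 0 ->
  \rank M = 2.
Proof.
set i6 := Ordinal _; set i7 := Ordinal _; pose i8 := @Ordinal 9 8 isT.
move=> anti c2 zero a0; set a := M i6 i7 in a0.
have diag i : M i i = 0.
  apply/eqP; have := anti i i => /eqP; rewrite -addr_eq0 -mulr2n -mulr_natl mulf_eq0.
  by rewrite (negPf c2).
have iP (i : 'I_9) : [\/ (i < 6)%N, i = i6, i = i7 | i = i8].
  case: i => -[|[|[|[|[|[|[|[|[|//]]]]]]]]] p; try by constructor 1.
  - by constructor 2; apply: val_inj.
  - by constructor 3; apply: val_inj.
  - by constructor 4; apply: val_inj.
pose N : 'M[F]_(2, 9) := \matrix_(i, j) (if i == 0 then M i6 j else M i7 j).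
pose L : 'M[F]_(9, 2) := \matrix_(i, j)
  (if i == i6 then (j == 0)%:R else if i == i7 then (j != 0)%:R
   else if i == i8 then (if j == 0 then - M i7 i8 / a else M i6 i8 / a) else 0).
have ME : M = L *m N.
  apply/matrixP => i j; rewrite mxE !big_ord_recl big_ord0 addr0 !mxE /=.
  have [i_6|->|->|->] := iP i.
  - rewrite zero// !ifF ?mul0r ?addr0//; apply/negP => /eqP e; by rewrite e in i_6.
  - by rewrite /= mul1r mul0r addr0.
  - by rewrite /= mul1r mul0r add0r.
  - rewrite /=; have [j_6|->|->|->] := iP j.
    + by rewrite (anti _ j) (anti i6 j) (anti i7 j) !(zero j)// oppr0 !mulr0 addr0.
    + rewrite diag (anti i7 i6) -/a mulr0 add0r (anti i8) mulrN divfK//.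
    + by rewrite diag -/a mulr0 addr0 (anti i8) divfK.
    + by rewrite diag; field.
apply/eqP; rewrite eqn_leq; apply/andP; split.
  by rewrite ME; apply: leq_trans (mulmx_max_rank _ _) _.
pose f (i : 'I_2) : 'I_9 := if i == 0 then i6 else i7.
have rk : \rank (mxsub f f M) = 2.
  apply: mxrank_unit; rewrite unitmxE det2E !mxE /= unitfE.
  by rewrite !diag mul0r sub0r (anti i7) mulrN opprK mulf_neq0.
rewrite -rk -[M in mxsub _ _ M]mulmx1 mxsub_mul rowsubE.
by apply: leq_trans (mxrankM_maxl _ _) _; exact: mxrankM_maxr.
Qed.

End Evaluation.

(** * The brackets of the nine traces *)

Section Main.
Variable R : realType.
Local Notation T k := (@tn R k isT).

Lemma tn_trX k (k9 : (k < 9)%N) : (k < 8)%N -> tn R k9 = trX R (loop_word k).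
Proof. by do 8 (case: k k9 => [//|k] k9). Qed.

Lemma trX_cyclic u v : trX R (u ++ v) = trX R (v ++ u).
Proof.
apply: CX_eqP => rho; rewrite !trXE !eval_cat !SL3_mulE; exact: mxtrace_mulC.
Qed.

Lemma trX_word_A : trX R word_A = t5' R.
Proof. exact: (trX_cyclic [:: (X1, false); (X2, true); (X1, true)] [:: (X2, false)]). Qed.

Lemma trX_word_B : trX R word_B = T 8.
Proof. exact: (trX_cyclic [:: (X2, true)] [:: (X1, false); (X2, false); (X1, true)]). Qed.

Lemma antisym_diag (br : CX R -> CX R -> CX R) f : (forall f g, br f g = - br g f) -> br f f = 0.
Proof.
move=> anti; apply: CX_eqP => rho.
have := congr1 (fun h : CX R => h rho) (anti f f).
have -> : (- br f f) rho = - (br f f rho) by [].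
move=> /eqP; rewrite -addr_eq0 -mulr2n -mulr_natl mulf_eq0 pnatr_eq0 /= => /eqP ->.
by [].
Qed.

Section Brackets.
Variables (o3 o1 : bool) (br3 br1 : CX R -> CX R -> CX R).
Hypothesis h3 : is_goldman_bracket (Sigma30 R) o3 br3.
Hypothesis h1 : is_goldman_bracket (Sigma11 R) o1 br1.

(** Disjoint loops are supplied for [k < l] only; antisymmetry settles the rest, so no loop has to
    be displaced from itself. *)
Lemma boundary_traces_disjoint k l (k9 : (k < 9)%N) (l9 : (l < 9)%N) : (k < 6)%N -> (l < 8)%N ->
  br3 (tn R k9) (tn R l9) = 0 /\ br1 (q_pull (tn R k9)) (q_pull (tn R l9)) = 0.
Proof.
have lt k' l' (k9' : (k' < 9)%N) (l9' : (l' < 9)%N) : (k' < l')%N -> (k' < 6)%N -> (l' < 8)%N ->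
  br3 (tn R k9') (tn R l9') = 0 /\ br1 (q_pull (tn R k9')) (q_pull (tn R l9')) = 0.
  move=> kl k6 l8; have k8 := leq_trans k6 (isT : (6 <= 8)%N).
  have [c [cP ic cw]] := basic_loopP R k8; have [d [dP id dw]] := basic_loopP R l8.
  have cd := basic_disjoint kl k6 l8 cP dP.
  rewrite (tn_trX k9')// (tn_trX l9')// !q_pull_trX; split.
    exact: (bracket_disjoint h3 cw dw cd).
  apply: (bracket_disjoint h1 (represents_glue cw) (represents_glue dw)).
  by rewrite crossings_glue.
move=> k6 l8; have [kl|lk|kl] := ltngtP k l.
- exact: lt.
- have l6 := ltn_trans lk k6; have k8 := leq_trans k6 (isT : (6 <= 8)%N).
  have [e3 e1] := lt _ _ l9 k9 lk l6 k8.
  by rewrite (goldman_antisym h3) e3 (goldman_antisym h1) e1 oppr0.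
- have -> : tn R l9 = tn R k9 by rewrite /tn; congr (t_ R _); apply: val_inj.
  split; apply: antisym_diag; [exact: goldman_antisym h3|exact: goldman_antisym h1].
Qed.

Lemma figure_eights_bracket :
  br3 (T 6) (T 7) = (t5' R - T 8) *~ (-1) ^+ o3 /\
  br1 (q_pull (T 6)) (q_pull (T 7)) = q_pull (t5' R - T 8) *~ (-1) ^+ o1.
Proof.
have [c [cP ic cw]] := @basic_loopP R 6 isT; have [d [dP id dw]] := @basic_loopP R 7 isT.
have [eA [eAP eAw]] := checked_loop R product_A_checked.
have [eB [eBP eBw]] := checked_loop R product_B_checked.
have pA := figure_eights_product cP dP (isT : (0 < size product_A)%N) erefl product_A_product eAP.
have pB := figure_eights_product cP dP (isT : (0 < size product_B)%N) erefl product_B_product eBP.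
have cr := figure_eights_crossings cP dP; have tr := figure_eights_transverse cP dP.
have [dA dB] := figure_eights_det cP dP.
have xAB : xA R != xB R.
  apply/eqP => /(congr1 fst); rewrite /xA /xB /= => /eqP.
  by rewrite mul0r eq_sym mulf_eq0 invr_eq0 !pnatr_eq0.
rewrite (tn_trX (k := 6))// (tn_trX (k := 7))// -trX_word_A -trX_word_B; split.
  exact: (bracket_two_crossings h3 cw dw tr cr xAB pA eAw pB eBw dA dB).
rewrite raddfB /= !q_pull_trX.
have pA' : is_product (glue_loop c) (glue_loop d) (xA R) (glue_loop eA) by exact: pA.
have pB' : is_product (glue_loop c) (glue_loop d) (xB R) (glue_loop eB) by exact: pB.
have cr' : crossings (glue_loop c) (glue_loop d) = [set xA R; xB R] by rewrite crossings_glue.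
exact: (bracket_two_crossings h1 (represents_glue cw) (represents_glue dw)
  (transverse_glue ic id tr) cr' xAB pA' (represents_glue eAw) pB' (represents_glue eBw) dA dB).
Qed.

Let eps : int := (-1) ^+ o1 * (-1) ^+ o3.

Lemma q_pull_generators k l (k9 : (k < 9)%N) (l9 : (l < 9)%N) : (k < 8)%N -> (l < 8)%N ->
  br1 (q_pull (tn R k9)) (q_pull (tn R l9)) = q_pull (br3 (tn R k9) (tn R l9)) *~ eps.
Proof.
move=> k8 l8; have [k6|k6] := ltnP k 6.
  by have [-> ->] := boundary_traces_disjoint k9 l9 k6 l8; rewrite raddf0 mul0rz.
have [l6|l6] := ltnP l 6.
  have [e3 e1] := boundary_traces_disjoint l9 k9 l6 k8.
  by rewrite (goldman_antisym h1) (goldman_antisym h3) e1 e3 oppr0 raddf0 mul0rz.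
have E67 : br1 (q_pull (T 6)) (q_pull (T 7)) = q_pull (br3 (T 6) (T 7)) *~ eps.
  have [-> ->] := figure_eights_bracket.
  rewrite raddfMz -mulrzA; congr (_ *~ _); rewrite /eps.
  by case: (o1); case: (o3).
have kE : tn R k9 = T 6 \/ tn R k9 = T 7.
  move: k6 k8; do 6 (case: k k9 => [//|k] k9).
  case: k k9 => [|[|//]] k9 _ _; [left|right]; congr (t_ R _); exact: val_inj.
have lE : tn R l9 = T 6 \/ tn R l9 = T 7.
  move: l6 l8; do 6 (case: l l9 => [//|l] l9).
  case: l l9 => [|[|//]] l9 _ _; [left|right]; congr (t_ R _); exact: val_inj.
case: kE => ->; case: lE => -> //.
- by rewrite !antisym_diag ?raddf0 ?mul0rz//; [exact: goldman_antisym h3|exact: goldman_antisym h1].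
- by rewrite (goldman_antisym h1) (goldman_antisym h3) E67 raddfN mulNrz.
- by rewrite !antisym_diag ?raddf0 ?mul0rz//; [exact: goldman_antisym h3|exact: goldman_antisym h1].
Qed.

Lemma bracket_linear S o br (h : is_goldman_bracket S o br) g (x : R[i]) (f f' : CX R) :
  br (x *: f + f') g = x *: br f g + br f' g.
Proof. exact: (goldman_linear h g x f f'). Qed.

(** For fixed [g] this is a derivation along [q_pull], so [derivation_eq0] applies, with [rho0]
    lying over [rho1]. *)
Let defect g f := br1 (q_pull f) (q_pull g) - q_pull (br3 f g) *~ eps.

Let defect_eq0 g : (forall k (k9 : (k < 9)%N), (k < 8)%N -> defect g (tn R k9) = 0) ->
  forall f, defect g f = 0.
Proof.
move=> H; have := @derivation_eq0 R (@q_pull R) (defect g); apply=> //.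
- by exists (rho0 R).
- exact: rmorph1.
- move=> x f f'; rewrite /defect linearP (bracket_linear h1) (bracket_linear h3) linearP.
  by rewrite mulrzDl scalerBr -scalerMzr opprD addrACA.
- move=> f f'; rewrite /defect rmorphM (goldman_leibniz h1) (goldman_leibniz h3) rmorphD !rmorphM /=.
  by rewrite mulrzDl -mulrzAr -mulrzAl opprD addrACA -mulrBr -mulrBl.
Qed.

(** The derivation argument is used in each variable in turn, antisymmetry exchanging them. *)
Lemma q_pull_bracket f g : br1 (q_pull f) (q_pull g) = q_pull (br3 f g) *~ eps.
Proof.
apply/eqP; rewrite -subr_eq0; apply/eqP; rewrite -/(defect g f).
apply: defect_eq0 => k k9 k8; rewrite /defect (goldman_antisym h1) (goldman_antisym h3 _ g).
rewrite raddfN mulNrz -opprD; apply/eqP; rewrite oppr_eq0; apply/eqP; rewrite -/(defect _ g).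
by apply: defect_eq0 => l l9 l8; rewrite /defect q_pull_generators// subrr.
Qed.

(** The derivation argument along the identity; in particular it covers the bracket with t_(5), for
    which there is no loop. *)
Lemma boundary_traces_casimir k (k9 : (k < 9)%N) f : (k < 6)%N -> br3 (tn R k9) f = 0.
Proof.
move=> k6; rewrite (goldman_antisym h3).
suff -> : br3 f (tn R k9) = 0 by rewrite oppr0.
apply: (@derivation_eq0 R id (br3^~ (tn R k9))).
- by exists (rho1 R).
- by [].
- exact: goldman_linear h3 _.
- by move=> g g'; rewrite (goldman_leibniz h3).
- move=> l l9 l8; rewrite (goldman_antisym h3).
  by have [-> _] := boundary_traces_disjoint k9 l9 k6 l8; rewrite oppr0.
Qed.

Lemma t5_t5'_rho1 : (t5' R - T 8) (rho1 R) != 0.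
Proof. by rewrite [X in X != 0](_ : _ = t5' R (rho1 R) - T 8 (rho1 R))// subr_eq0 eq_sym rho1_t5. Qed.

Lemma CX_mulrz_neq0 (h : CX R) (n : nat) : h != 0 -> h *~ (-1) ^+ n != 0.
Proof. by rewrite -signr_odd; case: (odd n); rewrite ?expr0 ?expr1 ?mulr1z ?mulrNz ?oppr_eq0. Qed.

(** The second part is not a consequence of the first, as [q_star] is not dominant; it is read off
    at [rho0], which [q_star] sends to [rho1]. *)
Lemma bracket67_neq0 : br3 (T 6) (T 7) != 0 /\ q_pull (br3 (T 6) (T 7)) != 0.
Proof.
have [-> _] := figure_eights_bracket; rewrite raddfMz.
split; apply: CX_mulrz_neq0.
  by apply: contra_neq t5_t5'_rho1 => ->.
have E : (q_pull (t5' R - T 8)) (rho0 R) != 0 by exact: t5_t5'_rho1.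
by apply: contra_neq E => ->.
Qed.

Lemma rank30_eq2 (x : closed_point R) : x (br3 (T 6) (T 7)) != 0 -> rank30 br3 x = 2.
Proof.
move=> nz; apply: rank2_antisym.
- by move=> i j; rewrite !mxE (goldman_antisym h3) rmorphN.
- by rewrite pnatr_eq0.
- move=> i j i6; rewrite mxE (_ : t_ R i = tn R (ltn_ord i)); last first.
    by rewrite /tn; congr (t_ R _); apply: val_inj.
  by rewrite boundary_traces_casimir// rmorph0.
- by rewrite mxE.
Qed.

Lemma rank11_eq2 (x : closed_point R) : x (q_pull (br3 (T 6) (T 7))) != 0 ->
  rank11_restricted br1 x = 2.
Proof.
move=> nz; apply: rank2_antisym.
- by move=> i j; rewrite !mxE (goldman_antisym h1) rmorphN.
- by rewrite pnatr_eq0.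
- move=> i j i6; rewrite mxE (_ : t_ R i = tn R (ltn_ord i)); last first.
    by rewrite /tn; congr (t_ R _); apply: val_inj.
  by rewrite q_pull_bracket boundary_traces_casimir// raddf0 mul0rz rmorph0.
- rewrite mxE q_pull_bracket raddfMz /eps; case: (o1); case: (o3);
  by rewrite ?(expr0, expr1, mulr1, mul1r, mulrNN, mulr1z, mulrNz, oppr_eq0, mulrN1).
Qed.

Lemma generic_rank : exists U : set (closed_point R),
  [/\ zariski_open U, zariski_dense U &
      forall x, U x -> rank11_restricted br1 x = rank30 br3 x].
Proof.
have [w0 qw0] := bracket67_neq0; set w := br3 _ _ in w0 qw0.
(* The two factors control the two ranks, each of which is 2 on this set. *)
exists [set x : closed_point R | x (w * q_pull w) != 0]; split.
- exists [set w * q_pull w]; apply/seteqP; split=> x /=.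
    by exists (w * q_pull w).
  by move=> [_ ->].
- apply: zariski_denseP; apply/eqP => /CX_mulf_eq0[/eqP|/eqP]; apply/negP => //.
- move=> x /=; rewrite rmorphM mulf_eq0 negb_or => /andP[nz qnz].
  by rewrite rank30_eq2// rank11_eq2.
Qed.

(** The orientation conditions quantify over interior points; this one allows their sign to be read
    off. *)
Lemma interior_Sigma30 : (region (Sigma30 R))° ((8^-1, 8^-1) : plane R).
Proof.
have : \forall z \near ((8^-1, 8^-1) : plane R), [set z : plane R | 0 <= z.1 <= 4^-1] z.
  have c1 : (z : plane R).1 @[z --> ((8^-1, 8^-1) : plane R)] --> (8^-1 : R) by exact: cvg_fst.
  have n1 : \forall s \near (8^-1 : R), 0 < s by apply: lt_nbhsr; rewrite invr_gt0.
  have n2 : \forall s \near (8^-1 : R), s < 4^-1 by apply: lt_nbhsl; lra.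
  near=> z; apply/andP; split; apply: ltW; near: z; [exact: c1 n1|exact: c1 n2].
apply: filterS => z; exact: left_region.
Unshelve. all: by end_near. Qed.

Lemma frame_sign_glue (o : bool) z (u v : plane R) :
  frame_sign o ('d (@Defs.glue R) z u) ('d (@Defs.glue R) z v) = frame_sign o u v.
Proof. by have -> : 'd (@Defs.glue R) z = id :> (plane R -> plane R) by exact: diff_val. Qed.

Lemma frame_sign_east_north (o : bool) : frame_sign o (east R) (north R) = (-1) ^+ o.
Proof.
rewrite /frame_sign (_ : det2 _ _ = 1) ?sgz1 ?mulr1//.
by rewrite /det2 /east /north /=; ring.
Qed.

End Brackets.
End Main.

Theorem theorem1 (R : realType) (o3 o1 : bool)
    (br3 br1 : CX R -> CX R -> CX R)
    (h3 : is_goldman_bracket (Sigma30 R) o3 br3)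
    (h1 : is_goldman_bracket (Sigma11 R) o1 br1) :
  [/\ poisson_morphism br3 br1 \/ anti_poisson_morphism br3 br1,
      glue_preserves_orientation R o3 o1 -> poisson_morphism br3 br1 &
      glue_reverses_orientation R o3 o1 -> anti_poisson_morphism br3 br1]
  /\ exists U : set (closed_point R),
       [/\ zariski_open U, zariski_dense U &
           forall x, U x -> rank11_restricted br1 x = rank30 br3 x].
Proof.
split; last exact: generic_rank h3 h1.
have qE := q_pull_bracket h3 h1.
have same : o3 = o1 -> poisson_morphism br3 br1.
  by move=> e f g; rewrite qE e -signr_addb addbb mulr1z.
have opp : o3 != o1 -> anti_poisson_morphism br3 br1.
  by move=> e f g; rewrite qE -signr_addb (_ : o1 (+) o3 = true) ?expr1 ?mulrNz ?mulr1z//; move: e; case: (o1); case: (o3).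
split.
- by have [/same|/opp] := eqVneq o3 o1; [left|right].
- move=> /(_ _ (interior_Sigma30 R) (east R) (north R)); rewrite frame_sign_glue !frame_sign_east_north.
  by move=> e; apply: same; move: e; case: (o1); case: (o3).
- move=> /(_ _ (interior_Sigma30 R) (east R) (north R)); rewrite frame_sign_glue !frame_sign_east_north.
  by move=> e; apply: opp; move: e; case: (o1); case: (o3).
Qed.
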